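(* Let $B=\{B_t,t\ge0\}$ be a standard Brownian motion. Assume $u=\{u_t,t\ge0\}$ is an adapted, square integrable process, continuous at a fixed time $t\ge0$ in the $L^2(\Omega)$ sense. Consider a nonnegative continuous and bounded function $\psi(x)$ on $\mathbb{R}$ such that $\int_{-\infty}^\infty\psi^2(x)\,dx=1$ and $\psi^2(x)=o(|x|^{-1})$ as $|x|\to\infty$. Let $\psi_n(x)=\sqrt n\,\psi(nx)$. Then the stochastic convolution $$(u*_B\psi_n)_t=\int_0^\infty u_s\psi_n(t-s)\,dB_s$$ converges stably to $u_tZ$ as $n\to\infty$, where $Z$ is a standard Gaussian random variable independent of $B$.
   Context: The Brownian motion $B$ is defined on a probability space $(\Omega,\mathcal{F},P)$, where $\mathcal{F}$ is the $P$-completion of the $\sigma$-field generated by $B$; adaptedness is with respect to the natural filtration of $B$, and ''square integrable'' means $E\int_0^\infty u_s^2\,ds<\infty$. Stable convergence: random variables $F_n$ on $(\Omega,\mathcal{F},P)$ with values in $\mathbb{R}^d$ converge stably to an $\mathbb{R}^d$-valued random variable $F$, defined on some extended probability space $(\Omega',\mathcal{F}',P')$, if $$\lim_{n\to\infty}E\left[Ye^{i\langle\lambda,F_n\rangle_{\mathbb{R}^d}}\right]=E'\left[Ye^{i\langle\lambda,F\rangle_{\mathbb{R}^d}}\right]$$ for every $\lambda\in\mathbb{R}^d$ and every bounded $\mathcal{F}$-measurable random variable $Y$. The variable $Z$ lives on such an extension.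
   Formalization: At t = 0 the claim is false as stated (the limit variance is the integral of ψ² over (-∞,0], times u_0²), so for t = 0 only it is additionally assumed that ∫_{-∞}^0 ψ²(x)dx = 1; this also leaves out the degenerate case t = 0 with u_0 = 0 a.s. *)

(* Defs.v *)
From HB Require Import structures.
From mathcomp Require Import all_boot all_order all_algebra.
From mathcomp Require Import all_classical all_reals all_analysis.
Import Order.TTheory GRing.Theory Num.Theory.
Import numFieldNormedType.Exports.

Set Implicit Arguments.
Unset Strict Implicit.
Unset Printing Implicit Defensive.

Local Open Scope classical_set_scope.
Local Open Scope ring_scope.

(* A process is a function [R -> T -> R] (time first); only its values at
   nonnegative times are ever used. *)

Section processes.
Context {d : measure_display} {T : measurableType d} {R : realType}.
Implicit Types (P : probability T R) (B u v : R -> T -> R) (I : set R).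

Definition sigma_gen B I : set (set T) :=
  <<s \bigcup_(s in I) preimage_set_system setT (B s) measurable >>.

Definition natural_filtration B (t : R) : set (set T) := sigma_gen B `[0, t].

Definition sigma_process B : set (set T) := sigma_gen B `[0, +oo[.

Definition measurable_wrt (G : set (set T)) (X : T -> R) :=
  forall U, measurable U -> G (X @^-1` U).

Definition independent P (G H : set (set T)) :=
  forall A C, G A -> H C -> P (A `&` C) = (P A * P C)%E.

(* [s] is the standard deviation; it is only used with [s != 0]. *)
Definition gaussian P (X : T -> R) (m s : R) :=
  forall U, measurable U -> P (X @^-1` U) = normal_prob m s U.

Definition brownian_motion P B :=
  [/\ forall s, 0 <= s -> measurable_fun setT (B s),
      {ae P, forall w, B 0 w = 0},
      forall s t, 0 <= s -> s < t ->
        independent P (natural_filtration B s)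
          (preimage_set_system setT (fun w => B t w - B s w) measurable),
      forall s t, 0 <= s -> s < t ->
        gaussian P (fun w => B t w - B s w) 0 (Num.sqrt (t - s)) &
      {ae P, forall w, {within `[0, +oo[, continuous (fun s => B s w)}}].

(* The sigma-field carried by [T] is the [P]-completion of [sigma_process B].
   The two bounds must be taken in [sigma_process B] itself: testing nullity in
   [T] would also allow sigma-fields larger than the completion. *)
Definition completed_by P B :=
  forall A : set T, measurable A <->
    exists C D, [/\ sigma_process B C, sigma_process B D,
                    C `<=` A, A `<=` D & P (D `\` C) = 0%E].

Definition measurable_process u :=
  measurable_fun ([set s : R | 0 <= s] `*` [set: T]) (fun x => u x.1 x.2).

Definition adapted B u :=
  forall s, 0 <= s -> measurable_wrt (natural_filtration B s) (u s).

Definition square_norm P u : \bar R :=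
  (\int[P]_w \int[lebesgue_measure]_(s in `[0%R, +oo[) ((u s w) ^+ 2)%:E)%E.

Definition L2_continuous_at P u (t : R) :=
  (\int[P]_w ((u s w - u t w) ^+ 2)%:E)%E @[s --> within [set s | 0 <= s] (nbhs t)]
    --> 0%E.

Record simple_process B := SimpleProcess {
  sp_size : nat;
  sp_time : nat -> R;
  sp_coef : nat -> T -> R;
  sp_time_ge0 : 0 <= sp_time 0%N;
  sp_time_le : forall i, sp_time i <= sp_time i.+1;
  sp_coef_adapted : forall i,
    measurable_wrt (natural_filtration B (sp_time i)) (sp_coef i);
  sp_coef_bounded : forall i, exists M : R, forall w, `|sp_coef i w| <= M }.

Definition simple_value B (H : simple_process B) : R -> T -> R := fun s w =>
  \sum_(i < sp_size H)
    sp_coef H i w * \1_(`]sp_time H i, sp_time H i.+1]%classic) s.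

Definition simple_integral B (H : simple_process B) : T -> R := fun w =>
  \sum_(i < sp_size H)
    sp_coef H i w * (B (sp_time H i.+1) w - B (sp_time H i) w).

(* [X] is a version of the stochastic integral of [v] against [B] over
   [0, +oo[.  It is a relation because the integral is only defined up to
   almost sure equality. *)
Definition is_ito_integral P B v (X : T -> R) :=
  measurable_fun setT X /\
  exists H : nat -> simple_process B,
    (square_norm P (fun s w => v s w - simple_value (H k) s w)
       @[k --> \oo] --> 0%E) /\
    ((\int[P]_w ((X w - simple_integral (H k) w) ^+ 2)%:E)%E @[k --> \oo] --> 0%E).

Definition is_stochastic_convolution P B u (phi : R -> R) (t : R) (X : T -> R) :=
  is_ito_integral P B (fun s w => u s w * phi (t - s)) X.

End processes.

Section extensions.
Context {d : measure_display} {T : measurableType d} {R : realType}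
        {d' : measure_display} {T' : measurableType d'}.
Implicit Types (P : probability T R) (Q : probability T' R).

(* A random variable [Y] on [T] is seen on the extension as [Y \o p]. *)
Definition is_extension P Q (p : T' -> T) :=
  measurable_fun setT p /\
  forall A, measurable A -> Q (p @^-1` A) = P A.

(* The two limits are the real and imaginary parts of
   E[Y exp(i lam X_n)] --> E'[Y exp(i lam F)]. *)
Definition stable_cvg P Q (p : T' -> T) (X : nat -> T -> R) (F : T' -> R) :=
  forall (lam : R) (Y : T -> R),
    measurable_fun setT Y -> (exists M : R, forall w, `|Y w| <= M) ->
    ((\int[P]_w (Y w * cos (lam * X n w))%:E)%E @[n --> \oo]
       --> (\int[Q]_w (Y (p w) * cos (lam * F w))%:E)%E) /\
    ((\int[P]_w (Y w * sin (lam * X n w))%:E)%E @[n --> \oo]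
       --> (\int[Q]_w (Y (p w) * sin (lam * F w))%:E)%E).

End extensions.

Definition dilation {R : realType} (psi : R -> R) (n : nat) : R -> R :=
  fun x => Num.sqrt n%:R * psi (n%:R * x).

(* The littleo of the library requires a canonical [filter_on], which is not
   declared for the neighbourhoods of infinity. *)
Definition littleo_infinity {R : realType} (f g : R -> R) :=
  forall eps : R, 0 < eps ->
    (\forall x \near +oo, `|f x| <= eps * `|g x|) /\
    (\forall x \near -oo, `|f x| <= eps * `|g x|).

(* Main.v *)
(** Let [phi x = E cos (x Z)].  As [psi^2 = o(1/|x|)], the kernel [psi_n (t - s)]
    concentrates around [s = t], so up to a small error in [L^2] the variable
    [X_n] is [c W_n], where [c] is bounded and measurable with respect to the
    past of some time [a <= t] close to [t], and [W_n] is a discretized Wiener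
    integral of [psi_n (t - s)] over a small interval [`]a, b]] around [t].
    Given the past of [a], [W_n] is Gaussian with variance close to [1], hence
    [zeta_n = cos (kap + lam X_n) - cos kap phi (lam u_t)] is nearly centered.
    Moreover the covariance of [W_m] and [W_n] is [int psi_m psi_n], which tends
    to [0] when [n] tends to infinity, so that the bounded variables [zeta_n] are
    asymptotically orthogonal; this forces [E (Y zeta_n)] to tend to [0] for
    every bounded [Y].  The resulting limit [E (Y cos kap phi (lam u_t))] is
    [E' (Y cos (kap + lam u_t Z))], because [Z] is independent of [B].  The real
    and imaginary parts are the cases [kap = 0] and [kap = - pi / 2]. *)
Require Import Defs.
From HB Require Import structures.
From mathcomp Require Import all_boot all_order all_algebra.
From mathcomp Require Import all_classical all_reals all_analysis.
From mathcomp Require Import measurable_realfun ring lra.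
Import Order.TTheory GRing.Theory Num.Theory.
Import numFieldNormedType.Exports.
Set Implicit Arguments.
Unset Strict Implicit.
Local Open Scope classical_set_scope.
Local Open Scope ring_scope.

(** * Integration and independence *)

(** The process [u] is only square integrable, so away from [t] nothing but a uniform bound on the
    kernel can help: [psi^2 = o(1/|x|)] is what makes [psi_n(t - s)^2] uniformly small outside a
    neighbourhood of [t]. The same fact controls the overlap of two kernels. Near [t] the integrand
    is frozen at the left end [a] rather than at [t]: for [t > 0] the interval must extend to the
    left of [t] to capture the mass of the kernel, and conditioning on the past of [a] requires a
    coefficient known at time [a]. This coefficient is truncated because the covariance estimate
    carries its squared bound. The order of choices matters: [a], [b], [c] depend on the precision
    only, so that they serve two indices [m] and [n] at once; the mesh comes last, as it must
    resolve both kernels. Since [Y] may depend on the whole path, conditioning on the past of [a]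
    does not give the limit of [E (Y zeta_n)]; asymptotic orthogonality avoids any approximation of
    [Y]. At [t = 0] only the part of the kernel on the negative half-line is seen, hence the
    separate mass condition there. *)

Section integration.
Context d (T : measurableType d) (R : realType) (mu : {measure set T -> \bar R}).
Implicit Types f g : T -> R.

Lemma integrable_RD f g : mu.-integrable setT (EFin \o f) ->
  mu.-integrable setT (EFin \o g) ->
  mu.-integrable setT (EFin \o (fun w => f w + g w)).
Proof. by move=> fi gi; apply: (@integrableD _ _ _ mu setT measurableT _ _ fi gi). Qed.

Lemma integrable_RZ (k : R) f : mu.-integrable setT (EFin \o f) ->
  mu.-integrable setT (EFin \o (fun w => k * f w)).
Proof. by move=> fi; apply: (@integrableZl _ _ _ mu setT measurableT k _ fi). Qed.

Lemma integrable_RB f g : mu.-integrable setT (EFin \o f) ->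
  mu.-integrable setT (EFin \o g) ->
  mu.-integrable setT (EFin \o (fun w => f w - g w)).
Proof. by move=> fi gi; apply: (@integrableB _ _ _ mu setT measurableT _ _ fi gi). Qed.

Lemma integrable_Rle f g : measurable_fun setT f ->
  mu.-integrable setT (EFin \o g) -> (forall w, `|f w| <= g w) ->
  mu.-integrable setT (EFin \o f).
Proof.
move=> mf gi fg; apply: le_integrable gi => //; first exact/measurable_EFinP.
by move=> w _ /=; rewrite lee_fin (le_trans (fg w)) ?ler_norm.
Qed.

Lemma integrable_bddM f g (M : R) : measurable_fun setT f ->
  (forall w, `|f w| <= M) -> mu.-integrable setT (EFin \o g) ->
  mu.-integrable setT (EFin \o (fun w => f w * g w)).
Proof.
move=> mf fM gi.
apply: (@integrableMr _ _ _ mu setT measurableT f (EFin \o g)) => //.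
by exists M; split; [exact: num_real|move=> x Mx y _ /=; rewrite (le_trans (fM y)) ?ltW].
Qed.

Lemma integrable_sqrM f g : measurable_fun setT f -> measurable_fun setT g ->
  mu.-integrable setT (EFin \o (fun w => f w ^+ 2)) ->
  mu.-integrable setT (EFin \o (fun w => g w ^+ 2)) ->
  mu.-integrable setT (EFin \o (fun w => f w * g w)).
Proof.
move=> mf mg fi gi; apply: integrable_Rle (integrable_RD fi gi) _.
  exact: measurable_funM.
move=> w; rewrite normrM -(real_normK (num_real (f w))) -(real_normK (num_real (g w))).
have := sqr_ge0 (`|f w| - `|g w|); have := normr_ge0 (f w); have := normr_ge0 (g w).
nra.
Qed.

Lemma integrable_Rsum (I : Type) (s : seq I) (F : I -> T -> R) :
  (forall i, mu.-integrable setT (EFin \o F i)) ->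
  mu.-integrable setT (EFin \o (fun w => \sum_(i <- s) F i w)).
Proof.
move=> Fi; rewrite [X in mu.-integrable _ X](_ : _ = fun w => (\sum_(i <- s) (F i w)%:E)%E).
  apply: (@integrable_sum _ _ _ mu setT measurableT _ s xpredT (fun i w => (F i w)%:E)) => i _; exact: Fi.
by apply/funext => w /=; rewrite -sumEFin.
Qed.

Lemma Rintegral_sum (I : Type) (s : seq I) (F : I -> T -> R) :
  (forall i, mu.-integrable setT (EFin \o F i)) ->
  (\int[mu]_w (\sum_(i <- s) F i w)) = \sum_(i <- s) \int[mu]_w F i w.
Proof.
move=> Fi; elim: s => [|i s IH].
  by rewrite big_nil; under eq_Rintegral do rewrite big_nil; rewrite Rintegral_cst ?mul0r.
rewrite big_cons -IH -RintegralD //; last exact: integrable_Rsum.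
by apply: eq_Rintegral => w _; rewrite big_cons.
Qed.

Lemma EFin_Rintegral f : mu.-integrable setT (EFin \o f) ->
  (\int[mu]_w f w)%:E = (\int[mu]_w (f w)%:E)%E.
Proof. by move=> fi; rewrite fineK //; exact: integrable_fin_num. Qed.

Lemma integral_sqr_add f g : measurable_fun setT f -> measurable_fun setT g ->
  (\int[mu]_w ((f w + g w) ^+ 2)%:E <=
   2%:E * (\int[mu]_w (f w ^+ 2)%:E) + 2%:E * (\int[mu]_w (g w ^+ 2)%:E))%E.
Proof.
move=> mf mg.
have mf2 : measurable_fun setT (fun w => (f w ^+ 2)%:E).
  by apply/measurable_EFinP; exact: measurable_funX.
have mg2 : measurable_fun setT (fun w => (g w ^+ 2)%:E).
  by apply/measurable_EFinP; exact: measurable_funX.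
rewrite -!ge0_integralZl //; try by move=> w _; rewrite lee_fin sqr_ge0.
rewrite -ge0_integralD //; try by move=> w _; rewrite -EFinM lee_fin mulr_ge0 ?sqr_ge0.
- apply: ge0_le_integral => //.
  + by move=> w _; rewrite lee_fin sqr_ge0.
  + by apply/measurable_EFinP; apply: measurable_funX; exact: measurable_funD.
  + by apply: emeasurable_funD; exact: measurable_funeM.
  + move=> w _; rewrite -!EFinM -EFinD lee_fin.
    by have := sqr_ge0 (f w - g w); nra.
- exact: measurable_funeM.
- exact: measurable_funeM.
Qed.

End integration.

Lemma integrable_bdd d (T : measurableType d) (R : realType) (P : probability T R)
  (f : T -> R) (M : R) : measurable_fun setT f -> (forall w, `|f w| <= M) ->
  P.-integrable setT (EFin \o f).
Proof.
move=> mf fM; apply: measurable_bounded_integrable => //.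
  exact: (le_lt_trans (probability_le1 _ _) (ltry _)).
by exists M; split; [exact: num_real|move=> x Mx y _ /=; rewrite (le_trans (fM y)) ?ltW].
Qed.

Lemma Rintegral_cst_probability d (T : measurableType d) (R : realType)
  (P : probability T R) (M : R) : \int[P]_w (cst M w) = M.
Proof.
rewrite Rintegral_cst // [X in fine X](_ : _ = 1%E) ?mulr1 //.
exact: probability_setT.
Qed.

Lemma Rintegral_bdd d (T : measurableType d) (R : realType) (P : probability T R)
  (f : T -> R) (M : R) : measurable_fun setT f -> (forall w, `|f w| <= M) ->
  `|\int[P]_w f w| <= M.
Proof.
move=> mf fM; have fi := @integrable_bdd _ _ _ P _ _ mf fM.
apply: (le_trans (le_normr_Rintegral measurableT fi)).
apply: (@le_trans _ _ (\int[P]_w (cst M w))); last first.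
  by rewrite Rintegral_cst_probability.
apply: le_Rintegral => //; first exact: integrable_norm.
exact: finite_measure_integrable_cst.
Qed.

Section independence.
Context d0 d1 d2 (T0 : measurableType d0) (T1 : measurableType d1)
  (T2 : measurableType d2) (R : realType) (Q : probability T0 R).

(** Independence makes the law of the pair agree with the product of the laws on rectangles, hence
    everywhere, and Fubini integrates out the second variable. The target spaces are arbitrary so
    that [f] may be the identity into a smaller sigma-field. *)
Lemma integral_independent (f : T0 -> T1) (g : T0 -> T2) (F : T1 * T2 -> R) :
  measurable_fun setT f -> measurable_fun setT g ->
  (forall A C, measurable A -> measurable C ->
    Q (f @^-1` A `&` g @^-1` C) = (Q (f @^-1` A) * Q (g @^-1` C))%E) ->
  measurable_fun setT F ->
  Q.-integrable setT (EFin \o (fun w => F (f w, g w))) ->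
  (forall x, Q.-integrable setT (EFin \o (fun v => F (x, g v)))) ->
  (\int[Q]_w (F (f w, g w))%:E = \int[Q]_w \int[Q]_v (F (f w, g v))%:E)%E.
Proof.
move=> mf mg indep mF iF iFx.
pose fm : {mfun T0 >-> T1} := HB.pack f (isMeasurableFun.Build _ _ _ _ _ mf).
pose gm : {mfun T0 >-> T2} := HB.pack g (isMeasurableFun.Build _ _ _ _ _ mg).
have mfg : measurable_fun setT (fun w => (f w, g w)) by exact/measurable_fun_pairP.
pose fgm : {mfun T0 >-> (T1 * T2)%type} :=
  HB.pack (fun w => (f w, g w)) (isMeasurableFun.Build _ _ _ _ _ mfg).
pose Qf := distribution Q fm; pose Qg := distribution Q gm.
have prodE X : measurable X -> (Qf \x Qg)%E X = distribution Q fgm X.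
  apply: product_measure_unique => A C mA mC.
  exact: indep.
have mEF : measurable_fun setT (EFin \o F) by exact/measurable_EFinP.
have iprod : (Qf \x Qg)%E.-integrable setT (EFin \o F).
  have : (distribution Q fgm).-integrable setT (EFin \o F).
    exact: integrable_pushforward.
  move=> /integrableP[_ foo]; apply/integrableP; split => //.
  rewrite (eq_measure_integral (distribution Q fgm)) // => A mA _.
  exact: prodE.
transitivity (\int[distribution Q fgm]_x (EFin \o F) x)%E.
  by rewrite integral_distribution.
rewrite (eq_measure_integral (Qf \x Qg)%E); last by move=> A mA _; exact/esym/prodE.
rewrite -integral12_prod_meas1 //.
have iG := integrable_fubini_F iprod.
have GE x : fubini_F Qg (EFin \o F) x = (\int[Q]_v (F (x, g v))%:E)%E.
  rewrite /fubini_F /Qg (@integral_distribution _ _ _ _ _ _ gm (fun y => (EFin \o F) (x, y))) //.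
    by apply: measurableT_comp mEF _; exact: measurable_pair1.
  exact: iFx.
rewrite integral_distribution //=; last 2 first.
- exact: (measurable_int _ iG).
- move/integrableP : iG => [mG Goo]; apply/integrableP; split.
    exact: measurableT_comp.
  move: Goo; rewrite ge0_integral_distribution //.
  exact: measurableT_comp.
by apply: eq_integral => w _; rewrite -GE.
Qed.

End independence.

(** * The normal law *)

Section affine.
Context (R : realType).
Notation mu := (@lebesgue_measure R).

Let aff (a b : R) : measurableTypeR R -> measurableTypeR R := fun x => a * x + b.

Let measurable_aff a b : measurable_fun setT (aff a b).
Proof. by apply: measurable_funD => //; exact: measurable_funM. Qed.

(** The image of Lebesgue measure under x -> a x + b, scaled by |a|. The existential packs it as a
    measure with its values and its change of variables; uniqueness on intervals then identifies it
    with Lebesgue measure. *)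
Let exists_affine_measure (a b : R) :
  exists m : {measure set (measurableTypeR R) -> \bar R},
    (forall U, m U = `|a|%:E * mu (aff a b @^-1` U))%E /\
    forall f : measurableTypeR R -> \bar R, measurable_fun setT f ->
      (forall x, 0 <= f x)%E ->
      (\int[m]_x f x = `|a|%:E * \int[mu]_x f (aff a b x))%E.
Proof.
unshelve eexists.
  refine (mscale (NngNum (normr_ge0 a)) (pushforward mu (aff a b))).
  exact: measurable_aff.
split => // f mf f0.
by rewrite ge0_integral_mscale //= ge0_integral_pushforward.
Qed.

Lemma lebesgue_measure_affine (a b : R) (U : set R) : a != 0 -> measurable U ->
  (`|a|%:E * mu ((fun x => (a * x + b)%R) @^-1` U) = mu U)%E.
Proof.
move=> a0 mU.
have [m [mE _]] := exists_affine_measure a b.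
rewrite -/(aff a b) -mE; apply/esym/lebesgue_measure_unique => //.
move=> _ [[c d]] _ <-; rewrite mE /=.
have [a_gt0|a_lt0] : (0 < a) \/ (a < 0) by case: (ltgtP a 0) a0 => //; auto.
- rewrite (_ : aff a b @^-1` _ = `](c - b) / a, (d - b) / a]%classic); last first.
    apply/seteqP; split=> x /=; rewrite !in_itv/= /aff ltr_pdivrMr // ler_pdivlMr //;
    by rewrite mulrC ltrBlDr lerBrDr.
  rewrite !lebesgue_measure_itv/= !lte_fin ltr_pM2r ?invr_gt0 // ltrD2r.
  case: ifP => _; last by rewrite mule0.
  by rewrite -!EFinD -EFinM gtr0_norm //; congr EFin; field; rewrite gt_eqF.
(* A negative slope exchanges the end points and moves the closed end to the left. *)
- rewrite (_ : aff a b @^-1` _ = `[(d - b) / a, (c - b) / a[%classic); last first.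
    apply/seteqP; split=> x /=; rewrite !in_itv/= /aff ltr_ndivlMr // ler_ndivrMr //;
    by rewrite mulrC lerBrDr ltrBlDr andbC.
  rewrite !lebesgue_measure_itv/= !lte_fin ltr_nM2r ?invr_lt0 // ltrD2r.
  case: ifP => _; last by rewrite mule0.
  by rewrite -!EFinD -EFinM ltr0_norm //; congr EFin; field; rewrite lt_eqF.
Qed.

Lemma ge0_integral_affine (a b : R) (f : R -> \bar R) : a != 0 ->
  measurable_fun setT f -> (forall x, 0 <= f x)%E ->
  (`|a|%:E * \int[mu]_x f (a * x + b)%R = \int[mu]_x f x)%E.
Proof.
move=> a0 mf f0.
have [m [mE mI]] := exists_affine_measure a b.
rewrite -[LHS]mI //; apply: eq_measure_integral => A mA _.
by rewrite mE lebesgue_measure_affine.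
Qed.
End affine.

Section density.
Context d (T : measurableType d) (R : realType) (mu nu : {measure set T -> \bar R}).
Import HBNNSimple.

(** Both sides are limits along the same increasing simple functions, by monotone convergence; on an
    indicator the identity is the hypothesis on [nu]. *)
Lemma ge0_integral_density (g : T -> R) (f : T -> \bar R) :
  measurable_fun setT g -> (forall x, 0 <= g x) ->
  (forall V, measurable V -> nu V = \int[mu]_(x in V) (g x)%:E)%E ->
  measurable_fun setT f -> (forall x, 0 <= f x)%E ->
  (\int[nu]_x f x = \int[mu]_x (f x * (g x)%:E))%E.
Proof.
move=> mg g0 nuE mf f0; set G := EFin \o g.
have mG : measurable_fun setT G by exact/measurable_EFinP.
pose h := nnsfun_approx measurableT mf.
have -> : (\int[nu]_x f x = limn (fun n => \int[nu]_x (EFin \o h n) x))%E.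
  have fE x : f x = limn (fun n => (EFin \o h n) x).
    by apply/esym/cvg_lim => //; apply: cvg_nnsfun_approx.
  under eq_integral do rewrite fE.
  apply: monotone_convergence => //.
  - by move=> n; apply/measurable_EFinP.
  - by move=> n x _; rewrite lee_fin.
  - by move=> x _ a b ab; rewrite lee_fin; exact/lefP/nd_nnsfun_approx.
have -> : (\int[mu]_x (f x * G x) = limn (fun n => \int[mu]_x ((EFin \o h n) x * G x)))%E.
  have fE x : (f x * G x = limn (fun n => (EFin \o h n) x * G x))%E.
    by apply/esym/cvg_lim => //; apply: cvgeZr => //; apply: cvg_nnsfun_approx.
  under eq_integral do rewrite fE.
  apply: monotone_convergence => //.
  - by move=> n; apply: emeasurable_funM => //; apply/measurable_EFinP.
  - by move=> n x _; rewrite mule_ge0 // lee_fin.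
  - move=> x _ a b ab; rewrite lee_wpmul2r ?lee_fin //.
    exact/lefP/nd_nnsfun_approx.
congr (limn _); apply/funext => n.
have indich r : measurable_fun setT (fun x => (r * \1_(h n @^-1` [set r]) x)%:E).
  by apply/measurable_EFinP; exact: measurable_funM.
transitivity (\int[nu]_x (\sum_(y \in range (h n)) (y * \1_(h n @^-1` [set y]) x)%:E))%E.
  by apply: eq_integral => t tE; rewrite /= fimfunE -fsumEFin.
rewrite ge0_integral_fsum//; last by move=> m y Ey; exact: nnfun_muleindic_ge0.
transitivity (\int[mu]_x (\sum_(y \in range (h n))
    (y * \1_(h n @^-1` [set y]) x)%:E * G x))%E; last first.
  apply: eq_integral => x _.
  rewrite -ge0_mule_fsuml => [|y]; last exact: nnfun_muleindic_ge0.
  by rewrite fsumEFin // -(fimfunE _ x).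
rewrite ge0_integral_fsum//; last 2 first.
  - by move=> y; apply: emeasurable_funM.
  - by move=> m y Ey; apply: mule_ge0; rewrite ?[X in (_ <= X)%E]/G /= ?lee_fin //; apply: nnfun_muleindic_ge0.
apply: eq_fsbigr => r rhn.
under eq_integral do rewrite EFinM.
rewrite integralZl_indic_nnsfun => //.
under [RHS]eq_integral do rewrite EFinM -muleA.
have r0 : 0 <= r by move: rhn => /set_mem [x _ <-].
rewrite ge0_integralZl//; last 2 first.
- by apply: emeasurable_funM => //; apply/measurable_EFinP.
- by move=> x _; rewrite mule_ge0 ?lee_fin.
congr (_ * _)%E; rewrite integral_indic // setIT nuE //.
rewrite integral_mkcond; apply: eq_integral => x _.
rewrite patchE indicE /=; case: ifP => _; by rewrite ?mul1e ?mul0e.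
Qed.
End density.

Section trigonometric_bounds.
Context (R : realType).
Implicit Types x y : R.

Lemma cos_lipschitz x y : `|cos x - cos y| <= `|x - y|.
Proof.
wlog xy : x y / x <= y.
  move=> H; case: (leP x y) => [/H //|/ltW/H].
  by rewrite distrC (distrC y).
have [c _ E] : exists2 c, c \in `[x, y]%R & cos y - cos x = - sin c * (y - x).
  apply: MVT_segment => //.
  exact/continuous_subspaceT/continuous_cos.
rewrite distrC E normrM normrN (distrC x y) ler_piMl //.
exact: sin_max.
Qed.

Lemma sin_lipschitz x y : `|sin x - sin y| <= `|x - y|.
Proof.
rewrite -!(cosBpihalf) (le_trans (cos_lipschitz _ _)) //.
by rewrite opprB addrA subrK.
Qed.

Lemma cos_ge x : 1 - cos x <= x ^+ 2 / 2.
Proof.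
have -> : x = (x / 2) *+ 2 by rewrite -mulr_natr divfK.
rewrite cos_mulr2n cos2sin2.
have : `|sin (x / 2)| <= `|x / 2|.
  by have := sin_lipschitz (x / 2) 0; rewrite sin0 !subr0.
rewrite -ler_sqr ?nnegrE // !real_normK ?num_real //.
move: (sin (x / 2)) => s; move: (x / 2) => h sh.
lra.
Qed.

Lemma measurable_cos : measurable_fun setT (@cos R).
Proof. apply: continuous_measurable_fun; exact: continuous_cos. Qed.

End trigonometric_bounds.

Section normal_law.
Context (R : realType).
Notation mu := (@lebesgue_measure R).
Notation nu := (normal_prob (0 : R) (1 : R)).

Lemma normal_prob_scale (s : R) (U : set R) : s != 0 -> measurable U ->
  normal_prob 0 s U = nu ((fun z => s * z) @^-1` U).
Proof.
move=> s0 mU; rewrite /normal_prob [LHS]integral_mkcond [RHS]integral_mkcond.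
have mf : measurable_fun setT ((fun x => (normal_pdf 0 s x)%:E) \_ U).
  apply/(measurable_restrictT _ mU); apply: measurable_funTS.
  by apply/measurable_EFinP; exact: measurable_normal_pdf.
have f0 x : (0 <= ((fun x => (normal_pdf 0 s x)%:E) \_ U) x)%E.
  by apply: erestrict_ge0 => y _; rewrite lee_fin normal_pdf_ge0.
rewrite -(ge0_integral_affine 0 s0 mf f0) -ge0_integralZl //; last first.
  by apply: (measurableT_comp mf); apply: measurable_funD => //.
apply: eq_integral => z _.
rewrite !patchE addr0 /=.
rewrite [X in _ = if X then _ else _](_ : _ = (s * z \in U)); last first.
  by apply/idP/idP; rewrite !inE.
case: ifP => _; last by rewrite mule0.
rewrite -EFinM !normal_pdfE ?oner_neq0 // /normal_peak /normal_fun.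
congr EFin; rewrite !subr0 expr1n mul1r mulrA; congr (_ * expR _).
  rewrite -[s ^+ 2 * pi *+ 2]mulrnAr sqrtrM ?sqr_ge0 // sqrtr_sqr invfM mulrA divff ?mul1r //.
  by rewrite normr_eq0.
by rewrite exprMn; field.
Qed.

Lemma normal_prob_opp (U : set R) : measurable U ->
  nu ((fun z => - z) @^-1` U) = nu U.
Proof.
move=> mU.
rewrite (_ : (fun z => - z) @^-1` U = (fun z => (-1) * z) @^-1` U).
  rewrite -normal_prob_scale ?oppr_eq0 ?oner_neq0 // /normal_prob.
  apply: eq_integral => x _.
  by rewrite /normal_pdf oppr_eq0 /normal_peak /normal_fun sqrrN.
by apply/seteqP; split => x /=; rewrite mulN1r.
Qed.

(** Integration by parts: as p' = - x p, the function x p(x) is a primitive of p - x^2 p. The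
    boundary term stays on the left to avoid subtracting extended reals. *)
Lemma normal_second_moment_half (n : nat) : (0 < n)%N ->
  (\int[mu]_(x in `[0%R, n%:R]) (x ^+ 2 * normal_pdf 0 1 x)%:E
    + (n%:R * normal_pdf 0 1 n%:R)%:E
   = \int[mu]_(x in `[0%R, n%:R]) (normal_pdf 0 1 x)%:E)%E.
Proof.
move=> n0; move Ep : (normal_pdf 0 1) => p.
have cp : continuous p by rewrite -Ep; apply: continuous_normal_pdf; exact: oner_neq0.
have dp (x : R) : is_derive x (1 : R) p (- x * p x).
  pose q := fun y : R => - 2^-1 * y ^+ 2.
  have dq : is_derive x (1 : R) q (- x).
    have -> : q = (- 2^-1) \*: ((id : R -> R) ^+ 2).
      by apply/funext => y; rewrite /q /= fctE.
    by apply: is_derive_eq; rewrite /GRing.scale /=; field.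
  have de : is_derive x (1 : R) (expR \o q) (- x * expR (q x)).
    by apply: is_derive_eq => //; rewrite /GRing.scale /=; field.
  have pE : p = normal_peak 1 \*: (expR \o q).
    apply/funext => y; rewrite -Ep normal_pdfE ?oner_neq0 // /normal_fun /= /q.
    by rewrite subr0 expr1n; congr (_ * expR _); field.
  rewrite pE; apply: is_derive_eq; rewrite /GRing.scale /=.
  by rewrite mulrCA.
have cxp : continuous (fun x : R => x * p x).
  by move=> x; apply: cvgM => //; exact: cp.
have cx2p : continuous (fun x : R => x ^+ 2 * p x).
  by move=> x; apply: cvgM => //; [exact: exprn_continuous|exact: cp].
have F2 : (\int[mu]_(x in `[0%R, n%:R]) ((p x - x ^+ 2 * p x)%:E) =
   (n%:R * p n%:R)%:E - (0 * p 0)%:E)%E.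
  apply: (@continuous_FTC2 _ _ (fun x => x * p x)).
  - by rewrite ltr0n.
  - apply: continuous_subspaceT => x; apply: cvgB; [exact: cp|exact: cx2p].
  - split.
    + by move=> x _; apply: derivableM => //; exact: ex_derive.
    + exact/cvg_at_right_filter/cxp.
    + exact/cvg_at_left_filter/cxp.
  - move=> x _; rewrite derive1E.
    have d2 : is_derive x (1 : R) (fun x : R => x * p x) (p x - x ^+ 2 * p x).
      apply: (@is_derive_eq _ _ _ ((id : R -> R) * p)).
      by rewrite /GRing.scale /=; ring.
    by rewrite derive_val.
have icont f : continuous f -> mu.-integrable `[0%R, n%:R] (EFin \o f).
  move=> cf; apply: continuous_compact_integrable; first exact: segment_compact.
  exact: continuous_subspaceT.
have ip := icont _ cp; have ix := icont _ cx2p.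
move: F2; rewrite mul0r sube0 => <-.
rewrite integralB_EFin // addeC subeK //.
exact: integrable_fin_num.
Qed.

End normal_law.

Section normal_moments.
Context (R : realType).
Notation mu := (@lebesgue_measure R).
Notation nu := (normal_prob (0 : R) (1 : R)).

Lemma cvg_mulr_normal_pdf :
  (n.+1%:R * normal_pdf 0 1 n.+1%:R : R) @[n --> \oo] --> (0 : R).
Proof.
set k := normal_peak (1 : R); have k0 : 0 <= k by exact: normal_peak_ge0.
(* From exp(y) >= 1 + y at y = m^2 / 2 one gets m exp(- m^2 / 2) <= 2 / m. *)
apply: (@squeeze_cvgr _ _ _ _ (cst 0) (fun n : nat => (2 * k) * harmonic n)).
- near=> n; apply/andP; split; first by rewrite mulr_ge0 // normal_pdf_ge0.
  rewrite normal_pdfE ?oner_neq0 // -/k /normal_fun subr0 expr1n mulrCA.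
  rewrite (mulrC 2) -mulrA ler_wpM2l // /harmonic /=.
  set m : R := n.+1%:R; have m0 : 0 < m by rewrite ltr0n.
  have := expR_ge1Dx (m ^+ 2 / 2); rewrite mulNr expRN.
  have := expR_gt0 (m ^+ 2 / 2); move: (expR _) => e e0 h.
  by rewrite ler_pdivrMr // mulrAC ler_pdivlMr //; lra.
- exact: cvg_cst.
- rewrite -[X in _ --> X](mulr0 (2 * k)).
  by apply: cvgM; [exact: cvg_cst|exact: cvg_harmonic].
Unshelve. all: by end_near. Qed.

(** By parity the half-lines suffice; the truncated identity then passes to the limit, where its
    boundary term disappears. *)
Lemma normal_second_moment : (\int[nu]_z (z ^+ 2)%:E = 1)%E.
Proof.
rewrite (@ge0_integral_density _ _ _ mu nu (normal_pdf 0 1)) //; last 4 first.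
- exact: measurable_normal_pdf.
- by move=> x; exact: normal_pdf_ge0.
- by apply/measurable_EFinP; exact: measurable_funX.
- by move=> x; rewrite lee_fin sqr_ge0.
under eq_integral do rewrite -EFinM.
move: (integral_normal_pdf (0 : R) 1) (@normal_second_moment_half R)
  (@cvg_mulr_normal_pdf) (@continuous_normal_pdf R 0 1 (oner_neq0 R))
  (@normal_pdf_ge0 R 0 1) (@measurable_normal_pdf R 0 1).
have : normal_pdf (0 : R) 1 =1 normal_pdf 0 1 \o -%R.
  by move=> x /=; rewrite !normal_pdfE ?oner_neq0 // /normal_fun !subr0 sqrrN.
move: (normal_pdf 0 1) => p evenp p1 pn pcvg cp p0 mp.
have setE : [set x : R | (0 <= x)%R] = `[0, +oo[%classic.
  by apply/seteqP; split => x/=; rewrite in_itv/= andbT.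
rewrite -[RHS]p1 !ge0_symfun_integralT //; last 3 first.
- by move=> x; rewrite mulr_ge0 ?sqr_ge0.
- by move=> x; apply: cvgM => //; [exact: exprn_continuous|exact: cp].
- by move=> x /=; rewrite sqrrN (evenp x).
congr (_ * _)%E; rewrite setE.
have A : (\int[mu]_(x in `[0%R, n.+1%:R]) (x ^+ 2 * p x)%:E @[n --> \oo] -->
    \int[mu]_(x in `[0%R, +oo[) (x ^+ 2 * p x)%:E)%E.
  have := @ge0_cvgn_integral R mu (fun x => x ^+ 2 * p x).
  rewrite -cvg_shiftS; apply; first by move=> x; rewrite mulr_ge0 ?sqr_ge0.
  by apply: measurable_funM => //; exact: measurable_funX.
have G : (\int[mu]_(x in `[0%R, n.+1%:R]) (p x)%:E @[n --> \oo] -->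
    \int[mu]_(x in `[0%R, +oo[) (p x)%:E)%E.
  by have := @ge0_cvgn_integral R mu p p0 mp; rewrite -cvg_shiftS.
apply/esym/(cvg_unique _ G) => //.
rewrite /= -(adde0 (\int[mu]_(x in `[0%R, +oo[) (x ^+ 2 * p x)%:E)%E).
have -> : (fun n => \int[mu]_(x in `[0%R, n.+1%:R]) (p x)%:E)%E =
    (fun n => \int[mu]_(x in `[0%R, n.+1%:R]) (x ^+ 2 * p x)%:E
      + (n.+1%:R * p n.+1%:R)%:E)%E by apply/funext => n; rewrite pn.
apply: cvgeD => //; first by rewrite fin_num_adde_defl.
by apply/cvg_EFin => //; near=> n.
Unshelve. all: by end_near. Qed.

End normal_moments.

Section standard_normal.
Context (R : realType).

Let measurable_toR : measurable_fun setT (fun z : measurableTypeR R => z : R).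
Proof. exact: measurable_id. Qed.

(* [normal_prob] lives on [measurableTypeR R], whose display differs from the
   one of [R]: this is the same law on [R]. *)
Definition std_normal : probability R R := distribution (normal_prob (0 : R) (1 : R))
  (HB.pack (fun z : measurableTypeR R => z : R)
     (isMeasurableFun.Build _ _ _ _ _ measurable_toR) : {mfun measurableTypeR R >-> R}).

Lemma std_normal_second_moment : (\int[std_normal]_z (z ^+ 2)%:E = 1)%E.
Proof.
rewrite ge0_integral_distribution ?normal_second_moment //.
- by apply/measurable_EFinP; exact: measurable_funX.
- by move=> x; rewrite lee_fin sqr_ge0.
Qed.

(** The characteristic function of the standard normal law: the sine part vanishes by symmetry. *)
Definition gaussian_cf (x : R) : R := \int[std_normal]_z cos (x * z).

End standard_normal.

Section gaussian_variables.
Context d (T : measurableType d) (R : realType) (P : probability T R)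
  (X : T -> R) (s : R).
Hypotheses (mX : measurable_fun setT X) (s0 : s != 0) (gX : gaussian P X 0 s).
Notation nu := (std_normal R).

Let ms : measurable_fun setT (fun z : R => s * z).
Proof. exact: measurable_funM. Qed.

Let Xm : {mfun T >-> R} := HB.pack X (isMeasurableFun.Build _ _ _ _ _ mX).
Let sm : {mfun R >-> R} := HB.pack (fun z : R => s * z) (isMeasurableFun.Build _ _ _ _ _ ms).

Let lawE U : measurable U -> distribution P Xm U = distribution nu sm U.
Proof. by move=> mU; rewrite [LHS]gX // normal_prob_scale. Qed.

Lemma ge0_integral_gaussian (f : R -> \bar R) : measurable_fun setT f ->
  (forall x, 0 <= f x)%E -> (\int[P]_w f (X w) = \int[nu]_z f (s * z)%R)%E.
Proof.
move=> mf f0; rewrite -[LHS](@ge0_integral_distribution _ _ _ _ _ P Xm f) //.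
rewrite -[RHS](@ge0_integral_distribution _ _ _ _ _ nu sm f) //.
by apply: eq_measure_integral => A mA _; exact: lawE.
Qed.

Lemma integral_gaussian (f : R -> R) : measurable_fun setT f ->
  P.-integrable setT (EFin \o (f \o X)) ->
  (\int[P]_w f (X w) = \int[nu]_z f (s * z)).
Proof.
move=> mf /integrableP[m1 i1].
have mEf : measurable_fun setT (EFin \o f) by exact/measurable_EFinP.
congr fine.
rewrite -[LHS](@integral_distribution _ _ _ _ _ P Xm (EFin \o f)) //; last exact/integrableP.
rewrite -[RHS](@integral_distribution _ _ _ _ _ nu sm (EFin \o f)) //.
  by apply: eq_measure_integral => A mA _; exact: lawE.
apply/integrableP; split; first exact: measurableT_comp.
rewrite -(@ge0_integral_gaussian (fun x => `|(EFin \o f) x|)%E) //.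
exact: measurableT_comp.
Qed.

Lemma integral_gaussian_sqr : (\int[P]_w (X w ^+ 2)%:E = (s ^+ 2)%:E)%E.
Proof.
rewrite (@ge0_integral_gaussian (fun x => (x ^+ 2)%:E)); last 2 first.
- by apply/measurable_EFinP; exact: measurable_funX.
- by move=> x; rewrite lee_fin sqr_ge0.
under eq_integral do rewrite exprMn EFinM.
rewrite ge0_integralZl //; first by rewrite std_normal_second_moment mule1.
- by apply/measurable_EFinP; exact: measurable_funX.
- by move=> x _; rewrite lee_fin sqr_ge0.
- by rewrite lee_fin sqr_ge0.
Qed.

Lemma integrable_gaussian_sqr : P.-integrable setT (EFin \o (fun w => X w ^+ 2)).
Proof.
apply/integrableP; split; first by apply/measurable_EFinP; exact: measurable_funX.
under eq_integral do rewrite /= ger0_norm ?sqr_ge0 //.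
by rewrite integral_gaussian_sqr ltry.
Qed.

Lemma integrable_gaussian : P.-integrable setT (EFin \o X).
Proof.
have i1 : P.-integrable setT (EFin \o (fun w => 1 + X w ^+ 2)).
  apply: integrable_RD integrable_gaussian_sqr.
  exact: finite_measure_integrable_cst.
apply: integrable_Rle mX i1 _ => w.
by rewrite -(real_normK (num_real (X w))); have := sqr_ge0 (`|X w| - 1); nra.
Qed.

End gaussian_variables.

Section gaussian_cf.
Context (R : realType).
Notation nu := (std_normal R).

Lemma gaussian_id : gaussian nu (fun z => z) 0 1.
Proof. by []. Qed.

Lemma gaussian_opp : gaussian nu (fun z => - z) 0 1.
Proof. by move=> U mU; exact: normal_prob_opp. Qed.

(** The law is invariant under z -> - z, so the integral equals its opposite. *)
Lemma integral_normal_odd (f : R -> R) : measurable_fun setT f ->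
  (forall x, f (- x) = - f x) -> nu.-integrable setT (EFin \o f) ->
  \int[nu]_z f z = 0.
Proof.
move=> mf oddf fi.
have mN : measurable_fun setT (fun z : R => - z) by exact: measurable_funN.
have /= E := @integral_gaussian _ _ _ nu _ 1 mN (oner_neq0 _) gaussian_opp f mf.
have iN : nu.-integrable setT (EFin \o (f \o (fun z => - z))).
  rewrite (_ : _ \o _ = EFin \o (fun z => (-1) * f z)); first exact: integrable_RZ.
  by apply/funext => z /=; rewrite oddf mulN1r.
move: (E iN).
under eq_Rintegral do rewrite oddf -mulN1r.
under [RHS]eq_Rintegral do rewrite mul1r.
rewrite RintegralZl // => h; lra.
Qed.

Lemma measurable_cosM (x : R) : measurable_fun setT (fun z : R => cos (x * z)).
Proof. by apply: (measurableT_comp (@measurable_cos R)); exact: measurable_funM. Qed.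

Lemma measurable_sinM (x : R) : measurable_fun setT (fun z : R => sin (x * z)).
Proof.
apply: (measurableT_comp (continuous_measurable_fun (@continuous_sin R))).
exact: measurable_funM.
Qed.

Lemma integrable_cosM (x : R) : nu.-integrable setT (EFin \o (fun z => cos (x * z))).
Proof. by apply: (@integrable_bdd _ _ _ _ _ 1); [exact: measurable_cosM|move=> z; exact: cos_max]. Qed.

Lemma integrable_sinM (x : R) : nu.-integrable setT (EFin \o (fun z => sin (x * z))).
Proof. by apply: (@integrable_bdd _ _ _ _ _ 1); [exact: measurable_sinM|move=> z; exact: sin_max]. Qed.

Lemma gaussian_cf_norm (x : R) : `|gaussian_cf x| <= 1.
Proof. by apply: Rintegral_bdd; [exact: measurable_cosM|move=> z; exact: cos_max]. Qed.

Lemma gaussian_cf_abs (x : R) : gaussian_cf `|x| = gaussian_cf x.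
Proof.
apply: eq_Rintegral => z _.
by case: (ger0P x) => _ //; rewrite mulNr cosN.
Qed.

Lemma gaussian_cf0 : gaussian_cf (0 : R) = 1.
Proof.
rewrite /gaussian_cf; under eq_Rintegral do rewrite mul0r cos0.
exact: Rintegral_cst_probability.
Qed.

Lemma normal_integrable_sqr : nu.-integrable setT (EFin \o (fun z => z ^+ 2)).
Proof.
exact: (@integrable_gaussian_sqr _ _ _ nu (fun z => z) 1 _ (oner_neq0 _) gaussian_id).
Qed.

Lemma gaussian_cf_ge (x : R) : 1 - gaussian_cf x <= x ^+ 2 / 2.
Proof.
have E : \int[nu]_z z ^+ 2 = 1 by rewrite /Rintegral std_normal_second_moment.
have i2 := @integrable_RZ _ _ _ nu (x ^+ 2 / 2) _ normal_integrable_sqr.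
have i1 : nu.-integrable setT (EFin \o (fun z => 1 : R)).
  exact: finite_measure_integrable_cst.
have ic := integrable_cosM x.
rewrite -[leRHS]mulr1 -[X in _ <= _ * X]E -RintegralZl //; last exact: normal_integrable_sqr.
have -> : 1 - gaussian_cf x = \int[nu]_z (1 - cos (x * z)).
  rewrite RintegralB //; congr (_ - _); exact/esym/(Rintegral_cst_probability nu 1).
apply: le_Rintegral => //; first exact: integrable_RB.
by move=> z _; have := cos_ge (x * z); rewrite exprMn; lra.
Qed.

Lemma integral_normal_cos (a x : R) :
  \int[nu]_z cos (a + x * z) = cos a * gaussian_cf x.
Proof.
under eq_Rintegral do rewrite cosD.
rewrite RintegralB //; [|exact/integrable_RZ/integrable_cosM|exact/integrable_RZ/integrable_sinM].
rewrite !RintegralZl //; [|exact: integrable_sinM|exact: integrable_cosM].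
rewrite (@integral_normal_odd (fun z => sin (x * z))) ?mulr0 ?subr0 //.
- exact: measurable_sinM.
- by move=> z; rewrite mulrN sinN.
- exact: integrable_sinM.
Qed.

End gaussian_cf.

Section gaussian_integrals.
Context d (T : measurableType d) (R : realType) (P : probability T R)
  (X : T -> R) (s : R).
Hypotheses (mX : measurable_fun setT X) (s0 : s != 0) (gX : gaussian P X 0 s).

Lemma integral_gaussian_mean : \int[P]_w X w = 0.
Proof.
rewrite (@integral_gaussian _ _ _ _ _ _ mX s0 gX id) //; last exact: integrable_gaussian gX.
have i1 := @integrable_gaussian _ _ _ (std_normal R) (fun z : R => z) 1
  (@measurable_id _ _ _) (oner_neq0 _) (@gaussian_id R).
rewrite RintegralZl // integral_normal_odd ?mulr0 //.
Qed.

Lemma integral_gaussian_cos (a x : R) :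
  \int[P]_w cos (a + x * X w) = cos a * gaussian_cf (x * s).
Proof.
have mf : measurable_fun setT (fun y : R => cos (a + x * y)).
  by apply: (measurableT_comp (@measurable_cos R)); apply: measurable_funD => //.
rewrite (@integral_gaussian _ _ _ _ _ _ mX s0 gX (fun y => cos (a + x * y))) //.
  by under eq_Rintegral do rewrite mulrA; exact: integral_normal_cos.
apply: (@integrable_bdd _ _ _ _ _ 1); first exact: (measurableT_comp mf).
by move=> w; exact: cos_max.
Qed.

End gaussian_integrals.

(** * Brownian increments *)

Section filtration.
Context d (T : measurableType d) (R : realType) (B : R -> T -> R).

(* [T] with the sigma-field of the natural filtration at time [s], so that the
   closure properties of [measurable_fun] apply to adapted variables. *)
Notation past s := (g_sigma_algebraType
  (\bigcup_(r in `[0, s]%classic) preimage_set_system setT (B r) measurable)).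

Lemma measurable_wrtP s (X : T -> R) :
  measurable_wrt (natural_filtration B s) X <-> measurable_fun setT (X : past s -> R).
Proof.
split=> mX => [_ U mU|U mU]; first by rewrite setTI; exact: mX.
by have := mX measurableT U mU; rewrite setTI.
Qed.

Lemma natural_filtration_mono s t : s <= t ->
  natural_filtration B s `<=` natural_filtration B t.
Proof.
move=> st; apply: sub_sigma_algebra2; apply: bigcup_subset.
by move=> x /=; rewrite !in_itv /= => /andP[-> /le_trans]; apply.
Qed.

Lemma measurable_wrt_mono s t (X : T -> R) : s <= t ->
  measurable_wrt (natural_filtration B s) X -> measurable_wrt (natural_filtration B t) X.
Proof. by move=> st mX U mU; apply: natural_filtration_mono st _ (mX U mU). Qed.

Lemma measurable_wrt_self s r : 0 <= r -> r <= s ->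
  measurable_wrt (natural_filtration B s) (B r).
Proof.
move=> r0 rs U mU; apply: sub_sigma_algebra; exists r; first by rewrite /= in_itv /= r0.
by exists U => //; rewrite setTI.
Qed.

Lemma measurable_wrtM s (X Y : T -> R) :
  measurable_wrt (natural_filtration B s) X -> measurable_wrt (natural_filtration B s) Y ->
  measurable_wrt (natural_filtration B s) (fun w => X w * Y w).
Proof.
by move=> /measurable_wrtP mX /measurable_wrtP mY; apply/measurable_wrtP; exact: measurable_funM.
Qed.

Lemma measurable_wrtD s (X Y : T -> R) :
  measurable_wrt (natural_filtration B s) X -> measurable_wrt (natural_filtration B s) Y ->
  measurable_wrt (natural_filtration B s) (fun w => X w + Y w).
Proof.
by move=> /measurable_wrtP mX /measurable_wrtP mY; apply/measurable_wrtP; exact: measurable_funD.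
Qed.

Lemma measurable_wrtB s (X Y : T -> R) :
  measurable_wrt (natural_filtration B s) X -> measurable_wrt (natural_filtration B s) Y ->
  measurable_wrt (natural_filtration B s) (fun w => X w - Y w).
Proof.
by move=> /measurable_wrtP mX /measurable_wrtP mY; apply/measurable_wrtP; exact: measurable_funB.
Qed.

Lemma measurable_wrt_comp s (f : R -> R) (X : T -> R) : measurable_fun setT f ->
  measurable_wrt (natural_filtration B s) X ->
  measurable_wrt (natural_filtration B s) (fun w => f (X w)).
Proof.
by move=> mf /measurable_wrtP mX; apply/measurable_wrtP; exact: (measurableT_comp mf).
Qed.

Lemma measurable_wrt_cst s (k : R) : measurable_wrt (natural_filtration B s) (fun=> k).
Proof. by apply/measurable_wrtP; exact: measurable_cst. Qed.

Lemma measurable_wrt_sum s n (F : nat -> T -> R) :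
  (forall i, (i < n)%N -> measurable_wrt (natural_filtration B s) (F i)) ->
  measurable_wrt (natural_filtration B s) (fun w => \sum_(i < n) F i w).
Proof.
elim: n => [|n IH] mF.
  rewrite (_ : (fun _ => _) = fun=> 0); first exact: measurable_wrt_cst.
  by apply/funext => w; rewrite big_ord0.
rewrite (_ : (fun _ => _) = fun w => \sum_(i < n) F i w + F n w).
  by apply: measurable_wrtD; [apply: IH => i /ltnW|]; exact: mF.
by apply/funext => w; rewrite big_ord_recr.
Qed.

End filtration.

Section brownian_increments.
Context d (T : measurableType d) (R : realType) (P : probability T R) (B : R -> T -> R).
Hypothesis bm : brownian_motion P B.
Notation past s := (g_sigma_algebraType
  (\bigcup_(r in `[0, s]%classic) preimage_set_system setT (B r) measurable)).

Lemma natural_filtration_measurable s A : natural_filtration B s A -> measurable A.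
Proof.
have [mB _ _ _ _] := bm.
move: A; apply: smallest_sub; first exact: sigma_algebra_measurable.
move=> A [r /=]; rewrite in_itv /= => /andP[r0 _] [U mU <-].
exact: (mB r r0 measurableT U mU).
Qed.

Lemma measurable_wrt_measurable s (X : T -> R) :
  measurable_wrt (natural_filtration B s) X -> measurable_fun setT X.
Proof.
by move=> mX _ U mU; rewrite setTI; exact: natural_filtration_measurable (mX U mU).
Qed.

Lemma measurable_increment s t : 0 <= s -> 0 <= t -> measurable_fun setT (fun w => B t w - B s w).
Proof. by have [mB _ _ _ _] := bm; move=> s0 t0; apply: measurable_funB; exact: mB. Qed.

Section increment.
Variables (s t : R).
Hypotheses (s0 : 0 <= s) (st : s < t).
Let D w := B t w - B s w.
Let mD : measurable_fun setT D.
Proof. by apply: measurable_increment => //; exact: le_trans (ltW st). Qed.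
Let sd0 : Num.sqrt (t - s) != 0. Proof. by rewrite gt_eqF // sqrtr_gt0 subr_gt0. Qed.
Let gD : gaussian P D 0 (Num.sqrt (t - s)).
Proof. by have [_ _ _ + _] := bm; apply. Qed.

(** Freezing lemma: given the past of [s], the increment keeps its law and the rest is constant. The
    type [past s] in the domain of [F] encodes that [F] depends on the outcome only through the
    past. *)
Lemma integral_past_increment (F : past s * R -> R) : measurable_fun setT F ->
  P.-integrable setT (EFin \o (fun w => F (w, D w))) ->
  (forall w, P.-integrable setT (EFin \o (fun v => F (w, D v)))) ->
  \int[P]_w F (w, D w) = \int[P]_w \int[P]_v F (w, D v).
Proof.
move=> mF i1 i2.
have mid : measurable_fun setT (fun w : T => w : past s).
  by move=> _ A mA; rewrite setTI; exact: natural_filtration_measurable mA.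
congr fine.
rewrite (@integral_independent _ _ _ _ _ _ _ P (fun w : T => w : past s) D F) //.
  by apply: eq_integral => w _; rewrite EFin_Rintegral.
move=> A C mA mC; have [_ _ ind _ _] := bm; apply: (ind s t s0 st) => //.
by exists C => //; rewrite setTI.
Qed.

Lemma integrable_increment_sqr : P.-integrable setT (EFin \o (fun w => D w ^+ 2)).
Proof. exact: integrable_gaussian_sqr gD. Qed.

Lemma Rintegral_increment_sqr : \int[P]_w (D w ^+ 2) = t - s.
Proof.
by rewrite /Rintegral (integral_gaussian_sqr mD sd0 gD) /= sqr_sqrtr // subr_ge0 ltW.
Qed.


Lemma integral_past_increment0 (V : T -> R) :
  measurable_wrt (natural_filtration B s) V ->
  P.-integrable setT (EFin \o (fun w => V w ^+ 2)) ->
  \int[P]_w (V w * D w) = 0.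
Proof.
move=> mV iV; have mVT := measurable_wrt_measurable mV.
have iD := integrable_gaussian mD sd0 gD.
rewrite (@integral_past_increment (fun z => V z.1 * z.2)).
- rewrite -[RHS](Rintegral_cst_probability P 0); apply: eq_Rintegral => w _ /=.
  by rewrite RintegralZl // (integral_gaussian_mean mD sd0 gD) mulr0.
- apply: measurable_funM => //; apply: measurableT_comp => //.
  exact/measurable_wrtP.
- exact: integrable_sqrM integrable_increment_sqr.
- by move=> w; exact: (@integrable_RZ _ _ _ P (V w) _ iD).
Qed.

Lemma integral_past_increment_sqr (V : T -> R) (M : R) :
  measurable_wrt (natural_filtration B s) V -> (forall w, `|V w| <= M) ->
  \int[P]_w (V w * D w ^+ 2) = (t - s) * \int[P]_w V w.
Proof.
move=> mV VM; have mVT := measurable_wrt_measurable mV.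
have iD := integrable_increment_sqr.
rewrite (@integral_past_increment (fun z => V z.1 * z.2 ^+ 2)).
- rewrite -RintegralZl //; last exact: integrable_bdd VM.
  apply: eq_Rintegral => w _ /=.
  by rewrite RintegralZl // Rintegral_increment_sqr mulrC.
- apply: measurable_funM; last exact: measurable_funX.
  by apply: measurableT_comp => //; exact/measurable_wrtP.
- exact: integrable_bddM VM _.
- by move=> w; exact: (@integrable_RZ _ _ _ P (V w) _ iD).
Qed.

Lemma integral_past_increment_cos (V A th : T -> R) (M : R) :
  measurable_wrt (natural_filtration B s) V -> (forall w, `|V w| <= M) ->
  measurable_wrt (natural_filtration B s) A ->
  measurable_wrt (natural_filtration B s) th ->
  \int[P]_w (V w * cos (A w + th w * D w)) =
  \int[P]_w (V w * (cos (A w) * gaussian_cf (th w * Num.sqrt (t - s)))).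
Proof.
move=> mV VM mA mth.
have mVT := measurable_wrt_measurable mV.
have mAT := measurable_wrt_measurable mA.
have mthT := measurable_wrt_measurable mth.
have M0 : 0 <= M by exact: le_trans (VM point).
have mcos := @measurable_cos R.
have bnd w x : `|V w * cos x| <= M.
  by rewrite normrM (le_trans _ (VM w)) // ler_piMr // cos_max.
rewrite (@integral_past_increment (fun z => V z.1 * cos (A z.1 + th z.1 * z.2))).
- apply: eq_Rintegral => w _ /=; rewrite RintegralZl.
  + by rewrite (integral_gaussian_cos mD sd0 gD).
  + exact: measurableT.
  + apply: (@integrable_bdd _ _ _ _ _ 1); last by move=> v; exact: cos_max.
    by apply: (measurableT_comp mcos); apply: measurable_funD => //; exact: measurable_funM.
- apply: measurable_funM; first by apply: measurableT_comp => //; exact/measurable_wrtP.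
  apply: (measurableT_comp mcos); apply: measurable_funD.
    by apply: measurableT_comp => //; exact/measurable_wrtP.
  apply: measurable_funM => //.
  by apply: measurableT_comp => //; exact/measurable_wrtP.
- apply: (@integrable_bdd _ _ _ _ _ M) => //.
  apply: measurable_funM => //; apply: (measurableT_comp mcos).
  by apply: measurable_funD => //; exact: measurable_funM.
- move=> w; apply: (@integrable_bdd _ _ _ _ _ M) => //.
  rewrite /=; apply: measurable_funM => //; apply: (measurableT_comp mcos).
  by apply: measurable_funD => //; exact: measurable_funM.
Qed.

End increment.

End brownian_increments.

(** * The Gaussian characteristic function in terms of the variance *)

Section gauss_var.
Context (R : realType).

Lemma gaussian_cf_lipschitz (x y : R) : `|gaussian_cf x - gaussian_cf y| <= `|x - y|.
Proof.
pose nu := std_normal R.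
have i1 : nu.-integrable setT (EFin \o (fun z : R => `|z|)).
  apply: integrable_norm.
  exact: (@integrable_gaussian _ _ _ nu (fun z => z) 1 _ (oner_neq0 _) (@gaussian_id R)).
(* The first absolute moment is at most 1 because |z| <= (1 + z^2) / 2 and the second moment is
   1. *)
have C1 : \int[nu]_z `|z| <= 1.
  have i2 : nu.-integrable setT (EFin \o (fun z : R => 2^-1 * (1 + z ^+ 2))).
    apply/integrable_RZ/integrable_RD; last exact: normal_integrable_sqr.
    exact: finite_measure_integrable_cst.
  apply: (@le_trans _ _ (\int[nu]_z (2^-1 * (1 + z ^+ 2)))).
    apply: le_Rintegral => // z _; rewrite -(real_normK (num_real z)).
    by have := sqr_ge0 (`|z| - 1); lra.
  rewrite RintegralZl //; last first.
    by apply: integrable_RD; [exact: finite_measure_integrable_cst|exact: normal_integrable_sqr].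
  rewrite RintegralD //; [|exact: finite_measure_integrable_cst|exact: normal_integrable_sqr].
  rewrite (Rintegral_cst_probability nu 1) /Rintegral std_normal_second_moment /=; lra.
rewrite /gaussian_cf -RintegralB //; try exact: integrable_cosM.
apply: le_trans (le_normr_Rintegral measurableT _) _.
  exact: integrable_RB (integrable_cosM _) (integrable_cosM _).
apply: (@le_trans _ _ (`|x - y| * \int[nu]_z `|z|)); last by rewrite ler_piMr.
rewrite -RintegralZl //; apply: le_Rintegral => //.
- by apply/integrable_norm/integrable_RB; exact: integrable_cosM.
- exact: integrable_RZ.
- by move=> z _; rewrite -normrM mulrBl; exact: cos_lipschitz.
Qed.

Lemma continuous_gaussian_cf : continuous (@gaussian_cf R).
Proof.
move=> x; apply/cvgrPdist_le => e e0; apply/nbhs_ballP; exists e => // y /ltW.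
exact: le_trans (gaussian_cf_lipschitz x y).
Qed.

(** With the variance as argument, adding independent Gaussian variables becomes multiplication; for
    v >= 0 this is exp(- v / 2). *)
Definition gauss_var (v : R) : R := gaussian_cf (Num.sqrt v).

Lemma gauss_var_sqr (x : R) : gauss_var (x ^+ 2) = gaussian_cf x.
Proof. by rewrite /gauss_var sqrtr_sqr gaussian_cf_abs. Qed.

Lemma measurable_gauss_var : measurable_fun setT gauss_var.
Proof.
apply: (@measurableT_comp _ _ _ _ _ _ (@gaussian_cf R)).
  by apply: continuous_measurable_fun; exact: continuous_gaussian_cf.
by apply: continuous_measurable_fun; exact: sqrt_continuous.
Qed.

Lemma gauss_var_norm v : `|gauss_var v| <= 1.
Proof. exact: gaussian_cf_norm. Qed.

Lemma gauss_var0 : gauss_var 0 = 1.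
Proof. by rewrite /gauss_var sqrtr0 gaussian_cf0. Qed.

Lemma gauss_var_ge v : 0 <= v -> 1 - gauss_var v <= v / 2.
Proof. by move=> v0; have := gaussian_cf_ge (Num.sqrt v); rewrite sqr_sqrtr. Qed.

End gauss_var.

(** * Brownian sums on a uniform partition *)

Section riemann_sums.
Context d (T : measurableType d) (R : realType) (P : probability T R) (B : R -> T -> R).
Hypothesis bm : brownian_motion P B.

(* The Gaussian characteristic function is never computed: its multiplicativity
   is read off the Brownian motion, whose adjacent increments add up. *)
Lemma gauss_varD (v w : R) : 0 <= v -> 0 <= w -> gauss_var (v + w) = gauss_var v * gauss_var w.
Proof.
rewrite le_eqVlt => /predU1P[<- _|v0]; first by rewrite add0r gauss_var0 mul1r.
rewrite le_eqVlt => /predU1P[<-|w0]; first by rewrite addr0 gauss_var0 mulr1.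
have cst1 s : measurable_wrt (natural_filtration B s) (fun=> 1 : R) by exact: measurable_wrt_cst.
have cst0 s : measurable_wrt (natural_filtration B s) (fun=> 0 : R) by exact: measurable_wrt_cst.
have b1 (x : T) : `|1 : R| <= 1 by rewrite normr1.
have vw : v < v + w by rewrite ltrDl.

have mA : measurable_wrt (natural_filtration B v) (fun x => B v x - B 0 x).
  by apply: measurable_wrtB => //; apply: measurable_wrt_self => //; exact: ltW.
have := integral_past_increment_cos bm (lexx 0) (addr_gt0 v0 w0) (cst1 0) b1 (cst0 0) (cst1 0).
have := integral_past_increment_cos bm (ltW v0) vw (cst1 v) b1 mA (cst1 v).
have := integral_past_increment_cos bm (lexx 0) v0 (cst1 0) b1 (cst0 0) (cst1 0).
rewrite !subr0 !mul1r (addrC v w) addrK cos0 !mul1r => E1 E2 E3.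
have -> : gauss_var (w + v) = \int[P]_x (cst (gauss_var (w + v)) x).
  by rewrite Rintegral_cst_probability.
rewrite /gauss_var -E3.
transitivity (\int[P]_w0 (1 * cos (B v w0 - B 0 w0 + 1 * (B (w + v) w0 - B v w0)))).
  by apply: eq_Rintegral => x _; rewrite !mul1r add0r; congr cos; ring.
rewrite E2.
transitivity (gaussian_cf (Num.sqrt w) * \int[P]_x (1 * cos (0 + 1 * (B v x - B 0 x)))).
  have mc : measurable_fun setT (fun x => 1 * cos (0 + 1 * (B v x - B 0 x))).
    apply: measurable_funM => //; apply: (measurableT_comp (@measurable_cos R)).
    apply: measurable_funD => //; apply: measurable_funM => //.
    by apply: (measurable_increment bm) => //; exact: ltW.
  rewrite -RintegralZl //.
    by apply: eq_Rintegral => x _; rewrite !mul1r add0r mulrC.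
  by apply: (@integrable_bdd _ _ _ _ _ 1) => // x; rewrite mul1r cos_max.
rewrite E1 mulrC; congr (_ * _).
exact: (Rintegral_cst_probability P).
Qed.

(** For v <= w the difference factors as [gauss_var v * (1 - gauss_var (w - v))], and the second
    factor lies between 0 and (w - v) / 2. *)
Lemma gauss_var_lipschitz (v w : R) : 0 <= v -> 0 <= w ->
  `|gauss_var v - gauss_var w| <= `|v - w| / 2.
Proof.
wlog vw : v w / v <= w.
  move=> H v0 w0; case: (leP v w) => [/H|/ltW/H]; first exact.
  by rewrite distrC (distrC v); apply.
move=> v0 w0; have wv : 0 <= w - v by rewrite subr_ge0.
rewrite -[in gauss_var w](subrK v w) (addrC _ v) gauss_varD //.
rewrite -[X in X - _]mulr1 -mulrBr normrM (distrC v) (ger0_norm wv).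
have := gauss_var_ge wv; have := gauss_var_norm (w - v); rewrite ler_norml => /andP[_ h1] h2.
have h3 : `|1 - gauss_var (w - v)| = 1 - gauss_var (w - v) by rewrite ger0_norm // subr_ge0.
rewrite h3 (le_trans _ h2) // ler_piMl ?subr_ge0 //; exact: gauss_var_norm.
Qed.

Section partition.
Variables (a h : R).
Hypotheses (a0 : 0 <= a) (h0 : 0 < h).

Definition tick (i : nat) : R := a + i%:R * h.

Lemma tick_ge i : a <= tick i.
Proof. by rewrite lerDl; apply: mulr_ge0 => //; exact: ltW. Qed.

Lemma tick_ge0 i : 0 <= tick i.
Proof. exact: le_trans a0 (tick_ge i). Qed.

Lemma tick_le i j : (i <= j)%N -> tick i <= tick j.
Proof. by move=> ij; rewrite lerD2l; apply: ler_wpM2r; [exact: ltW|rewrite ler_nat]. Qed.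

Lemma tick_lt i : tick i < tick i.+1.
Proof. by rewrite ltrD2l ltr_pM2r // ltr_nat. Qed.

Lemma tick_diff i : tick i.+1 - tick i = h.
Proof. by rewrite /tick -natr1; ring. Qed.

(** The Wiener integral of the step function equal to [g i] on the cell that follows [tick i]. *)
Definition brownian_sum (g : nat -> R) k w :=
  \sum_(i < k) g i * (B (tick i.+1) w - B (tick i) w).

(** The covariance of the Brownian sums of [g1] and [g2], that is, the L^2 product of the two step
    functions. *)
Definition sum_prod (g1 g2 : nat -> R) k := \sum_(i < k) g1 i * g2 i * h.

Lemma brownian_sum_past g k :
  measurable_wrt (natural_filtration B (tick k)) (brownian_sum g k).
Proof.
apply: (@measurable_wrt_sum _ _ _ B _ k (fun i w => g i * (B (tick i.+1) w - B (tick i) w))).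
move=> i ik; apply: measurable_wrtM; first exact: measurable_wrt_cst.
by apply: measurable_wrtB; apply: measurable_wrt_self; rewrite ?tick_ge0 ?tick_le // ltnW.
Qed.

Lemma sum_prod_ge0 g k : 0 <= sum_prod g g k.
Proof. by apply: sumr_ge0 => i _; apply: mulr_ge0 (ltW h0); rewrite -expr2 sqr_ge0. Qed.

(** The last increment is integrated out first, given the past of [tick k]. It leaves a factor that
    depends on [c] only, hence is known at time [a], and is absorbed in the weight: this is why the
    induction quantifies over [V]. *)
Lemma integral_brownian_sum_cos (g : nat -> R) k (V c : T -> R) (M kap : R) :
  measurable_wrt (natural_filtration B a) V -> (forall w, `|V w| <= M) ->
  measurable_wrt (natural_filtration B a) c ->
  \int[P]_w (V w * cos (kap + c w * brownian_sum g k w)) =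
  \int[P]_w (V w * (cos kap * gauss_var (c w ^+ 2 * sum_prod g g k))).
Proof.
move=> + + mc; elim: k V => [|k IH] V mV VM.
  by apply: eq_Rintegral => w _; rewrite /brownian_sum /sum_prod !big_ord0 !mulr0 addr0 gauss_var0 mulr1.
have past (X : T -> R) : measurable_wrt (natural_filtration B a) X ->
    measurable_wrt (natural_filtration B (tick k)) X.
  exact: measurable_wrt_mono (tick_ge k).
pose G w := gauss_var ((c w * g k) ^+ 2 * h).
transitivity (\int[P]_w (V w * cos ((kap + c w * brownian_sum g k w)
    + (c w * g k) * (B (tick k.+1) w - B (tick k) w)))).
  apply: eq_Rintegral => w _; congr (_ * cos _).
  by rewrite /brownian_sum big_ord_recr /=; ring.
rewrite (integral_past_increment_cos bm (tick_ge0 k) (tick_lt k) (M := M)) //; last 3 first.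
- exact: past.
- apply: measurable_wrtD; first exact: measurable_wrt_cst.
  by apply: measurable_wrtM; [exact: past|exact: brownian_sum_past].
- by apply: measurable_wrtM; [exact: past|exact: measurable_wrt_cst].
rewrite tick_diff.
transitivity (\int[P]_w ((V w * G w) * cos (kap + c w * brownian_sum g k w))).
  apply: eq_Rintegral => w _; rewrite /G -gauss_var_sqr exprMn sqr_sqrtr ?ltW //.
  by ring.
rewrite IH.
- apply: eq_Rintegral => w _; rewrite /sum_prod big_ord_recr /= -/(sum_prod g g k).
  have n1 : 0 <= c w ^+ 2 * sum_prod g g k.
    by apply: mulr_ge0; [exact: sqr_ge0|exact: sum_prod_ge0].
  have n2 : 0 <= c w ^+ 2 * (g k * g k * h).
    apply: mulr_ge0; first exact: sqr_ge0.
    by apply: mulr_ge0 (ltW h0); rewrite -expr2 sqr_ge0.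
  rewrite mulrDr gauss_varD //.
  by rewrite /G exprMn (mulrA (c w ^+ 2)); ring.
- apply: measurable_wrtM => //; apply: (measurable_wrt_comp (f := @gauss_var R)).
    exact: measurable_gauss_var.
  apply: measurable_wrtM; last exact: measurable_wrt_cst.
  apply: (measurable_wrt_comp (f := fun x => x ^+ 2)); first exact: measurable_funX.
  by apply: measurable_wrtM => //; exact: measurable_wrt_cst.
- move=> w; rewrite normrM (le_trans _ (VM w)) // ler_piMr //; exact: gauss_var_norm.
Qed.

End partition.
End riemann_sums.

Lemma ler_halves (R : realType) (C x y z : R) : C * x <= x -> x <= z -> y <= z ->
  2^-1 * C * x + 2^-1 * y <= z.
Proof. by rewrite -mulrA => h1 h2 h3; lra. Qed.

(** * Covariance of the centered cosines *)

Section decorrelation.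
Context d (T : measurableType d) (R : realType) (P : probability T R) (B : R -> T -> R).
Hypothesis bm : brownian_motion P B.
Variables (a h : R).
Hypotheses (a0 : 0 <= a) (h0 : 0 < h).
Notation W g k := (brownian_sum B a h g k).
Notation S := (sum_prod h).

Lemma measurable_brownian_sum g k : measurable_fun setT (W g k).
Proof. exact: (measurable_wrt_measurable bm (@brownian_sum_past _ _ _ B _ _ a0 h0 g k)). Qed.

Lemma brownian_sumD g1 g2 k w :
  W (fun i => g1 i + g2 i) k w = W g1 k w + W g2 k w.
Proof. by rewrite -big_split; apply: eq_bigr => i _; rewrite /= mulrDl. Qed.

Lemma brownian_sumB g1 g2 k w :
  W (fun i => g1 i - g2 i) k w = W g1 k w - W g2 k w.
Proof. by rewrite -sumrB; apply: eq_bigr => i _; rewrite /= mulrBl. Qed.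

Lemma sum_prod_sqrD g1 g2 k : S (fun i => g1 i + g2 i) (fun i => g1 i + g2 i) k =
  S g1 g1 k + S g2 g2 k + 2 * S g1 g2 k.
Proof. by rewrite /sum_prod mulr_sumr -!big_split; apply: eq_bigr => i _ /=; ring. Qed.

Lemma sum_prod_sqrB g1 g2 k : S (fun i => g1 i - g2 i) (fun i => g1 i - g2 i) k =
  S g1 g1 k + S g2 g2 k - 2 * S g1 g2 k.
Proof. by rewrite /sum_prod mulr_sumr -big_split -sumrB; apply: eq_bigr => i _ /=; ring. Qed.

(** The cosine minus its conditional expectation given the past of [a], when [c] is known at time
    [a]. *)
Definition centered_cos (kap : R) (c : T -> R) (g : nat -> R) k w :=
  cos (kap + c w * W g k w) - cos kap * gauss_var (c w ^+ 2 * S g g k).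

Lemma centered_cos_norm kap c g k w : `|centered_cos kap c g k w| <= 2.
Proof.
apply: le_trans (ler_normB _ _) _.
by apply: (@lerD _ _ 1 _ 1); rewrite ?normrM ?mulr_ile1 ?cos_max ?gauss_var_norm.
Qed.

Lemma measurable_centered_cos kap (c : T -> R) g k : measurable_fun setT c ->
  measurable_fun setT (centered_cos kap c g k).
Proof.
move=> mc; apply: measurable_funB.
  apply: (measurableT_comp (@measurable_cos R)); apply: measurable_funD => //.
  by apply: measurable_funM => //; exact: measurable_brownian_sum.
apply: measurable_funM => //; apply: (measurableT_comp (@measurable_gauss_var R)).
by apply: measurable_funM => //; exact: measurable_funX.
Qed.

(** By the product formula for cosines, only the sums with coefficients g1 + g2 and g1 - g2 occur;
    their variances are s1 + s2 + 2 s12 and s1 + s2 - 2 s12. With s12 = 0 all terms would cancel,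
    and [gauss_var] is Lipschitz with constant 1/2. *)
Lemma integral_centered_cosM (g1 g2 : nat -> R) k (c : T -> R) (M kap : R) :
  measurable_wrt (natural_filtration B a) c -> (forall w, `|c w| <= M) ->
  `|\int[P]_w (centered_cos kap c g1 k w * centered_cos kap c g2 k w)|
    <= M ^+ 2 * `|S g1 g2 k|.
Proof.
move=> mc cM; have mcT := measurable_wrt_measurable bm mc.
pose G v w := gauss_var (c w ^+ 2 * v) : R.
have mG v : measurable_wrt (natural_filtration B a) (G v).
  apply: (measurable_wrt_comp (f := @gauss_var R)); first exact: measurable_gauss_var.
  apply: measurable_wrtM; last exact: measurable_wrt_cst.
  by apply: (measurable_wrt_comp (f := fun x => x ^+ 2)) => //; exact: measurable_funX.
have G1 v w : `|G v w| <= 1 by exact: gauss_var_norm.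
pose s1 := S g1 g1 k; pose s2 := S g2 g2 k; pose s12 := S g1 g2 k.
have I (V : T -> R) (kp : R) g : measurable_wrt (natural_filtration B a) V ->
    (forall w, `|V w| <= 1) ->
  [/\ P.-integrable setT (EFin \o (fun w => V w * cos (kp + c w * W g k w))),
      P.-integrable setT (EFin \o (fun w => V w * (cos kp * G (S g g k) w))) &
      \int[P]_w (V w * cos (kp + c w * W g k w)) =
      \int[P]_w (V w * (cos kp * G (S g g k) w))].
  move=> mV V1; have mVT := measurable_wrt_measurable bm mV; split.
  - apply: (@integrable_bdd _ _ _ _ _ 1).
      apply: measurable_funM => //; apply: (measurableT_comp (@measurable_cos R)).
      by apply: measurable_funD => //; apply: measurable_funM => //; exact: measurable_brownian_sum.
    by move=> w; rewrite normrM mulr_ile1 // cos_max.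
  - apply: (@integrable_bdd _ _ _ _ _ 1).
      apply: measurable_funM => //; apply: measurable_funM => //.
      exact: (measurable_wrt_measurable bm (mG _)).
    by move=> w; rewrite normrM mulr_ile1 // normrM mulr_ile1 ?cos_max.
  - exact: (integral_brownian_sum_cos bm a0 h0 g k kp mV V1 mc).
have half (w : T) : `|cst (2^-1 : R) w| <= 1 by rewrite /= ger0_norm ?invr_ge0 //; lra.
have mhalf : measurable_wrt (natural_filtration B a) (cst (2^-1 : R)).
  exact: measurable_wrt_cst.
have k1 : `|cos kap| <= 1 by exact: cos_max.
(* Expanding the product: [V3] and [V4] weigh the two cross terms, [V5] is the product of the two
   conditional means. *)
pose V3 w := - cos kap * G s2 w; pose V4 w := - cos kap * G s1 w.
pose V5 w := cos kap ^+ 2 * (G s1 w * G s2 w).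
have V31 w : `|V3 w| <= 1 by rewrite normrM mulr_ile1 // normrN.
have V41 w : `|V4 w| <= 1 by rewrite normrM mulr_ile1 // normrN.
have V51 w : `|V5 w| <= 1.
  by rewrite normrM mulr_ile1 ?normrX ?exprn_ile1 // normrM mulr_ile1.
have mV3 : measurable_wrt (natural_filtration B a) V3.
  by apply: measurable_wrtM => //; exact: measurable_wrt_cst.
have mV4 : measurable_wrt (natural_filtration B a) V4.
  by apply: measurable_wrtM => //; exact: measurable_wrt_cst.
have mV5 : measurable_wrt (natural_filtration B a) V5.
  by apply: measurable_wrtM; [exact: measurable_wrt_cst|exact: measurable_wrtM].
have [i1 j1 e1] := I _ (kap *+ 2) (fun i => g1 i + g2 i) mhalf half.
have [i2 j2 e2] := I _ 0 (fun i => g1 i - g2 i) mhalf half.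
have [i3 j3 e3] := I _ kap g1 mV3 V31.
have [i4 j4 e4] := I _ kap g2 mV4 V41.
have i5 : P.-integrable setT (EFin \o V5).
  exact: integrable_bdd (measurable_wrt_measurable bm mV5) V51.
rewrite (_ : \int[P]_w _ = \int[P]_w (
   cst 2^-1 w * (cos (kap *+ 2) * G (s1 + s2 + 2 * s12) w) +
   cst 2^-1 w * (cos 0 * G (s1 + s2 - 2 * s12) w) +
   V3 w * (cos kap * G s1 w) + V4 w * (cos kap * G s2 w) + V5 w)); last first.
  move: j1 j2 e1 e2; rewrite sum_prod_sqrD sum_prod_sqrB => j1 j2 e1 e2.
  transitivity (\int[P]_w (
    cst 2^-1 w * cos (kap *+ 2 + c w * W (fun i => g1 i + g2 i) k w) +
    cst 2^-1 w * cos (0 + c w * W (fun i => g1 i - g2 i) k w) +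
    V3 w * cos (kap + c w * W g1 k w) + V4 w * cos (kap + c w * W g2 k w) + V5 w)).
    apply: eq_Rintegral => w _; rewrite brownian_sumD brownian_sumB.
    rewrite /centered_cos /V3 /V4 /V5 /G -/s1 -/s2 /cst.
    set x := W g1 k w; set y := W g2 k w.
    have -> : kap *+ 2 + c w * (x + y) = (kap + c w * x) + (kap + c w * y) by ring.
    have -> : 0 + c w * (x - y) = (kap + c w * x) - (kap + c w * y) by ring.
    move: (kap + c w * x) (kap + c w * y) => al be.
    by rewrite cosD cosB; field.
  have i12 := integrable_RD i1 i2; have i13 := integrable_RD i12 i3.
  have i14 := integrable_RD i13 i4.
  have j12 := integrable_RD j1 j2; have j13 := integrable_RD j12 j3.
  have j14 := integrable_RD j13 j4.
  rewrite (RintegralD measurableT i14 i5) (RintegralD measurableT i13 i4).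
  rewrite (RintegralD measurableT i12 i3) (RintegralD measurableT i1 i2).
  rewrite (RintegralD measurableT j14 i5) (RintegralD measurableT j13 j4).
  rewrite (RintegralD measurableT j12 j3) (RintegralD measurableT j1 j2).
  by rewrite e1 e2 e3 e4.
have mGT v : measurable_fun setT (G v) by exact: (measurable_wrt_measurable bm (mG v)).
have mV3T := measurable_wrt_measurable bm mV3.
have mV4T := measurable_wrt_measurable bm mV4.
have mV5T := measurable_wrt_measurable bm mV5.
apply: Rintegral_bdd.
  apply: measurable_funD => //; apply: measurable_funD; last first.
    by apply: measurable_funM => //; exact: measurable_funM.
  apply: measurable_funD; last by apply: measurable_funM => //; exact: measurable_funM.
  by apply: measurable_funD; apply: measurable_funM => //; exact: measurable_funM.
move=> w.
have s10 : 0 <= s1 by exact: sum_prod_ge0.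
have s20 : 0 <= s2 by exact: sum_prod_ge0.
have sp0 : 0 <= s1 + s2 + 2 * s12 by rewrite -sum_prod_sqrD; exact: sum_prod_ge0.
have sm0 : 0 <= s1 + s2 - 2 * s12 by rewrite -sum_prod_sqrB; exact: sum_prod_ge0.
have c20 : 0 <= c w ^+ 2 by exact: sqr_ge0.
have cM2 : c w ^+ 2 <= M ^+ 2.
  by rewrite -(real_normK (num_real (c w))) lerXn2r ?nnegrE //; exact: le_trans (cM w).
have G12 : G s1 w * G s2 w = G (s1 + s2) w.
  by rewrite /G mulrDr (gauss_varD bm) // mulr_ge0.
have diff v : 0 <= v -> `|v - (s1 + s2)| = 2 * `|s12| ->
    `|G v w - G (s1 + s2) w| <= M ^+ 2 * `|s12|.
  move=> v0 vE; apply: le_trans (gauss_var_lipschitz bm _ _) _.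
  - exact: mulr_ge0.
  - by apply: mulr_ge0 => //; exact: addr_ge0.
  rewrite -mulrBr normrM vE (ger0_norm c20).
  by rewrite mulrCA mulrAC divff ?mul1r // ler_wpM2r.
have d1 := diff _ sp0; have d2 := diff _ sm0.
have {}d1 : `|G (s1 + s2 + 2 * s12) w - G (s1 + s2) w| <= M ^+ 2 * `|s12|.
  by apply: d1; rewrite addrC addKr normrM ger0_norm.
have {}d2 : `|G (s1 + s2 - 2 * s12) w - G (s1 + s2) w| <= M ^+ 2 * `|s12|.
  by apply: d2; rewrite addrC addKr normrN normrM ger0_norm.
(* The terms with [V3], [V4] and [V5] add up to - cos^2 kap G(s1 + s2), and cos^2 kap = (cos 2 kap +
   1) / 2 distributes this over the other two terms. *)
rewrite (_ : _ + V5 w =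
   2^-1 * cos (kap *+ 2) * (G (s1 + s2 + 2 * s12) w - G (s1 + s2) w) +
   2^-1 * (G (s1 + s2 - 2 * s12) w - G (s1 + s2) w)); last first.
  by rewrite /V3 /V4 /V5 -G12 cos0 cos_mulr2n /cst; field.
apply: le_trans (ler_normD _ _) _.
rewrite !normrM [`|2^-1|]ger0_norm ?invr_ge0 //.
by apply: ler_halves => //; rewrite ler_piMl // cos_max.
Qed.

End decorrelation.

(** * Isometry *)

Section overlap.
Context (R : realType).
Notation mu := (@lebesgue_measure R).

Definition overlap (a b c d : R) : R := Num.max 0 (Num.min b d - Num.max a c).

Lemma indic_mul_integral (a b c d : R) :
  mu.-integrable setT
    (EFin \o (fun s => \1_(`]a, b]%classic) s * \1_(`]c, d]%classic) s)) /\
  \int[mu]_s (\1_(`]a, b]%classic) s * \1_(`]c, d]%classic) s) = overlap a b c d.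
Proof.
have E s : \1_(`]a, b]%classic) s * \1_(`]c, d]%classic) s =
    \1_(`]Num.max a c, Num.min b d]%classic) s :> R.
  rewrite -[LHS]/((\1_(`]a, b]%classic) \* \1_(`]c, d]%classic)) s) -indicI.
  congr (\1_ _ s); apply/seteqP; split => x /=; rewrite !in_itv /= gt_max le_min.
    by move=> [/andP[-> ->] /andP[-> ->]].
  by move=> /andP[/andP[-> ->] /andP[-> ->]].
rewrite (_ : (fun s => _) = \1_(`]Num.max a c, Num.min b d]%classic)); last exact/funext.
split; first exact: integrable_indic_itv.
transitivity (fine (\int[mu]_s (\1_(`]Num.max a c, Num.min b d]%classic) s)%:E)).
  by congr fine; apply: eq_integral => s _; rewrite E.
rewrite integral_indic // setIT /= lebesgue_measure_itv /= lte_fin /overlap.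
case: ltP => h; first by rewrite -EFinB /= [RHS]max_r // subr_ge0 ltW.
by rewrite [RHS]max_l // subr_le0.
Qed.

End overlap.

Section isometry.
Context d (T : measurableType d) (R : realType) (P : probability T R) (B : R -> T -> R).
Hypothesis bm : brownian_motion P B.
Notation mu := (@lebesgue_measure R).

Let L2 (f : T -> R) := measurable_fun setT f /\
  P.-integrable setT (EFin \o (fun w => f w ^+ 2)).

Let L2_bddM (f g : T -> R) (M : R) : measurable_fun setT f -> (forall w, `|f w| <= M) -> L2 g ->
  L2 (fun w => f w * g w).
Proof.
move=> mf fM [mg ig]; split; first exact: measurable_funM.
rewrite (_ : _ \o _ = EFin \o (fun w => f w ^+ 2 * g w ^+ 2)); last first.
  by apply/funext => w /=; rewrite exprMn.
apply: (@integrable_bddM _ _ _ P _ _ (M ^+ 2)) ig; first exact: measurable_funX.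
move=> w; rewrite normrX lerXn2r ?nnegrE //; exact: le_trans (fM w).
Qed.

Let L2M (f g : T -> R) : L2 f -> L2 g -> P.-integrable setT (EFin \o (fun w => f w * g w)).
Proof. by move=> [mf jf] [mg jg]; exact: integrable_sqrM. Qed.

Let D (s t : R) (w : T) := B t w - B s w.

Let L2D s t : 0 <= s -> s <= t -> L2 (D s t).
Proof.
move=> s0; rewrite le_eqVlt => /predU1P[<-|st]; last first.
  split; first by apply: (measurable_increment bm) => //; exact: le_trans (ltW st).
  exact: (integrable_increment_sqr bm s0 st).
rewrite (_ : D s s = cst 0); last by apply/funext => w; rewrite /D subrr.
split => //; rewrite (_ : _ \o _ = EFin \o cst 0); last first.
  by apply/funext => w /=; rewrite expr0n.
exact: finite_measure_integrable_cst.
Qed.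

Let E0 s t (V : T -> R) : 0 <= s -> s <= t -> measurable_wrt (natural_filtration B s) V ->
  L2 V -> \int[P]_w (V w * D s t w) = 0.
Proof.
move=> s0; rewrite le_eqVlt => /predU1P[<- mV LV|st mV [_ LV]]; last exact: integral_past_increment0.
rewrite -[RHS](Rintegral_cst_probability P 0).
by apply: eq_Rintegral => w _; rewrite /D subrr mulr0.
Qed.

Let E2 s t (V : T -> R) (M : R) : 0 <= s -> s <= t -> measurable_wrt (natural_filtration B s) V ->
  (forall w, `|V w| <= M) -> \int[P]_w (V w * D s t w ^+ 2) = (t - s) * \int[P]_w V w.
Proof.
move=> s0; rewrite le_eqVlt => /predU1P[<- mV LV|st mV VM]; last exact: integral_past_increment_sqr VM.
rewrite subrr mul0r -[RHS](Rintegral_cst_probability P 0).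
by apply: eq_Rintegral => w _; rewrite /D subrr expr0n mulr0.
Qed.

Let pastW s t (X : T -> R) : s <= t -> measurable_wrt (natural_filtration B s) X ->
  measurable_wrt (natural_filtration B t) X.
Proof. exact: measurable_wrt_mono. Qed.

Let pastD r s t : 0 <= r -> r <= s -> s <= t -> measurable_wrt (natural_filtration B t) (D r s).
Proof.
move=> r0 rs st; apply: measurable_wrtB; apply: measurable_wrt_self => //.
- exact: le_trans rs.
- exact: le_trans st.
Qed.

(** [D c n] is [D c m] plus [D m n], and the latter is centered given the past of [m]. *)
Let nested c m n (U : T -> R) (M : R) : 0 <= c -> c <= m -> m <= n ->
  measurable_wrt (natural_filtration B c) U -> (forall w, `|U w| <= M) ->
  \int[P]_w (U w * (D c m w * D c n w)) = (m - c) * \int[P]_w U w.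
Proof.
move=> c0 cm mn mU UM; have m0 := le_trans c0 cm.
have mUT := measurable_wrt_measurable bm mU.
have LU : L2 (fun w => U w * D c m w) by apply: L2_bddM UM _ => //; exact: L2D.
have LD := L2D c0 cm.
transitivity (\int[P]_w (U w * D c m w ^+ 2 + (U w * D c m w) * D m n w)).
  by apply: eq_Rintegral => w _; rewrite /D; ring.
rewrite RintegralD //.
- rewrite (E2 c0 cm mU UM) E0 ?addr0 //.
  apply: measurable_wrtM; first exact: pastW mU.
  exact: pastD.
- rewrite (_ : _ \o _ = EFin \o (fun w => (U w * D c m w) * D c m w)); first exact: L2M.
  by apply/funext => w /=; rewrite -mulrA -expr2.
- by apply: L2M => //; exact: L2D.
Qed.

(** Everything but the last increment is known at its starting time, and that increment is
    centered. *)
Let disjoint_ordered a b c e (V W : T -> R) (M N : R) : 0 <= a -> a <= b -> b <= c -> c <= e ->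
  measurable_wrt (natural_filtration B a) V -> (forall w, `|V w| <= M) ->
  measurable_wrt (natural_filtration B c) W -> (forall w, `|W w| <= N) ->
  \int[P]_w ((V w * D a b w) * (W w * D c e w)) = 0.
Proof.
move=> a0 ab bc ce mV VM mW WN.
have mVT := measurable_wrt_measurable bm mV; have mWT := measurable_wrt_measurable bm mW.
have c0 := le_trans a0 (le_trans ab bc).
transitivity (\int[P]_w ((W w * (V w * D a b w)) * D c e w)).
  by apply: eq_Rintegral => w _; ring.
apply: E0 => //.
  apply: measurable_wrtM => //; apply: measurable_wrtM.
    by apply: pastW mV; exact: le_trans bc.
  exact: pastD.
by apply: L2_bddM WN _ => //; apply: L2_bddM VM _ => //; exact: L2D.
Qed.

Lemma integral_two_increments a b c e (V W : T -> R) (M N : R) : 0 <= a -> a <= b -> 0 <= c -> c <= e ->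
  measurable_wrt (natural_filtration B a) V -> (forall w, `|V w| <= M) ->
  measurable_wrt (natural_filtration B c) W -> (forall w, `|W w| <= N) ->
  P.-integrable setT (EFin \o (fun w => (V w * D a b w) * (W w * D c e w))) /\
  \int[P]_w ((V w * D a b w) * (W w * D c e w)) =
    overlap a b c e * \int[P]_w (V w * W w).
Proof.
move=> a0 ab c0 ce mV VM mW WN.
have mVT := measurable_wrt_measurable bm mV; have mWT := measurable_wrt_measurable bm mW.
split.
  by apply: L2M; [apply: L2_bddM VM _|apply: L2_bddM WN _] => //; exact: L2D.
wlog ac : a b c e V W M N a0 ab c0 ce mV VM mW WN mVT mWT / a <= c.
  move=> H; case: (leP a c) => [ac|/ltW ca]; first exact: H VM _ WN _ _ _.
  transitivity (\int[P]_w ((W w * D c e w) * (V w * D a b w))).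
    by apply: eq_Rintegral => w _; rewrite mulrC.
  rewrite (H _ _ _ _ _ _ _ _ c0 ce a0 ab mW WN mV VM) //.
  rewrite /overlap (minC e b) (maxC c a); congr (_ * _).
  by apply: eq_Rintegral => w _; rewrite mulrC.
case: (leP b c) => [bc|/ltW cb].
  rewrite (disjoint_ordered a0 ab bc ce mV VM mW WN) /overlap [Num.max 0 _]max_l ?mul0r //.
  by rewrite subr_le0 (max_r ac) ge_min bc.
have mVc := pastW ac mV.
have mU : measurable_wrt (natural_filtration B c) (fun w => V w * W w).
  exact: measurable_wrtM.
have UM w : `|V w * W w| <= M * N by rewrite normrM ler_pM.
(* The first increment is cut at [c]. The part before [c] contributes nothing; the two remaining
   increments both start at [c], and minimum and maximum put the shorter one first. *)
transitivity (\int[P]_w ((V w * D a c w) * (W w * D c e w)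
    + (V w * W w) * (D c (Num.min b e) w * D c (Num.max b e) w))).
  apply: eq_Rintegral => w _.
  rewrite (_ : D c (Num.min b e) w * D c (Num.max b e) w = D c b w * D c e w).
    by rewrite /D; ring.
  by case: (leP b e) => _ //; rewrite mulrC.
rewrite RintegralD //.
- rewrite (disjoint_ordered a0 ac (lexx c) ce mV VM mW WN) add0r.
  rewrite (@nested _ _ _ _ (M * N)) //.
  + rewrite /overlap (max_r ac) [Num.max 0 _]max_r // subr_ge0 le_min cb //.
  + by rewrite le_min cb.
  + by rewrite ge_min le_max lexx.
- by apply: L2M; [apply: L2_bddM VM _|apply: L2_bddM WN _] => //; exact: L2D.
- rewrite (_ : _ \o _ = EFin \o (fun w => (V w * D c (Num.min b e) w) * (W w * D c (Num.max b e) w))).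
    apply: L2M; [apply: L2_bddM VM _|apply: L2_bddM WN _] => //; apply: L2D => //.
      by rewrite le_min cb.
    by rewrite le_max cb.
  by apply/funext => w /=; congr EFin; ring.
Qed.

(** The intervals may overlap and come in any order, as all pairs of increments are compared
    directly. This covers the difference of two simple processes without a common refinement of
    their partitions. *)
Lemma ito_isometry (I : finType) (lo hi : I -> R) (c : I -> T -> R) :
  (forall i, 0 <= lo i) -> (forall i, lo i <= hi i) ->
  (forall i, measurable_wrt (natural_filtration B (lo i)) (c i)) ->
  (forall i, exists M : R, forall w, `|c i w| <= M) ->
  (\int[P]_w ((\sum_i c i w * (B (hi i) w - B (lo i) w)) ^+ 2)%:E =
   square_norm P (fun s w => (\sum_i c i w * \1_(`]lo i, hi i]%classic) s)%R))%E.
Proof.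
move=> lo0 lohi mc /choice[M cM].
pose ov i j := overlap (lo i) (hi i) (lo j) (hi j).
have X i j := integral_two_increments (lo0 i) (lohi i) (lo0 j) (lohi j) (mc i) (cM i) (mc j) (cM j).
have mcT i := measurable_wrt_measurable bm (mc i).
have icc i j : P.-integrable setT (EFin \o (fun w => c i w * c j w)).
  apply: integrable_bddM (cM i) _ => //.
  exact: integrable_bdd (cM j).
transitivity ((\sum_i \sum_j ov i j * \int[P]_w (c i w * c j w))%:E).
  under eq_integral do rewrite expr2 big_distrlr /=.
  rewrite -EFin_Rintegral.
    congr EFin; rewrite Rintegral_sum; last first.
      by move=> i; apply: integrable_Rsum => j; exact: (X i j).1.
    apply: eq_bigr => i _; rewrite Rintegral_sum; last by move=> j; exact: (X i j).1.
    by apply: eq_bigr => j _; exact: (X i j).2.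
  by apply: integrable_Rsum => i; apply: integrable_Rsum => j; exact: (X i j).1.
rewrite /square_norm.
transitivity (\int[P]_w (\sum_i \sum_j ov i j * (c i w * c j w))%:E)%E; last first.
  apply: eq_integral => w _.
  have iM i j := integrable_RZ (c i w * c j w) (indic_mul_integral (lo i) (hi i) (lo j) (hi j)).1.
  rewrite [RHS]integral_mkcond.
  transitivity (\int[mu]_s (\sum_i \sum_j (c i w * c j w) *
      (\1_(`]lo i, hi i]%classic) s * \1_(`]lo j, hi j]%classic) s))%:E)%E; last first.
    apply: eq_integral => s _; rewrite patchE; case: ifPn => [_|].
      congr EFin; rewrite expr2 big_distrlr /=; apply: eq_bigr => i _.
      by apply: eq_bigr => j _; rewrite mulrACA.
    rewrite notin_setE /= in_itv /= andbT => /negP; rewrite -ltNge => s0.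
    rewrite big1 // => i _; rewrite big1 // => j _.
    (* Left end points are nonnegative, so the integrand vanishes at negative times and the
       half-line may be replaced by the line. *)
    rewrite (_ : \1_(`]lo i, hi i]%classic) s = 0) ?mul0r ?mulr0 //.
    rewrite indicE memNset //= in_itv /= => /andP[los _].
    by have := lt_trans (le_lt_trans (lo0 i) los) s0; rewrite ltxx.
  rewrite -EFin_Rintegral; last by apply: integrable_Rsum => i; apply: integrable_Rsum => j; exact: iM.
  congr EFin; rewrite Rintegral_sum; last by move=> i; apply: integrable_Rsum => j; exact: iM.
  apply: eq_bigr => i _; rewrite Rintegral_sum; last by move=> j; exact: iM.
  apply: eq_bigr => j _; rewrite RintegralZl //; last first.
    exact: (indic_mul_integral (lo i) (hi i) (lo j) (hi j)).1.
  rewrite mulrC; congr (_ * _).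
  exact/esym/(indic_mul_integral (lo i) (hi i) (lo j) (hi j)).2.
have icZ i j := integrable_RZ (ov i j) (icc i j).
rewrite -EFin_Rintegral; last by apply: integrable_Rsum => i; apply: integrable_Rsum => j; exact: icZ.
congr EFin; rewrite Rintegral_sum; last by move=> i; apply: integrable_Rsum => j; exact: icZ.
apply: eq_bigr => i _; rewrite Rintegral_sum; last by move=> j; exact: icZ.
by apply: eq_bigr => j _; rewrite RintegralZl.
Qed.

End isometry.

(** * The dilated kernel *)

Section continuous_integrands.
Context (R : realType).
Notation mu := (@lebesgue_measure R).

Lemma continuous_integrable_oc (f : R -> R) (a b : R) : continuous f ->
  mu.-integrable `]a, b] (EFin \o f).
Proof.
move=> cf; apply: (@integrableS _ _ _ mu `[a, b]) => //.
  by apply: subset_itv; rewrite bnd_simp.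
apply: continuous_compact_integrable; first exact: segment_compact.
exact: continuous_subspaceT.
Qed.

(** Trades a bound on x for one on x^2: near the peak, either x <= 1 / e or x <= e x^2. With e
    small, the integral of x is controlled by that of x^2 and by the length of a short interval. *)
Lemma ler_split_sqr (x e : R) (near_t : bool) : 0 <= x -> 0 < e ->
  (~~ near_t -> x ^+ 2 <= e ^+ 2) -> x <= e + (e * x ^+ 2 + e^-1 * near_t%:R).
Proof.
move=> x0 e0; have i0 : 0 < e^-1 by rewrite invr_gt0.
have q0 : 0 <= e * x ^+ 2 by rewrite mulr_ge0 ?sqr_ge0 ?ltW.
case: near_t => /= [_|/(_ isT)].
  have [ex|/ltW ex] := leP (e * x) 1.
    have : x <= e^-1 by rewrite -[e^-1]mul1r ler_pdivlMr // mulrC.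
    by rewrite mulr1; lra.
  have : x <= e * x ^+ 2 by rewrite expr2 mulrA ler_peMl.
  by rewrite mulr1; lra.
rewrite ler_sqr ?nnegrE ?(ltW e0) // mulr0; lra.
Qed.

End continuous_integrands.

Section dilation.
Context (R : realType).
Notation mu := (@lebesgue_measure R).
Variable psi : R -> R.
Hypothesis psi_ge0 : forall x, 0 <= psi x.
Hypothesis psi_continuous : continuous psi.
Hypothesis psi_norm : (\int[mu]_x ((psi x) ^+ 2)%:E = 1)%E.
Hypothesis psi_littleo : littleo_infinity (fun x => (psi x) ^+ 2) (fun x => `|x|^-1).

Lemma dilation_sqr n x : dilation psi n x ^+ 2 = n%:R * psi (n%:R * x) ^+ 2.
Proof. by rewrite /dilation exprMn sqr_sqrtr. Qed.

Lemma dilation_ge0 n x : 0 <= dilation psi n x.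
Proof. by rewrite mulr_ge0 ?sqrtr_ge0. Qed.

Lemma continuous_dilation n : continuous (dilation psi n).
Proof.
move=> x; apply: cvgM; first exact: cvg_cst.
apply: (cvg_comp (fun y => n%:R * y) psi); last exact: psi_continuous.
exact: mulrl_continuous.
Qed.

Lemma continuous_dilationB n (t : R) : continuous (fun s => dilation psi n (t - s)).
Proof.
move=> x; apply: (cvg_comp (fun s => t - s) (dilation psi n)).
  by apply: cvgB; [exact: cvg_cst|exact: cvg_id].
exact: continuous_dilation.
Qed.

(** With y = n x, the bound psi(y)^2 <= eps r / |y| multiplied by n becomes eps r / |x|, which is at
    most eps as soon as |x| >= r. *)
Lemma dilation_far (r eps : R) : 0 < r -> 0 < eps ->
  exists N : nat, forall n x, (N <= n)%N -> r <= `|x| -> dilation psi n x ^+ 2 <= eps.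
Proof.
move=> r0 e0.
have [[A [_ HA]] [A' [_ HA']]] := psi_littleo (mulr_gt0 e0 r0).
(* From this index on, |x| >= r puts n x beyond both thresholds of the little-o. *)
exists (Num.bound (Num.max `|A| `|A'| / r)).+1 => n x nN rx.
have n0 : 0 < n%:R :> R by rewrite ltr0n; case: n nN.
have x0 : 0 < `|x| by exact: lt_le_trans rx.
have big : Num.max `|A| `|A'| < n%:R * `|x|.
  have mr : Num.max `|A| `|A'| / r < n%:R.
    apply: lt_le_trans (archi_boundP _) _; first by rewrite divr_ge0 ?le_max ?normr_ge0 ?ltW.
    by rewrite ler_nat ltnW.
  rewrite ltr_pdivrMr // in mr; apply: lt_le_trans mr _.
  by rewrite ler_wpM2l // ltW.
have key : `|psi (n%:R * x) ^+ 2| <= (eps * r) * `| `|n%:R * x|^-1|.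
  move: big; rewrite gt_max => /andP[bA bA'].
  case: (leP 0 x) => x0'.
    apply: HA; apply: le_lt_trans (ler_norm A) _.
    by rewrite (ger0_norm x0') in bA.
  apply: HA'; rewrite (ltr0_norm x0') in bA'.
  rewrite -ltrN2 -mulrN; apply: le_lt_trans bA'.
  by rewrite -normrN ler_norm.
rewrite dilation_sqr.
apply: (@le_trans _ _ (n%:R * ((eps * r) * `| `|n%:R * x|^-1|))).
  by rewrite ler_wpM2l ?(ltW n0) // (le_trans _ key) // ler_norm.
rewrite ger0_norm ?invr_ge0 // normrM (gtr0_norm n0).
rewrite (_ : _ * _ = eps * r / `|x|); last by field; rewrite !gt_eqF.
by rewrite ler_pdivrMr // ler_wpM2l // ltW.
Qed.

(** The substitution x = (n + 1) (t - s) moves the dilation into the indicator, so that the fixed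
    function psi^2 dominates as n tends to infinity. *)
Lemma integral_dilation_sqr (t : R) n (A : set R) : measurable A -> 
  (\int[mu]_(s in A) (dilation psi n.+1 (t - s) ^+ 2)%:E =
   \int[mu]_x (psi x ^+ 2 * \1_A (t - x / n.+1%:R))%:E)%E.
Proof.
move=> mA; set m : R := n.+1%:R.
have m0 : m != 0 by rewrite pnatr_eq0.
have mpsi : measurable_fun setT psi by exact: continuous_measurable_fun.
pose f x := (psi x ^+ 2 * \1_A (t - x / m))%:E.
have mf : measurable_fun setT f.
  apply/measurable_EFinP; apply: measurable_funM; first exact: measurable_funX.
  apply: (measurableT_comp (measurable_indic _)) => //.
  apply: measurable_funB => //; exact: measurable_funM.
have f0 x : (0 <= f x)%E by rewrite lee_fin mulr_ge0 ?sqr_ge0 // indicE.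
rewrite -[RHS](ge0_integral_affine (m * t) (_ : - m != 0)) ?oppr_eq0 //.
rewrite normrN -ge0_integralZl //; last 2 first.
- by apply: (measurableT_comp mf); apply: measurable_funD => //.
- by move=> x _; exact: f0.
rewrite [LHS]integral_mkcond; apply: eq_integral => s _.
rewrite patchE /f -EFinM.
have -> : t - (- m * s + m * t) / m = s by field.
rewrite indicE dilation_sqr -/m; case: ifP => _; last by rewrite mulr0 mulr0.
rewrite mulr1 ger0_norm //; congr (_ * psi _ ^+ 2)%:E; ring.
Qed.

Let mpsi : measurable_fun setT psi.
Proof. exact: continuous_measurable_fun. Qed.

Let mpsi2 : measurable_fun setT (fun x => (psi x ^+ 2)%:E).
Proof. by apply/measurable_EFinP; exact: measurable_funX. Qed.

Lemma integrable_psi_sqr : mu.-integrable setT (fun x => (psi x ^+ 2)%:E).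
Proof.
apply/integrableP; split => //.
under eq_integral do rewrite gee0_abs ?lee_fin ?sqr_ge0 //.
by rewrite psi_norm ltry.
Qed.

Let mcut (t m : R) (A : set R) : measurable A ->
  measurable_fun setT (fun x => (psi x ^+ 2 * \1_A (t - x / m))%:E).
Proof.
move=> mA; apply/measurable_EFinP; apply: measurable_funM; first exact: measurable_funX.
apply: (measurableT_comp (measurable_indic _)) => //.
by apply: measurable_funB => //; exact: measurable_funM.
Qed.

Lemma integral_dilation_sqr_le1 (t : R) n (A : set R) : measurable A ->
  (\int[mu]_(s in A) (dilation psi n.+1 (t - s) ^+ 2)%:E <= 1)%E.
Proof.
move=> mA; rewrite integral_dilation_sqr // -psi_norm.
apply: ge0_le_integral => //.
- by move=> x _; rewrite lee_fin mulr_ge0 ?sqr_ge0 // indicE.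
- exact: mcut.
- by move=> x _; rewrite lee_fin ler_piMr ?sqr_ge0 // indicE lern1 leq_b1.
Qed.

(** The point t - x / (n + 1) tends to t. For t > 0 it eventually lies in the interval; for t = 0
    the interval starts at t itself, and only negative x bring the point into it. Dominated
    convergence gives mass 1 in both cases. *)
Lemma cvg_integral_dilation_sqr (t del : R) : 0 <= t -> 0 < del ->
  (t = 0 -> (\int[mu]_(x in `]-oo, 0%R]) ((psi x) ^+ 2)%:E = 1)%E) ->
  (\int[mu]_(s in `](Num.max 0 (t - del))%R, (t + del)%R]) (dilation psi n.+1 (t - s) ^+ 2)%:E
     @[n --> \oo] --> 1)%E.
Proof.
move=> t0 d0 bound; set A := [set` _].
have mA : measurable A by exact: measurable_itv.
pose g x := (psi x ^+ 2 * ((0 < t) || (x < 0))%:R)%:E.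
have cvgt (x : R) : t - x / n.+1%:R @[n --> \oo] --> t.
  rewrite -[X in _ --> X]subr0; apply: cvgB; first exact: cvg_cst.
  rewrite -(mulr0 x); apply: cvgM; first exact: cvg_cst.
  exact: cvg_harmonic.
have cvgg (x : R) : (psi x ^+ 2 * \1_A (t - x / n.+1%:R))%:E @[n --> \oo] --> g x.
  apply: cvg_near_cst; rewrite /g.
  have [tpos|] := ltP 0 t.
    near=> n; congr (_ * _)%:E; rewrite indicE mem_set // /A /= in_itv /=.
    apply/andP; split.
      rewrite gt_max; apply/andP; split; near: n; apply: (cvgr_gt t (cvgt x)) => //.
      by rewrite ltrBlDr ltrDl.
    by near: n; apply: (cvgr_le t (cvgt x)) => //; rewrite ltrDl.
  move=> tneg; have te : t = 0 by apply/eqP; rewrite eq_le tneg t0.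
  have Amax : Num.max 0 (t - del) = 0 by rewrite max_l // te sub0r oppr_le0 ltW.
  have [xneg|xpos] := ltP x 0.
    near=> n; congr (_ * _)%:E; rewrite indicE mem_set // /A /= in_itv /= Amax.
    apply/andP; split; first by rewrite te sub0r oppr_gt0 pmulr_llt0 // invr_gt0 ltr0n.
    by near: n; apply: (cvgr_le t (cvgt x)) => //; rewrite ltrDl.
  near=> n; congr (_ * _)%:E; rewrite indicE memNset // /A /= in_itv /= Amax.
  by apply/negP; rewrite negb_and -leNgt te sub0r oppr_le0 divr_ge0.
have g1 : (\int[mu]_x g x = 1)%E.
  have [tpos|tneg] := ltP 0 t.
    by rewrite -psi_norm; apply: eq_integral => x _; rewrite /g tpos mulr1.
  have te : t = 0 by apply/eqP; rewrite eq_le tneg t0.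
  rewrite -(bound te) -integral_itv_bndo_bndc; last by apply: measurable_funTS.
  rewrite [RHS]integral_mkcond; apply: eq_integral => x _.
  rewrite patchE /g te ltxx /= mem_setE in_itv /=.
  by case: ifP => _; rewrite ?mulr1 ?mulr0.
rewrite -g1.
under eq_fun do rewrite integral_dilation_sqr //.
have [||||| _ _ //] := @dominated_convergence _ _ _ mu setT measurableT
  (fun n x => (psi x ^+ 2 * \1_A (t - x / n.+1%:R))%:E) g (fun x => (psi x ^+ 2)%:E).
- by move=> n; exact: mcut.
- apply: (emeasurable_fun_cvg (fun n x => (psi x ^+ 2 * \1_A (t - x / n.+1%:R))%:E)).
    by move=> n; exact: mcut.
  by move=> x _; exact: cvgg.
- by apply: aeW => x _; exact: cvgg.
- exact: integrable_psi_sqr.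
- apply: aeW => x n _; rewrite gee0_abs ?lee_fin; last by rewrite mulr_ge0 ?sqr_ge0 // indicE.
  by rewrite ler_piMr ?sqr_ge0 // indicE lern1 leq_b1.
Unshelve. all: by end_near. Qed.

(** The fixed kernel psi_m is bounded, so it is enough that psi_n tends to 0 in L^1 on the interval:
    its L^2 mass concentrates on a vanishing set. *)
Lemma dilation_cross (t a b eta : R) (m : nat) : (exists M, forall x, psi x <= M) ->
  a <= b -> 0 < eta ->
  exists N : nat, forall n, (N <= n)%N ->
    0 <= \int[mu]_(s in `]a, b]) (dilation psi n (t - s) * dilation psi m (t - s)) <= eta.
Proof.
move=> [M psiM] ab eta0.
have M0 : 0 <= M by exact: le_trans (psi_ge0 0) (psiM 0).
pose C := Num.sqrt m%:R * M.
have C0 : 0 <= C by rewrite mulr_ge0 ?sqrtr_ge0.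
have dC x : dilation psi m x <= C by rewrite ler_wpM2l ?sqrtr_ge0.
(* The three parts of [ler_split_sqr] contribute e (b - a), e times a mass at most 1, and 1 / e
   times the length 2 e^2 of the peak zone: in total e (b - a + 3), to be multiplied by C. *)
pose e := eta / ((C + 1) * (b - a + 3)).
have ba3 : 0 < b - a + 3 by rewrite ltr_wpDl ?subr_ge0.
have C1 : 0 < C + 1 by rewrite ltr_wpDl.
have e0 : 0 < e by rewrite divr_gt0 // mulr_gt0.
have e20 : 0 < e ^+ 2 by rewrite exprn_gt0.
have [N HN] := dilation_far e20 e20.
exists N.+1 => -[//|n]; rewrite ltnS => Nn.
apply/andP; split.
  by apply: Rintegral_ge0 => x _; rewrite mulr_ge0 ?dilation_ge0.
pose E : set R := `[t - e ^+ 2, t + e ^+ 2]%classic.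
have mE : measurable (E : set R) by exact: measurable_itv.
have md k : measurable_fun setT (fun s : R => dilation psi k (t - s)).
  by apply: continuous_measurable_fun; exact: continuous_dilationB.
have md2 : measurable_fun (`]a, b]%classic : set R) (fun s : R => (dilation psi n.+1 (t - s) ^+ 2)%:E).
  by apply/measurable_EFinP; apply: measurable_funTS; apply: measurable_funX.
have mD : measurable (`]a, b]%classic : set R) by exact: measurable_itv.
have mI : measurable_fun (`]a, b]%classic : set R) (fun s : R => (\1_E s)%:E : \bar R).
  by apply/measurable_EFinP; apply: measurable_funTS; exact: measurable_indic.
suff : (\int[mu]_(s in `]a, b]) (dilation psi n.+1 (t - s) * dilation psi m (t - s))%:E <= eta%:E)%E.
  have fi : (\int[mu]_(s in `]a, b]) (dilation psi n.+1 (t - s) * dilation psi m (t - s))%:E \is a fin_num)%E.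
    apply: integrable_fin_num => //; apply: continuous_integrable_oc => x.
    by apply: cvgM; exact: continuous_dilationB.
  by rewrite /Rintegral -lee_fin fineK.
apply: (@le_trans _ _ (\int[mu]_(s in `]a, b]) (C%:E * (e%:E + (e%:E * (dilation psi n.+1 (t - s) ^+ 2)%:E
   + e^-1%:E * (\1_E s)%:E))))%E).
  apply: ge0_le_integral => //.
  - by move=> x _; rewrite lee_fin mulr_ge0 ?dilation_ge0.
  - by apply/measurable_EFinP; apply: measurable_funTS; apply: measurable_funM; exact: md.
  - apply: measurable_funeM; apply: emeasurable_funD => //.
    by apply: emeasurable_funD; exact: measurable_funeM.
  - move=> s _.
    rewrite [leRHS](_ : _ = (C * (e + (e * dilation psi n.+1 (t - s) ^+ 2
      + e^-1 * \1_E s)))%:E) // lee_fin mulrC.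
    apply: ler_pM; rewrite ?dilation_ge0 //.
    rewrite indicE; apply: ler_split_sqr; rewrite ?dilation_ge0 // => snE.
    apply: HN; first exact: leqW.
    rewrite leNgt; apply: contra snE => small.
    rewrite inE /E /= in_itv /= -ler_distlC.
    exact: ltW.
have mde : measurable_fun (`]a, b]%classic : set R) (fun s : R => e%:E * (dilation psi n.+1 (t - s) ^+ 2)%:E)%E.
  exact: measurable_funeM.
have mIe : measurable_fun (`]a, b]%classic : set R) (fun s : R => e^-1%:E * (\1_E s)%:E)%E.
  exact: measurable_funeM.
have de0 x : (0 <= e%:E * (dilation psi n.+1 (t - x) ^+ 2)%:E)%E.
  by rewrite -EFinM lee_fin mulr_ge0 ?sqr_ge0 ?ltW.
have Ie0 x : (0 <= e^-1%:E * (\1_E x)%:E)%E.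
  by apply: mule_ge0; rewrite lee_fin ?invr_ge0 ?(ltW e0) // indicE.
rewrite ge0_integralZl //; last 2 first.
- by apply: emeasurable_funD => //; exact: emeasurable_funD.
- by move=> x _; apply: adde_ge0; [rewrite lee_fin ltW|exact: adde_ge0].
rewrite ge0_integralD //; last 3 first.
- by move=> x _; rewrite lee_fin ltW.
- by move=> x _; exact: adde_ge0.
- exact: emeasurable_funD.
rewrite ge0_integralD // !ge0_integralZl //; try (by rewrite lee_fin ?invr_ge0 ltW);
  try (by move=> x _; rewrite lee_fin ?indicE ?sqr_ge0).
have lenD : (mu `]a, b]%classic = (b - a)%:E)%E.
  rewrite lebesgue_measure_itv /= lte_fin; case: ltP => [_|ba]; first by rewrite -EFinB.
  by rewrite (_ : a = b) ?subrr //; apply/eqP; rewrite eq_le ab.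
have lenE : (\int[mu]_(s in `]a, b]) (\1_E s)%:E <= (2 * e ^+ 2)%:E)%E.
  rewrite integral_indic //.
  apply: (@le_trans _ _ (mu E)).
    apply: le_measure; rewrite ?inE //; exact: measurableI.
  rewrite lebesgue_measure_itv /= lte_fin; case: ifP => _; last by rewrite lee_fin mulr_ge0 ?ltW.
  by rewrite -EFinB lee_fin; lra.
have -> : (\int[mu]_(x in `]a, b]) e%:E = e%:E * (b - a)%:E)%E.
  by rewrite integral_cst //; congr (_ * _)%E.
apply: (@le_trans _ _ (C%:E * (e%:E * (b - a)%:E + (e%:E * 1 + e^-1%:E * (2 * e ^+ 2)%:E))))%E.
  apply: lee_wpmul2l; first by rewrite lee_fin.
  apply: leeD => //; apply: leeD; apply: lee_wpmul2l; rewrite ?lee_fin ?invr_ge0 ?(ltW e0) //.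
  exact: integral_dilation_sqr_le1.
rewrite mule1 [leLHS](_ : _ = (C * (e * (b - a) + (e + e^-1 * (2 * e ^+ 2))))%:E) // lee_fin.
rewrite (_ : _ * _ = C * (e * (b - a + 3))); last by field; rewrite gt_eqF.
apply: (@le_trans _ _ ((C + 1) * (e * (b - a + 3)))).
  by rewrite ler_wpM2r ?lerDl // mulr_ge0 // ltW.
by rewrite mulrCA [leLHS](_ : _ = eta) // /e; field; rewrite !gt_eqF.
Qed.

End dilation.

(** * Riemann sums on uniform meshes *)

Section riemann.
Context (R : realType).
Notation mu := (@lebesgue_measure R).

(** Only [x] is confined to the segment. Compactness, in the form of near coverings, makes one [del]
    work for all [x]. *)
Lemma continuous_uniform_itv (f : R -> R) (a b eta : R) : continuous f -> 0 < eta ->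
  exists2 del, 0 < del & forall x y, a <= x <= b -> `|x - y| < del -> `|f x - f y| <= eta.
Proof.
move=> cf eta0.
have /compact_near_coveringP cab := @segment_compact R a b.
have := cab R (0^'+) (fun del x => forall y, `|x - y| < del -> `|f x - f y| <= eta) _.
case.
  move=> x _; have e2 : 0 < eta / 2 by rewrite divr_gt0.
  have /cvgrPdist_le/(_ _ e2) /nbhs_ballP[r /= r0 Hr] := cf x.
  have r2 : 0 < r / 2 by rewrite divr_gt0.
  near=> x' del; rewrite /= => y x'y.
  have xx' : `|x - x'| < r / 2 by near: x'; apply/nbhs_ballP; exists (r / 2).
  have dr : del <= r / 2 by near: del; exact: nbhs_right_le.
  have xy : `|x - y| < r.
    rewrite (le_lt_trans (ler_distD x' _ _)) // [r]splitr ltrD //.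
    exact: lt_le_trans dr.
  rewrite (le_trans (ler_distD (f x) _ _)) // [eta]splitr lerD //.
    by rewrite distrC; apply: Hr; rewrite /ball /= (lt_trans xx') // ltr_pdivrMr // ltr_pMr // ltr1n.
  by apply: Hr.
move=> del /= del0 H.
exists (del / 2); first by rewrite divr_gt0.
move=> x y xab; apply: (H (del / 2)) => /=.
- by rewrite sub0r normrN gtr0_norm ?divr_gt0 // ltr_pdivrMr // ltr_pMr // ltr1n.
- by rewrite divr_gt0.
- by rewrite in_itv.
Unshelve. all: by end_near. Qed.

Definition step (f : R -> R) (a h : R) (K : nat) (s : R) : R :=
  \sum_(i < K) f (tick a h i) * \1_(`]tick a h i, tick a h i.+1]%classic) s.

Lemma sum_indic_tick (a h : R) K s : 0 < h ->
  \sum_(i < K) \1_(`]tick a h i, tick a h i.+1]%classic) s = \1_(`]a, tick a h K]%classic) s :> R.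
Proof.
move=> h0; elim: K => [|K IH].
  by rewrite big_ord0 /tick mul0r addr0 set_itvoc0 indicE in_set0.
rewrite big_ord_recr /= IH !indicE !mem_setE !in_itv /=.
have lt1 := tick_lt a h0 K.
have le1 : a <= tick a h K by exact: tick_ge.
have [sK|Ks] := leP s (tick a h K).
  by rewrite (le_trans sK (ltW lt1)) addr0.
by rewrite (le_lt_trans le1 Ks) /= add0r.
Qed.

Lemma step_close (f : R -> R) (a h eta : R) K s : 0 < h ->
  (forall i x, (i < K)%N -> tick a h i <= x <= tick a h i.+1 -> `|f (tick a h i) - f x| <= eta) ->
  `|step f a h K s - f s * \1_(`]a, tick a h K]%classic) s| <= eta * \1_(`]a, tick a h K]%classic) s.
Proof.
move=> h0 close; rewrite -sum_indic_tick // !mulr_sumr /step -sumrB.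
apply: le_trans (ler_norm_sum _ _ _) _; apply: ler_sum => i _.
rewrite -mulrBl normrM [`|\1_ _ _|]ger0_norm ?indicE //.
have [|] := boolP (s \in _); last by rewrite !mulr0.
rewrite !mulr1 inE /= in_itv /= => /andP[s1 s2]; apply: close => //.
by rewrite (ltW s1).
Qed.

Definition mesh (a b : R) (K : nat) : R := (b - a) / K.+1%:R.

Lemma mesh_gt0 a b K : a < b -> 0 < mesh a b K.
Proof. by move=> ab; rewrite divr_gt0 ?subr_gt0 ?ltr0n. Qed.

Lemma tick_mesh a b K : tick a (mesh a b K) K.+1 = b.
Proof. by rewrite /tick /mesh mulrC divfK ?pnatr_eq0 // addrC subrK. Qed.

Lemma fine_mesh (f : R -> R) (a b eta : R) : a < b -> continuous f -> 0 < eta ->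
  exists K0 : nat, forall K i x, (K0 <= K)%N -> (i < K.+1)%N ->
    tick a (mesh a b K) i <= x <= tick a (mesh a b K) i.+1 ->
    `|f (tick a (mesh a b K) i) - f x| <= eta.
Proof.
move=> ab cf eta0; have [del del0 H] := continuous_uniform_itv a b cf eta0.
exists (Num.bound ((b - a) / del)) => K i x K0K iK /andP[x1 x2].
have m0 := mesh_gt0 K ab.
apply: H.
  rewrite tick_ge //= -{2}(tick_mesh a b K); apply: tick_le => //; exact: ltnW.
rewrite distrC ger0_norm ?subr_ge0 //.
apply: (@le_lt_trans _ _ (mesh a b K)).
  by rewrite -[leRHS](tick_diff a (mesh a b K) i) lerD2r.
rewrite /mesh ltr_pdivrMr ?ltr0n // mulrC -ltr_pdivrMr //.
apply: lt_le_trans (archi_boundP _) _; first by rewrite divr_ge0 ?subr_ge0 ?ltW.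
by rewrite ler_nat leqW.
Qed.

Lemma integrable_step f a h K : mu.-integrable setT (EFin \o step f a h K).
Proof.
apply: integrable_Rsum => i; apply: integrable_RZ; exact: integrable_indic_itv.
Qed.

Lemma integral_step f a h K : 0 < h ->
  \int[mu]_s step f a h K s = \sum_(i < K) f (tick a h i) * h.
Proof.
move=> h0; rewrite Rintegral_sum; last first.
  by move=> i; apply: integrable_RZ; exact: integrable_indic_itv.
apply: eq_bigr => i _; rewrite RintegralZl //; last exact: integrable_indic_itv.
congr (_ * _); rewrite /Rintegral integral_indic // setIT /= lebesgue_measure_itv /=.
by rewrite lte_fin tick_lt // -EFinB /= tick_diff.
Qed.

Lemma riemann_sum (f : R -> R) (a b eta : R) : a < b -> continuous f -> 0 < eta ->
  exists K0 : nat, forall K, (K0 <= K)%N ->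
    `|\sum_(i < K.+1) f (tick a (mesh a b K) i) * mesh a b K
      - \int[mu]_(s in `]a, b]) f s| <= eta.
Proof.
move=> ab cf eta0.
(* A uniform error eta / (b - a) integrates to eta over the interval. *)
have e0 : 0 < eta / (b - a) by rewrite divr_gt0 ?subr_gt0.
have [K0 HK] := fine_mesh ab cf e0.
exists K0 => K K0K; have m0 := mesh_gt0 K ab.
rewrite -integral_step // [X in _ - X]Rintegral_mkcond.
have fE s : (f \_ `]a, b]) s = f s * \1_(`]a, b]%classic) s.
  by rewrite patchE indicE; case: ifP => _; rewrite ?mulr1 ?mulr0.
have i1 : mu.-integrable setT (EFin \o (f \_ `]a, b])).
  have := continuous_integrable_oc a b cf.
  by rewrite integrable_mkcond // restrict_EFin.
have i2 := integrable_step f a (mesh a b K) K.+1.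
rewrite -(RintegralB measurableT i2 i1).
apply: le_trans (le_normr_Rintegral measurableT _) _.
  exact: integrable_RB.
apply: (@le_trans _ _ (\int[mu]_s (eta / (b - a) * \1_(`]a, b]%classic) s))).
  apply: le_Rintegral => //.
  - by apply/integrable_norm/integrable_RB.
  - by apply: integrable_RZ; exact: integrable_indic_itv.
  move=> s _; rewrite fE.
  have := @step_close f a (mesh a b K) (eta / (b - a)) K.+1 s m0.
  by rewrite tick_mesh; apply => i x iK; exact: HK.
rewrite RintegralZl //; last exact: integrable_indic_itv.
rewrite /Rintegral integral_indic // setIT /= lebesgue_measure_itv /= lte_fin ab -EFinB /=.
by rewrite divfK // gt_eqF // subr_gt0.
Qed.

End riemann.

(** * Distance between stochastic integrals *)

Section square_norm.
Context d (T : measurableType d) (R : realType) (P : probability T R).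
Notation mu := (@lebesgue_measure R).
Implicit Types u v : R -> T -> R.

Definition square_mean v (s : R) : \bar R := (\int[P]_w ((v s w) ^+ 2)%:E)%E.

Let nonneg : set (R * T) := [set s : R | 0 <= s] `*` [set: T].

Let measurable_nonneg : measurable nonneg.
Proof. by apply: measurableX => //; rewrite -set_itvcy. Qed.

(** The squared process extended by 0 to negative times, where nothing is known of [v], so that
    Tonelli applies on the whole product. *)
Let masked v : measurableTypeR R * T -> \bar R := (fun x => ((v x.1 x.2) ^+ 2)%:E) \_ nonneg.

Let maskedE v s w : 0 <= s -> masked v (s, w) = ((v s w) ^+ 2)%:E.
Proof. by move=> s0; rewrite /masked patchE mem_set. Qed.

Let masked0 v s w : ~~ (0 <= s) -> masked v (s, w) = 0%E.
Proof. by move=> s0; rewrite /masked patchE memNset // => -[/=]; rewrite (negbTE s0). Qed.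

Let masked_ge0 v x : (0 <= masked v x)%E.
Proof. by apply: erestrict_ge0 => y _; rewrite lee_fin sqr_ge0. Qed.

Let measurable_masked v : measurable_process v -> measurable_fun setT (masked v).
Proof.
move=> mv; apply/(measurable_restrictT _ measurable_nonneg).
by apply/measurable_EFinP; exact: measurable_funX.
Qed.

Let fubini_masked v s : 0 <= s -> fubini_F P (masked v) s = square_mean v s.
Proof. by move=> s0; apply: eq_integral => w _; rewrite maskedE. Qed.

Lemma measurable_square_mean v : measurable_process v ->
  measurable_fun (`[0, +oo[%classic : set R) (square_mean v).
Proof.
move=> /measurable_masked mv.
apply: (eq_measurable_fun (fubini_F P (masked v))).
  by move=> s; rewrite inE /= in_itv /= andbT => /fubini_masked.
apply: measurable_funTS.
exact: (@measurable_fun_fubini_tonelli_F _ _ _ _ _ P (masked v) mv (masked_ge0 v)).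
Qed.

Lemma square_norm_swap v : measurable_process v ->
  square_norm P v = (\int[mu]_(s in `[0%R, +oo[) square_mean v s)%E.
Proof.
move=> /measurable_masked mv; rewrite /square_norm.
transitivity (\int[P]_w \int[mu]_s masked v (s, w))%E.
  apply: eq_integral => w _; rewrite integral_mkcond; apply: eq_integral => s _.
  rewrite patchE mem_setE in_itv /= andbT; case: ifPn => s0; first by rewrite maskedE.
  by rewrite masked0.
rewrite -(@fubini_tonelli _ _ _ _ _ mu P (masked v) mv (masked_ge0 v)).
rewrite [RHS]integral_mkcond; apply: eq_integral => s _.
rewrite patchE mem_setE in_itv /= andbT; case: ifPn => s0; first exact: fubini_masked.
by apply: integral0_eq => w _; rewrite masked0.
Qed.

Lemma measurable_process_at v s : 0 <= s -> measurable_process v -> measurable_fun setT (v s).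
Proof.
move=> s0 mv.
apply: (@measurable_comp _ _ _ _ _ _ nonneg (fun x => v x.1 x.2) setT (fun w => (s, w))) => //.
by move=> _ [w _ <-].
exact: measurable_pair1.
Qed.

Lemma measurable_processD u v : measurable_process u -> measurable_process v ->
  measurable_process (fun s w => u s w + v s w).
Proof. by move=> mu' mv; exact: measurable_funD. Qed.

Lemma measurable_processB u v : measurable_process u -> measurable_process v ->
  measurable_process (fun s w => u s w - v s w).
Proof. by move=> mu' mv; exact: measurable_funB. Qed.

Lemma measurable_processM u v : measurable_process u -> measurable_process v ->
  measurable_process (fun s w => u s w * v s w).
Proof. by move=> mu' mv; exact: measurable_funM. Qed.

Lemma measurable_process_time (f : R -> R) : measurable_fun setT f ->
  measurable_process (fun s (w : T) => f s).
Proof. by move=> mf; apply: measurable_funTS; exact: (measurableT_comp mf). Qed.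

Lemma measurable_process_space (c : T -> R) : measurable_fun setT c ->
  measurable_process (fun (s : R) w => c w).
Proof. by move=> mc; apply: measurable_funTS; exact: (measurableT_comp mc). Qed.

Lemma measurable_process_sum (I : Type) (r : seq I) (F : I -> R -> T -> R) :
  (forall i, measurable_process (F i)) ->
  measurable_process (fun s w => \sum_(i <- r) F i s w).
Proof.
move=> mF; elim: r => [|i r IH].
  rewrite (_ : (fun _ => _) = fun (s : R) (w : T) => 0 : R).
    by apply: measurable_process_time; exact: measurable_cst.
  by apply/funext => s; apply/funext => w; rewrite big_nil.
rewrite (_ : (fun _ => _) = fun (s : R) (w : T) => F i s w + \sum_(i <- r) F i s w).
  exact: measurable_processD.
by apply/funext => s; apply/funext => w; rewrite big_cons.
Qed.

Lemma square_normD u v : measurable_process u -> measurable_process v ->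
  (square_norm P (fun s w => (u s w + v s w)%R) <=
   2%:E * square_norm P u + 2%:E * square_norm P v)%E.
Proof.
move=> mpu mpv; rewrite !square_norm_swap //; last exact: measurable_processD.
have ge0 x s : (0 <= square_mean x s)%E.
  by apply: integral_ge0 => w _; rewrite lee_fin sqr_ge0.
have mm := measurable_square_mean.
rewrite -!ge0_integralZl //; try exact: mm.
rewrite -ge0_integralD //; try (by apply: measurable_funeM; exact: mm);
  try (by move=> s _; exact: mule_ge0).
apply: ge0_le_integral => //.
- by apply: mm; exact: measurable_processD.
- by apply: emeasurable_funD; apply: measurable_funeM; exact: mm.
- move=> s; rewrite /= in_itv /= andbT => s0.
  by apply: integral_sqr_add; exact: measurable_process_at.
Qed.

End square_norm.

Lemma cvge_near_lt (R : realType) (I : Type) (F : set_system I) (FF : Filter F)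
  (f : I -> \bar R) (l x : \bar R) : f @ F --> l -> (l < x)%E -> \forall i \near F, (f i < x)%E.
Proof.
move=> fl lx; apply: (fl [set y | (y < x)%E]).
by apply: open_nbhs_nbhs; split => //; exact: open_ereal_lt_ereal.
Qed.

Lemma cvge_near_gt (R : realType) (I : Type) (F : set_system I) (FF : Filter F)
  (f : I -> \bar R) (l x : \bar R) : f @ F --> l -> (x < l)%E -> \forall i \near F, (x < f i)%E.
Proof.
move=> fl lx; apply: (fl [set y | (x < y)%E]).
by apply: open_nbhs_nbhs; split => //; exact: open_ereal_gt_ereal.
Qed.

Section ito_distance.
Context d (T : measurableType d) (R : realType) (P : probability T R) (B : R -> T -> R).
Hypothesis bm : brownian_motion P B.
Variables (a h : R).
Hypotheses (a0 : 0 <= a) (h0 : 0 < h).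

Definition scaled_step (c : T -> R) (g : nat -> R) k (s : R) (w : T) : R :=
  c w * \sum_(i < k) g i * \1_(`]tick a h i, tick a h i.+1]%classic) s.

Lemma measurable_scaled_step c g k : measurable_fun setT c ->
  measurable_process (scaled_step c g k).
Proof.
move=> mc; apply: measurable_processM; first exact: measurable_process_space.
apply: measurable_process_time.
apply: measurable_sum => i; apply: measurable_funM => //.
Qed.

Lemma measurable_simple_value (H : simple_process B) : measurable_process (simple_value H).
Proof.
apply: measurable_process_sum => i; apply: measurable_processM.
  apply: measurable_process_space.
  exact: (measurable_wrt_measurable bm (@sp_coef_adapted _ _ _ _ H i)).
by apply: measurable_process_time; exact: measurable_indic.
Qed.

Lemma measurable_simple_integral (H : simple_process B) : measurable_fun setT (simple_integral H).
Proof.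
apply: measurable_sum => i; apply: measurable_funM.
  exact: (measurable_wrt_measurable bm (@sp_coef_adapted _ _ _ _ H i)).
have t0 j : 0 <= sp_time H j.
  by elim: j => [|j IH]; [exact: sp_time_ge0|exact: le_trans (sp_time_le H j)].
exact: (measurable_increment bm).
Qed.

Lemma ito_isometry_diff (H : simple_process B) (c : T -> R) (g : nat -> R) k :
  measurable_wrt (natural_filtration B a) c -> (exists M : R, forall w, `|c w| <= M) ->
  (\int[P]_w ((simple_integral H w - c w * brownian_sum B a h g k w) ^+ 2)%:E =
   square_norm P (fun s w => (simple_value H s w - scaled_step c g k s w)%R))%E.
Proof.
move=> mc [M cM].
have t0 j : 0 <= sp_time H j.
  by elim: j => [|j IH]; [exact: sp_time_ge0|exact: le_trans (sp_time_le H j)].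
pose n := sp_size H.
(* The cells of both processes are listed side by side; those of the step function get the opposite
   coefficient. *)
pose lo (i : 'I_n + 'I_k) := match i with inl i => sp_time H i | inr i => tick a h i end.
pose hi (i : 'I_n + 'I_k) := match i with inl i => sp_time H i.+1 | inr i => tick a h i.+1 end.
pose co (i : 'I_n + 'I_k) := match i with inl i => sp_coef H i | inr i => fun w => c w * - g i end.
have := @ito_isometry _ _ _ P B bm ('I_n + 'I_k)%type lo hi co.
move=> /(_ _ _ _ _) iso.
transitivity (\int[P]_w ((\sum_i co i w * (B (hi i) w - B (lo i) w)) ^+ 2)%:E)%E.
  apply: eq_integral => w _; congr (_ ^+ 2)%:E.
  rewrite big_sumType /=; congr (_ + _).
  rewrite /brownian_sum mulr_sumr -sumrN; apply: eq_bigr => i _; ring.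
rewrite {}iso.
- congr (square_norm P _); apply/funext => s; apply/funext => w.
  rewrite big_sumType /=; congr (_ + _).
  rewrite /scaled_step mulr_sumr -sumrN; apply: eq_bigr => i _; ring.
- by case=> i; [exact: t0|exact: tick_ge0].
- by case=> i; [exact: sp_time_le|exact: ltW (tick_lt _ _ _)].
- case=> i; first exact: (@sp_coef_adapted _ _ _ _ H i).
  apply: measurable_wrtM; last exact: measurable_wrt_cst.
  exact: (measurable_wrt_mono (tick_ge a h0 i) mc).
- case=> i; first exact: sp_coef_bounded.
  by exists (M * `|- g i|) => w; rewrite normrM ler_wpM2r.
Qed.

(** [X] is only known through its approximating simple integrals, so the isometry is applied to
    these. The inequality (x + y)^2 <= 2 x^2 + 2 y^2 is used twice, once on integrals and once on
    integrands, hence the factor 4. *)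
Lemma ito_distance (v : R -> T -> R) (X : T -> R) (c : T -> R) (g : nat -> R) k :
  measurable_process v -> is_ito_integral P B v X ->
  measurable_wrt (natural_filtration B a) c -> (exists M : R, forall w, `|c w| <= M) ->
  (\int[P]_w ((X w - c w * brownian_sum B a h g k w) ^+ 2)%:E <=
   4%:E * square_norm P (fun s w => (v s w - scaled_step c g k s w)%R))%E.
Proof.
move=> mv [mX [H [cv cX]]] mc bc.
have mcT := measurable_wrt_measurable bm mc.
have mW : measurable_fun setT (brownian_sum B a h g k) by exact: (measurable_brownian_sum bm a0 h0).
have mK := measurable_scaled_step g k mcT.
set Q := square_norm P _.
apply/lee_addgt0Pr => e e0.
(* The approximation errors of [X] and [v] enter with weights 2 and 4, and 6 e / 8 <= e. *)
have e8 : 0 < e / 8 by rewrite divr_gt0.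
have ev : \forall n \near \oo,
    (square_norm P (fun s w => (v s w - simple_value (H n) s w)%R) < (e / 8)%:E)%E.
  by apply: (cvge_near_lt _ cv); rewrite lte_fin.
have eX : \forall n \near \oo,
    (\int[P]_w ((X w - simple_integral (H n) w) ^+ 2)%:E < (e / 8)%:E)%E.
  by apply: (cvge_near_lt _ cX); rewrite lte_fin.
near \oo => n.
have hv : (square_norm P (fun s w => (v s w - simple_value (H n) s w)%R) < (e / 8)%:E)%E.
  by near: n.
have hX : (\int[P]_w ((X w - simple_integral (H n) w) ^+ 2)%:E < (e / 8)%:E)%E by near: n.
have mH := measurable_simple_value (H n); have mI := measurable_simple_integral (H n).
apply: (@le_trans _ _ (2%:E * (e / 8)%:E + 2%:E * (2%:E * (e / 8)%:E + 2%:E * Q))%E).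
  rewrite (eq_integral (fun w => (((X w - simple_integral (H n) w)
     + (simple_integral (H n) w - c w * brownian_sum B a h g k w)) ^+ 2)%:E)); last first.
    by move=> w _; rewrite addrA subrK.
  have m1 : measurable_fun setT (fun w => X w - simple_integral (H n) w).
    exact: measurable_funB.
  have m2 : measurable_fun setT
      (fun w => simple_integral (H n) w - c w * brownian_sum B a h g k w).
    by apply: measurable_funB => //; exact: measurable_funM.
  apply: le_trans (integral_sqr_add P m1 m2) _.
  apply: leeD; first by rewrite lee_wpmul2l ?lee_fin // ltW.
  rewrite lee_wpmul2l ?lee_fin // ito_isometry_diff //.
  have opp : square_norm P (fun s w => (simple_value (H n) s w - v s w)%R) =
             square_norm P (fun s w => (v s w - simple_value (H n) s w)%R).
    by apply: eq_integral => w _; apply: eq_integral => s _; rewrite -sqrrN opprB.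
  have := @square_normD _ _ _ P (fun s w => simple_value (H n) s w - v s w)
    (fun s w => v s w - scaled_step c g k s w) (measurable_processB mH mv) (measurable_processB mv mK).
  rewrite (_ : (fun s w => _ + _) = fun s w => simple_value (H n) s w - scaled_step c g k s w); last first.
    by apply/funext => s; apply/funext => w; rewrite addrA subrK.
  move=> /le_trans; apply; rewrite opp -/Q.
  by apply: leeD => //; rewrite lee_wpmul2l ?lee_fin // ltW.
have Q0 : (0 <= Q)%E.
  by apply: integral_ge0 => w _; apply: integral_ge0 => s _; rewrite lee_fin sqr_ge0.
rewrite muleDr ?ge0_adde_def ?inE ?mule_ge0 ?lee_fin ?(ltW e8) // !muleA -!EFinM -natrM.
rewrite addeA -EFinD addeC leeD2l // lee_fin; lra.
Unshelve. all: by end_near. Qed.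

End ito_distance.

Section truncation.
Context d (T : measurableType d) (R : realType) (P : probability T R).
Notation mu := (@lebesgue_measure R).

(** Large values become 0 instead of being clipped: the error is then either 0 or the value itself,
    and its square is dominated by x^2. *)
Definition truncate (M : nat) (x : R) : R := x * \1_(`[- M%:R, M%:R]%classic : set R) x.

Lemma measurable_truncate M : measurable_fun setT (truncate M).
Proof. by apply: measurable_funM => //; exact: measurable_indic. Qed.

Lemma truncate_le M x : `|truncate M x| <= M%:R.
Proof.
rewrite /truncate indicE; have [|_] := boolP (x \in _); last by rewrite mulr0 normr0.
by rewrite inE /= in_itv /= -ler_norml mulr1.
Qed.

Lemma truncate_sqr_le M x : (x - truncate M x) ^+ 2 <= x ^+ 2.
Proof.
rewrite /truncate indicE; case: (_ \in _); rewrite ?mulr1 ?mulr0 ?subr0 //.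
by rewrite subrr expr0n sqr_ge0.
Qed.

Lemma truncate_cvg (f : T -> R) (e : R) : measurable_fun setT f ->
  (\int[P]_w (f w ^+ 2)%:E < +oo)%E -> 0 < e ->
  exists M : nat, (\int[P]_w ((f w - truncate M (f w)) ^+ 2)%:E < e%:E)%E.
Proof.
move=> mf foo e0.
have mf2 : measurable_fun setT (fun w => (f w ^+ 2)%:E).
  by apply/measurable_EFinP; exact: measurable_funX.
have [||||| _ _ cv] := @dominated_convergence _ _ _ P setT measurableT
  (fun M w => ((f w - truncate M (f w)) ^+ 2)%:E) (cst 0%E) (fun w => (f w ^+ 2)%:E).
- move=> M; apply/measurable_EFinP; apply: measurable_funX; apply: measurable_funB => //.
  exact: (measurableT_comp (measurable_truncate M)).
- exact: measurable_cst.
- apply: aeW => w _; apply: cvg_near_cst; near=> M.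
  rewrite /truncate indicE mem_set ?mulr1 ?subrr ?expr0n //=.
  rewrite in_itv /= -ler_norml; near: M; exact: nbhs_infty_ger.
- apply/integrableP; split => //.
  by under eq_integral do rewrite gee0_abs ?lee_fin ?sqr_ge0 //.
- apply: aeW => w M _; rewrite gee0_abs ?lee_fin ?sqr_ge0 //; exact: truncate_sqr_le.
have e0' : (0 < e%:E :> \bar R)%E by rewrite lte_fin.
rewrite integral0 in cv.
have [M _ HM] := cvge_near_lt _ cv e0'.
by exists M; apply: HM => /=.
Unshelve. all: by end_near. Qed.

End truncation.

Section square_norm_estimate.
Context d (T : measurableType d) (R : realType) (P : probability T R).
Notation mu := (@lebesgue_measure R).

(** On the interval, u f - c st = (u - ut) f + (ut - c) f + c (f - st), where st is the step
    function of f: the errors come from the continuity of u, the approximation of ut and the mesh.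
    Outside, st vanishes and f^2 <= kap leaves a small multiple of the norm of u. *)
Lemma square_norm_step_le (u : R -> T -> R) (c ut : T -> R) (f : R -> R) (a b : R) (K : nat)
    (M e1 e2 eta kap : R) :
  measurable_process u -> measurable_fun setT c -> measurable_fun setT ut -> continuous f ->
  0 <= a -> a < b -> 0 <= M -> 0 <= e1 -> 0 <= e2 -> 0 <= kap -> (forall w, `|c w| <= M) ->
  (forall s, a < s -> s <= b -> (\int[P]_w ((u s w - ut w) ^+ 2)%:E <= e1%:E)%E) ->
  (\int[P]_w ((ut w - c w) ^+ 2)%:E <= e2%:E)%E ->
  (forall i x, (i < K.+1)%N -> tick a (mesh a b K) i <= x <= tick a (mesh a b K) i.+1 ->
    `|f (tick a (mesh a b K) i) - f x| <= eta) ->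
  (forall s, 0 < s -> (s <= a) || (b < s) -> f s ^+ 2 <= kap) ->
  (\int[mu]_(s in `]a, b]) (f s ^+ 2)%:E <= 1)%E ->
  (square_norm P (fun s w => (u s w * f s
      - scaled_step a (mesh a b K) c (fun i => f (tick a (mesh a b K) i)) K.+1 s w)%R) <=
   kap%:E * square_norm P u + (4 * (e1 + e2) + 4 * M ^+ 2 * eta ^+ 2 * (b - a))%:E)%E.
Proof.
move=> mpu mc mut cf a0 ab M0 e10 e20 kap0 cM H1 H2 Heta Hkap If.
have h0 := mesh_gt0 K ab.
set v := (X in square_norm P X).
have mf : measurable_fun setT f by exact: continuous_measurable_fun.
have mv : measurable_process v.
  apply: measurable_processB; last exact: measurable_scaled_step.
  by apply: measurable_processM => //; exact: measurable_process_time.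
(* Two uses of (x + y)^2 <= 2 x^2 + 2 y^2 give 2 e1 f^2 + 4 e2 f^2 + 4 M^2 eta^2; the coefficient 2
   is rounded up to 4. *)
pose C1 := 4 * (e1 + e2); pose C2 := 4 * M ^+ 2 * eta ^+ 2.
have C10 : 0 <= C1 by rewrite mulr_ge0 // addr_ge0.
have C20 : 0 <= C2 by apply: mulr_ge0 (sqr_ge0 _); exact: mulr_ge0 (sqr_ge0 _).
have sm0 x s : (0 <= square_mean P x s)%E.
  by apply: integral_ge0 => w _; rewrite lee_fin sqr_ge0.
have cut s : ((fun s => (C1 * f s ^+ 2 + C2)%:E) \_ `]a, b]) s =
  ((C1 * f s ^+ 2 + C2) * \1_(`]a, b]%classic) s)%:E.
  by rewrite patchE indicE; case: ifP => _; rewrite ?mulr1 ?mulr0.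
have key s : 0 < s -> (square_mean P v s <=
    kap%:E * square_mean P u s + ((fun s => (C1 * f s ^+ 2 + C2)%:E) \_ `]a, b]) s)%E.
  move=> s0; have us := measurable_process_at (ltW s0) mpu.
  rewrite patchE; case: ifPn => [|].
    rewrite inE /= in_itv /= => /andP[as' sb].
    pose st := step f a (mesh a b K) K.+1 s.
    have close : (f s - st) ^+ 2 <= eta ^+ 2.
      have := @step_close _ f a (mesh a b K) eta K.+1 s h0 Heta.
      rewrite tick_mesh indicE mem_set ?mulr1 /= ?in_itv /= ?as' ?sb // -/st distrC => h.
      rewrite -(real_normK (num_real (f s - st))) lerXn2r ?nnegrE //.
      exact: le_trans h.
    have m1 : measurable_fun setT (fun w => (u s w - ut w) * f s).
      by apply: measurable_funM => //; exact: measurable_funB.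
    have m2 : measurable_fun setT (fun w => (ut w - c w) * f s).
      by apply: measurable_funM => //; exact: measurable_funB.
    have m3 : measurable_fun setT (fun w => c w * (f s - st)) by exact: measurable_funM.
    have m23 : measurable_fun setT (fun w => (ut w - c w) * f s + c w * (f s - st)).
      exact: measurable_funD.
    have f20 : 0 <= f s ^+ 2 by exact: sqr_ge0.
    have scale (g : T -> R) (e : R) : measurable_fun setT g -> 
        (\int[P]_w ((g w) ^+ 2)%:E <= e%:E)%E ->
        (\int[P]_w ((g w * f s) ^+ 2)%:E <= (f s ^+ 2 * e)%:E)%E.
      move=> mg ge; under eq_integral do rewrite exprMn mulrC EFinM.
      rewrite ge0_integralZl //; first by rewrite [leRHS]EFinM lee_wpmul2l ?lee_fin.
      - by apply/measurable_EFinP; exact: measurable_funX.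
      - by move=> w _; rewrite lee_fin sqr_ge0.
    have i1 := scale (fun w => u s w - ut w) e1 (measurable_funB us mut) (H1 s as' sb).
    have i2 := scale (fun w => ut w - c w) e2 (measurable_funB mut mc) H2.
    have i3 : (\int[P]_w ((c w * (f s - st)) ^+ 2)%:E <= (M ^+ 2 * eta ^+ 2)%:E)%E.
      apply: (@le_trans _ _ (\int[P]_w (cst (M ^+ 2 * eta ^+ 2)%:E w))%E).
        apply: ge0_le_integral => //.
        - by move=> w _; rewrite lee_fin sqr_ge0.
        - by apply/measurable_EFinP; exact: measurable_funX.
        - move=> w _; rewrite lee_fin exprMn ler_pM ?sqr_ge0 //.
          by rewrite -(real_normK (num_real (c w))) lerXn2r ?nnegrE.
      by rewrite integral_cst // [X in (_ * X)%E](_ : _ = 1%E) ?mule1 //; exact: probability_setT.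
    apply: (@le_trans _ _ ((2 * (f s ^+ 2 * e1) +
        2 * (2 * (f s ^+ 2 * e2) + 2 * (M ^+ 2 * eta ^+ 2))))%:E).
      rewrite /square_mean (eq_integral (fun w => (((u s w - ut w) * f s +
          ((ut w - c w) * f s + c w * (f s - st))) ^+ 2)%:E)); last first.
        by move=> w _; congr (_ ^+ 2)%:E; rewrite /v /scaled_step -/(step f a (mesh a b K) K.+1 s) -/st; ring.
      apply: le_trans (integral_sqr_add P m1 m23) _.
      rewrite [leRHS]EFinD; apply: leeD; first by rewrite [leRHS]EFinM lee_wpmul2l ?lee_fin.
      rewrite [leRHS]EFinM lee_wpmul2l ?lee_fin //.
      apply: le_trans (integral_sqr_add P m2 m3) _.
      by rewrite [leRHS]EFinD; apply: leeD; rewrite [leRHS]EFinM lee_wpmul2l ?lee_fin.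
    apply: (@le_trans _ _ (C1 * f s ^+ 2 + C2)%:E); last by rewrite leeDr // mule_ge0 ?lee_fin.
    rewrite lee_fin /C1 /C2.
    have x1 : 0 <= f s ^+ 2 * e1 by exact: mulr_ge0.
    by clear -x1; lra.
  rewrite notin_setE /= in_itv /= => /negP; rewrite negb_and -leNgt -ltNge => out.
  rewrite adde0; apply: (@le_trans _ _ ((f s ^+ 2)%:E * square_mean P u s)%E); last first.
    by rewrite lee_wpmul2r // lee_fin; exact: Hkap.
  rewrite -ge0_integralZl ?lee_fin ?sqr_ge0 //; last 2 first.
  - by apply/measurable_EFinP; exact: measurable_funX.
  - by move=> w _; rewrite lee_fin sqr_ge0.
  rewrite le_eqVlt; apply/orP; left; apply/eqP; apply: eq_integral => w _.
  have st0 : step f a (mesh a b K) K.+1 s = 0.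
    have := @step_close _ f a (mesh a b K) eta K.+1 s h0 Heta.
    rewrite tick_mesh indicE memNset ?mulr0 ?subr0 ?normr_le0 => [/eqP //|].
    by rewrite /= in_itv /=; apply/negP; rewrite negb_and -leNgt -ltNge.
  by rewrite /v /scaled_step -/(step f a (mesh a b K) K.+1 s) st0 mulr0 subr0 exprMn mulrC.
(* Time 0 is discarded: when a = t = 0 in the application, it is where the kernel is evaluated at 0,
   and the bound by [kap] is only assumed at positive times. *)
rewrite !square_norm_swap // -!integral_itv_obnd_cbnd; last 2 first.
- by apply: measurable_funS (measurable_square_mean P mpu) => //; apply: subset_itv; rewrite bnd_simp.
- by apply: measurable_funS (measurable_square_mean P mv) => //; apply: subset_itv; rewrite bnd_simp.
have mC : measurable_fun setT (fun s => (C1 * f s ^+ 2 + C2)%:E).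
  apply/measurable_EFinP; apply: measurable_funD => //.
  by apply: measurable_funM => //; exact: measurable_funX.
have mpatch : measurable_fun setT ((fun s => (C1 * f s ^+ 2 + C2)%:E) \_ `]a, b]).
  by apply/(measurable_restrictT _ (measurable_itv _)); exact: measurable_funTS.
have C0 s : 0 <= C1 * f s ^+ 2 + C2.
  by apply: addr_ge0 => //; apply: mulr_ge0 => //; exact: sqr_ge0.
have patch0 s : (0 <= ((fun s => (C1 * f s ^+ 2 + C2)%:E) \_ `]a, b]) s)%E.
  by apply: erestrict_ge0 => y _; rewrite lee_fin.
have msu : measurable_fun (`]0, +oo[%classic : set R) (square_mean P u).
  by apply: measurable_funS (measurable_square_mean P mpu) => //; apply: subset_itv; rewrite bnd_simp.
have msv : measurable_fun (`]0, +oo[%classic : set R) (square_mean P v).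
  by apply: measurable_funS (measurable_square_mean P mv) => //; apply: subset_itv; rewrite bnd_simp.
apply: (@le_trans _ _ (\int[mu]_(s in `]0%R, +oo[) (kap%:E * square_mean P u s
    + ((fun s => (C1 * f s ^+ 2 + C2)%:E) \_ `]a, b]) s))%E).
  apply: ge0_le_integral => //.
  - by apply: emeasurable_funD; [exact: measurable_funeM|exact: measurable_funTS].
  - by move=> s; rewrite /= in_itv /= andbT; exact: key.
rewrite ge0_integralD //; last 3 first.
- by move=> s _; rewrite mule_ge0 ?lee_fin.
- exact: measurable_funeM.
- exact: measurable_funTS.
rewrite ge0_integralZl // ?lee_fin //; apply: leeD => //.
apply: (@le_trans _ _ (\int[mu]_s ((fun s => (C1 * f s ^+ 2 + C2)%:E) \_ `]a, b]) s)%E).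
  by apply: ge0_subset_integral.
rewrite -integral_mkcond.
have mf2 : measurable_fun (`]a, b]%classic : set R) (fun s : R => (f s ^+ 2)%:E).
  by apply/measurable_EFinP; apply: measurable_funTS; exact: measurable_funX.
have -> : (\int[mu]_(s in `]a, b]) (C1 * f s ^+ 2 + C2)%:E =
    C1%:E * \int[mu]_(s in `]a, b]) (f s ^+ 2)%:E + C2%:E * (b - a)%:E)%E.
  under eq_integral do rewrite EFinD EFinM.
  rewrite ge0_integralD //; last 2 first.
  - by move=> s _; rewrite mule_ge0 ?lee_fin ?sqr_ge0.
  - exact: measurable_funeM.
  rewrite ge0_integralZl //; last by move=> s _; rewrite lee_fin sqr_ge0.
  congr (_ + _)%E; rewrite integral_cst //; congr (_ * _)%E.
  by rewrite /= lebesgue_measure_itv /= lte_fin ab.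
rewrite [leRHS]EFinD; apply: leeD => //.
by rewrite -[leRHS]mule1 lee_wpmul2l ?lee_fin.
Qed.

End square_norm_estimate.

(** * Approximation of the convolution *)

Lemma ler_norm1_sqrt (R : rcfType) (x : R) : 0 <= x -> `|1 - Num.sqrt x| <= `|1 - x|.
Proof.
move=> x0; have s0 := sqrtr_ge0 x.
rewrite -{2}(sqr_sqrtr x0) -{2}(expr1n R 2) subr_sqr normrM ler_peMr //.
by rewrite ger0_norm ?addr_ge0 // lerDl.
Qed.

Lemma ler_budget1 (R : realFieldType) (x y e : R) : x <= e -> y <= e ->
  x + (4 * (e + 4 * e) + y) <= 22 * e.
Proof. lra. Qed.

Lemma ler_budget2 (R : realFieldType) (x e : R) : 0 < e -> x <= e / 88 ->
  2 * (4 * (e / 88)) + x <= e.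
Proof. lra. Qed.

Section approximation.
Context d (T : measurableType d) (R : realType) (P : probability T R) (B u : R -> T -> R).
Notation mu := (@lebesgue_measure R).
Hypotheses (bm : brownian_motion P B) (u_measurable : measurable_process u)
  (u_adapted : adapted B u) (u_square_integrable : (square_norm P u < +oo)%E).
Variable t : R.
Hypotheses (t_ge0 : 0 <= t) (u_continuous : L2_continuous_at P u t).

Let mut s : 0 <= s -> measurable_fun setT (u s).
Proof. by move=> s0; exact: (measurable_wrt_measurable bm (u_adapted s0)). Qed.

Lemma L2_continuous_ball (e : R) : 0 < e -> exists2 r, 0 < r &
  forall s, 0 <= s -> `|s - t| < r -> (\int[P]_w ((u s w - u t w) ^+ 2)%:E < e%:E)%E.
Proof.
move=> e0; have e0' : (0 < e%:E :> \bar R)%E by rewrite lte_fin.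
have W := @cvge_near_lt _ _ _ (within_filter _ _) _ _ _ u_continuous e0'; rewrite near_withinE in W.
have [r /= r0 H] := (@nbhs_ballP R R t _).1 (W _).
by exists r => // s s0 st; apply: H => //; rewrite /ball /= distrC.
Qed.

Lemma square_mean_finite_near s : 0 <= s -> (\int[P]_w ((u s w - u t w) ^+ 2)%:E < +oo)%E ->
  (square_mean P u t < +oo)%E -> (square_mean P u s < +oo)%E.
Proof.
move=> s0 sm tm.
have m1 : measurable_fun setT (fun w => u s w - u t w) by apply: measurable_funB; exact: mut.
rewrite /square_mean (eq_integral (fun w => (((u s w - u t w) + u t w) ^+ 2)%:E)); last first.
  by move=> w _; rewrite subrK.
apply: le_lt_trans (integral_sqr_add P m1 (mut t_ge0)) _.
by apply: lte_add_pinfty; rewrite lte_mul_pinfty ?lee_fin.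
Qed.

(** Square integrability says nothing about one fixed time. But if E u_t^2 were infinite, L^2
    continuity would make E u_s^2 infinite on an interval to the right of t, against the finiteness
    of the norm. *)
Lemma square_mean_finite : (square_mean P u t < +oo)%E.
Proof.
have [r r0 Hr] := L2_continuous_ball ltr01.
have sm0 s : (0 <= square_mean P u s)%E.
  by apply: integral_ge0 => w _; rewrite lee_fin sqr_ge0.
rewrite ltNge leye_eq; apply/negP => /eqP tinf.
have sinf s : t < s -> s < t + r -> square_mean P u s = +oo%E.
  move=> ts sr; have s0 : 0 <= s by exact: le_trans (ltW ts).
  apply/eqP; rewrite -leye_eq leNgt; apply/negP => sfin.
  have : (square_mean P u t < +oo)%E; last by rewrite tinf.
  have m1 : measurable_fun setT (fun w => u t w - u s w) by apply: measurable_funB; exact: mut.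
  rewrite /square_mean (eq_integral (fun w => (((u t w - u s w) + u s w) ^+ 2)%:E)); last first.
    by move=> w _; rewrite subrK.
  apply: le_lt_trans (integral_sqr_add P m1 (mut s0)) _.
  apply: lte_add_pinfty; rewrite lte_mul_pinfty ?lee_fin //.
  rewrite (eq_integral (fun w => ((u s w - u t w) ^+ 2)%:E)); last first.
    by move=> w _; rewrite -sqrrN opprB.
  apply: lt_trans (ltry 1); apply: Hr => //.
  by rewrite gtr0_norm ?subr_gt0 // ltrBlDl.
move: u_square_integrable; rewrite square_norm_swap // ltNge => /negP; apply.
have infE : (\int[mu]_(s in `]t, (t + r)%R[) square_mean P u s = +oo)%E.
  rewrite (eq_integral (cst +oo%E)); last first.
    by move=> s; rewrite inE /= in_itv /= => /andP[ts sr]; exact: sinf.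
  rewrite integral_cst //= lebesgue_measure_itv /= lte_fin ltrDl r0 -EFinB addrC addKr.
  by rewrite gt0_mulye ?lte_fin.
rewrite -infE; apply: ge0_subset_integral => //.
- exact: measurable_square_mean.
- move=> s /=; rewrite !in_itv /= => /andP[ts _].
  by rewrite (le_trans t_ge0) // ltW.
Qed.

Variable psi : R -> R.
Hypothesis psi_ge0 : forall x, 0 <= psi x.
Hypothesis psi_continuous : continuous psi.
Hypothesis psi_norm : (\int[mu]_x ((psi x) ^+ 2)%:E = 1)%E.
Hypothesis psi_littleo : littleo_infinity (fun x => (psi x) ^+ 2) (fun x => `|x|^-1).
Hypothesis psi_boundary : t = 0 ->
  (\int[mu]_(x in `]-oo, 0%R]) ((psi x) ^+ 2)%:E = 1)%E.
Variable X : nat -> T -> R.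
Hypothesis X_conv : forall n, is_stochastic_convolution P B u (dilation psi n) t (X n).

Definition kernel_tick a b n K i := dilation psi n (t - tick a (mesh a b K) i).

(* [c] is a truncation of [u a], and [`]a, b]] a small interval around [t]. *)
Lemma stochastic_convolution_approx (eps : R) : 0 < eps ->
  exists (a b : R) (c : T -> R) (M : R),
  [/\ 0 <= a, a < b, measurable_wrt (natural_filtration B a) c, (forall w, `|c w| <= M) &
   exists N : nat, forall n, (N <= n)%N -> exists K0 : nat, forall K, (K0 <= K)%N ->
    (\int[P]_w ((X n.+1 w - c w *
       brownian_sum B a (mesh a b K) (kernel_tick a b n.+1 K) K.+1 w) ^+ 2)%:E <= eps%:E)%E /\
    (\int[P]_w ((u t w - c w * Num.sqrt (sum_prod (mesh a b K)
       (kernel_tick a b n.+1 K) (kernel_tick a b n.+1 K) K.+1)) ^+ 2)%:E <= eps%:E)%E].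
Proof.
(* 88 = 4 * 22: [ito_distance] costs the factor 4, and the norm of the difference is at most e + 4
   (e + 4 e) + e, for the far zone, the freezing of u and the mesh. *)
move=> eps0; pose e := eps / 88.
have e0 : 0 < e by rewrite divr_gt0.
have [r r0 Hr] := L2_continuous_ball e0.
pose del := r / 2; have del0 : 0 < del by rewrite divr_gt0.
have delr : del < r by rewrite ltr_pdivrMr // ltr_pMr // ltr1n.
pose a := Num.max 0 (t - del); pose b := t + del.
have a0 : 0 <= a by rewrite le_max lexx.
have at_ : a <= t by rewrite ge_max t_ge0 gerBl ltW.
have tb : t < b by rewrite ltrDl.
have ab : a < b by exact: le_lt_trans tb.
have ta : t - del <= a by rewrite le_max lexx orbT.
have near_t s : a <= s -> s <= b -> `|s - t| < r.
  move=> as' sb; apply: le_lt_trans delr.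
  by rewrite ler_distl sb andbT (le_trans ta).
have uafin : (square_mean P u a < +oo)%E.
  apply: square_mean_finite_near => //; last exact: square_mean_finite.
  by apply: lt_trans (ltry e); apply: Hr => //; apply: near_t => //; exact: ltW.
have [M HM] := truncate_cvg (mut a0) uafin e0.
pose c w := truncate M (u a w).
have mc : measurable_wrt (natural_filtration B a) c.
  exact: measurable_wrt_comp (measurable_truncate M) (u_adapted a0).
have cM w : `|c w| <= M%:R by exact: truncate_le.
have mcT := measurable_wrt_measurable bm mc.
have e2 : (\int[P]_w ((u t w - c w) ^+ 2)%:E <= (4 * e)%:E)%E.
  have m1 : measurable_fun setT (fun w => u t w - u a w) by apply: measurable_funB; exact: mut.
  have m2 : measurable_fun setT (fun w => u a w - c w) by apply: measurable_funB => //; exact: mut.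
  rewrite (eq_integral (fun w => (((u t w - u a w) + (u a w - c w)) ^+ 2)%:E)); last first.
    by move=> w _; rewrite addrA subrK.
  apply: le_trans (integral_sqr_add P m1 m2) _.
  rewrite [leRHS](_ : _ = 2%:E * e%:E + 2%:E * e%:E)%E; last first.
    by rewrite -!EFinM -EFinD; congr EFin; ring.
  apply: leeD; rewrite lee_wpmul2l ?lee_fin //; last exact: ltW.
  rewrite (eq_integral (fun w => ((u a w - u t w) ^+ 2)%:E)); last first.
    by move=> w _; rewrite -sqrrN opprB.
  by apply/ltW/Hr => //; apply: near_t => //; exact: ltW.
exists a, b, c, M%:R; split => //.
have Q0 : (0 <= square_norm P u)%E.
  by apply: integral_ge0 => w _; apply: integral_ge0 => s _; rewrite lee_fin sqr_ge0.
pose Q := fine (square_norm P u).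
have QE : square_norm P u = Q%:E by rewrite fineK // ge0_fin_numE.
have Q0r : 0 <= Q by exact: fine_ge0.
(* [kap] and [eta2] are calibrated by kap Q <= e and 2 M^2 eta2^2 <= e, the latter for the error c
   (1 - sqrt S); the added 1 avoids null denominators. *)
pose kap := e / (Q + 1).
have kap0 : 0 < kap by rewrite divr_gt0 // ltr_wpDl.
pose eta2 := Num.sqrt (e / (2 * M%:R ^+ 2 + 1)).
have eta20 : 0 < eta2 by rewrite sqrtr_gt0 divr_gt0 // ltr_wpDl // mulr_ge0 ?sqr_ge0.
have [N1 HN1] := dilation_far psi_littleo del0 kap0.
have [N2 _ HN2] : \forall n \near \oo, ((1 - eta2 / 2)%:E <
    \int[mu]_(s in `]a, b]) (dilation psi n.+1 (t - s) ^+ 2)%:E)%E.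
  apply: cvge_near_gt (cvg_integral_dilation_sqr psi_continuous psi_norm t_ge0 del0 psi_boundary) _.
  by rewrite lte_fin ltrBlDr ltrDl divr_gt0.
exists (maxn N1 N2) => n; rewrite geq_max => /andP[n1 n2].
pose f s := dilation psi n.+1 (t - s).
have cf : continuous f by exact: continuous_dilationB.
(* Makes the mesh error 4 M^2 eta^2 (b - a) at most e. The mesh that achieves [eta] depends on n,
   whose kernel it has to resolve. *)
pose eta := Num.sqrt (e / (4 * M%:R ^+ 2 * (b - a) + 1)).
have eta0 : 0 < eta.
  by rewrite sqrtr_gt0 divr_gt0 // ltr_wpDl // mulr_ge0 ?subr_ge0 ?(ltW ab) //.
have [K1 HK1] := fine_mesh ab cf eta0.
have cf2 : continuous (fun s => f s ^+ 2).
  by move=> s; apply: (cvg_comp f (fun x => x ^+ 2)); [exact: cf|exact: exprn_continuous].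
have [K2 HK2] : exists K2 : nat, forall K, (K2 <= K)%N ->
    `|\sum_(i < K.+1) f (tick a (mesh a b K) i) ^+ 2 * mesh a b K
      - \int[mu]_(s in `]a, b]) f s ^+ 2| <= eta2 / 2.
  by apply: (riemann_sum ab cf2); rewrite divr_gt0.
exists (maxn K1 K2) => K; rewrite geq_max => /andP[k1 k2].
have h0 := mesh_gt0 K ab.
split.
  have mv : measurable_process (fun s w => u s w * f s).
    by apply: measurable_processM => //; apply: measurable_process_time; exact: continuous_measurable_fun.
  have bc : exists M' : R, forall w, `|c w| <= M' by exists M%:R.
  apply: le_trans (@ito_distance _ _ _ P B bm a (mesh a b K) a0 h0 _ (X n.+1) c
    (kernel_tick a b n.+1 K) K.+1 mv (X_conv n.+1) mc bc) _.
  apply: (@le_trans _ _ (4%:E * (22 * e)%:E)%E); last first.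
    by rewrite -EFinM lee_fin /e; lra.
  rewrite lee_wpmul2l ?lee_fin //.
  apply: le_trans (@square_norm_step_le _ _ _ P u c (u t) f a b K M%:R e (4 * e) eta kap
    u_measurable mcT (mut t_ge0) cf a0 ab _ (ltW e0) _ (ltW kap0) cM _ e2 _ _ _) _ => //.
  - by rewrite mulr_ge0 // ltW.
  - move=> s as' sb; apply/ltW/Hr; first exact: le_trans (ltW as').
    by apply: near_t => //; exact: ltW.
  - by move=> i x iK; exact: HK1.
  - move=> s s0 out; apply: HN1; first exact: leqW.
    case/orP: out => [|bs]; last first.
      by rewrite distrC (le_trans _ (ler_norm _)) // lerBrDl ltW.
    rewrite /a le_max leNgt s0 /= => sa.
    by rewrite (le_trans _ (ler_norm _)) // lerBrDl -lerBrDr.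
  - exact: integral_dilation_sqr_le1.
  rewrite QE -EFinM -EFinD lee_fin.
  have k1' : kap * Q <= e.
    by rewrite /kap mulrAC ler_pdivrMr ?ltr_wpDl // ler_wpM2l ?(ltW e0) // lerDl.
  have A0 : 0 <= 4 * M%:R ^+ 2 * (b - a).
    by rewrite mulr_ge0 ?subr_ge0 ?(ltW ab).
  have k2' : 4 * M%:R ^+ 2 * eta ^+ 2 * (b - a) <= e.
    rewrite mulrAC sqr_sqrtr; last by rewrite divr_ge0 ?(ltW e0) ?addr_ge0.
    by rewrite mulrA ler_pdivrMr ?ltr_wpDl // mulrC ler_wpM2l ?(ltW e0) // lerDl.
  exact: ler_budget1 k1' k2'.
set S := sum_prod _ _ _ _.
have S0 : 0 <= S by exact: sum_prod_ge0.
(* One half of [eta2] pays for the mass of the kernel missing from the interval, the other half for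
   the Riemann sum. *)
have SI : `|1 - S| <= eta2.
  pose I := \int[mu]_(s in `]a, b]) f s ^+ 2.
  have SE : S = \sum_(i < K.+1) f (tick a (mesh a b K) i) ^+ 2 * mesh a b K.
    by apply: eq_bigr => i _; rewrite -expr2.
  have Ifin : (\int[mu]_(s in `]a, b]) (f s ^+ 2)%:E \is a fin_num)%E.
    by apply: integrable_fin_num => //; exact: continuous_integrable_oc.
  have I1 : I <= 1 by rewrite -lee_fin fineK //; exact: integral_dilation_sqr_le1.
  have I2 : 1 - eta2 / 2 < I by rewrite -lte_fin fineK //; exact: HN2.
  have := HK2 K k2; rewrite -SE -/I => SI.
  rewrite (le_trans (ler_distD I _ _)) // [eta2]splitr lerD //; last by rewrite distrC.
  by rewrite ger0_norm ?subr_ge0 // ltW // ltrBlDr -ltrBlDl.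
have q1 : (1 - Num.sqrt S) ^+ 2 <= eta2 ^+ 2.
  rewrite -(real_normK (num_real (1 - _))) lerXn2r ?nnegrE ?(ltW eta20) //.
  exact: le_trans (ler_norm1_sqrt S0) SI.
have q2 : 2 * (M%:R ^+ 2 * (1 - Num.sqrt S) ^+ 2) <= e.
  apply: (@le_trans _ _ (2 * (M%:R ^+ 2 * eta2 ^+ 2))).
    by rewrite !ler_wpM2l.
  have A0 : 0 <= 2 * M%:R ^+ 2 :> R by rewrite mulr_ge0.
  rewrite mulrA sqr_sqrtr; last by rewrite divr_ge0 ?(ltW e0) ?addr_ge0.
  by rewrite mulrA ler_pdivrMr ?ltr_wpDl // mulrC ler_wpM2l ?(ltW e0) // lerDl.
rewrite (eq_integral (fun w => (((u t w - c w) + c w * (1 - Num.sqrt S)) ^+ 2)%:E)); last first.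
  by move=> w _; congr (_ ^+ 2)%:E; ring.
have m1 : measurable_fun setT (fun w => u t w - c w) by apply: measurable_funB => //; exact: mut.
have m2 : measurable_fun setT (fun w => c w * (1 - Num.sqrt S)) by exact: measurable_funM.
apply: le_trans (integral_sqr_add P m1 m2) _.
apply: (@le_trans _ _ (2%:E * (4 * e)%:E + (2 * (M%:R ^+ 2 * (1 - Num.sqrt S) ^+ 2))%:E)%E).
  apply: leeD; first by rewrite lee_wpmul2l ?lee_fin.
  rewrite [leRHS]EFinM lee_wpmul2l ?lee_fin //.
  apply: (@le_trans _ _ (\int[P]_w (cst (M%:R ^+ 2 * (1 - Num.sqrt S) ^+ 2)%:E w))%E).
    apply: ge0_le_integral => //.
    - by move=> w _; rewrite lee_fin sqr_ge0.
    - by apply/measurable_EFinP; exact: measurable_funX.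
    - move=> w _; rewrite lee_fin exprMn ler_wpM2r ?sqr_ge0 //.
      by rewrite -(real_normK (num_real (c w))) lerXn2r ?nnegrE.
  by rewrite integral_cst // [X in (_ * X)%E](_ : _ = 1%E) ?mule1 //; exact: probability_setT.
rewrite -EFinM -EFinD lee_fin; exact: ler_budget2.
Qed.

End approximation.

(** * Asymptotically orthogonal variables *)

(** A new summand adds a cross term, at most 2 p e, and a diagonal term, at most 4; passing from p^2
    to (p + 1)^2 leaves room for the former. *)
Lemma ler_growth (R : realType) (p : nat) (e x y z : R) : 0 <= e ->
  x <= 4 * p%:R + p%:R ^+ 2 * e -> y <= p%:R * e -> z <= 4 ->
  x + 2 * y + z <= 4 * p.+1%:R + p.+1%:R ^+ 2 * e.
Proof. by move=> e0 hx hy hz; rewrite -natr1; lra. Qed.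

(** Cauchy-Schwarz as the positivity of a quadratic form, taken at al = p e / A: it yields p^2 e^2 /
    A <= 4 p + p^2 e', and e' = e^2 / (4 A) lets the left side absorb the last term. *)
Lemma quadratic_contradiction (R : realFieldType) (p e e' A al YY YS SS : R) :
  0 < p -> 0 < e -> 0 < A -> 0 < al -> al * A = p * e -> e' * (4 * A) = e ^+ 2 -> YY <= A ->
  p * e <= YS -> SS <= 4 * p + p ^+ 2 * e' ->
  0 <= al ^+ 2 * YY - 2 * al * YS + SS -> p * e ^+ 2 <= 8 * A.
Proof.
move=> p0 e0 A0 al0 alA e'A hY hYS hS h.
have h1 : al ^+ 2 * YY <= al * (p * e).
  by rewrite -alA expr2 -mulrA ler_wpM2l ?(ltW al0) // ler_wpM2l // ltW.
have h2 : al * (p * e) <= al * YS by rewrite ler_wpM2l // ltW.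
have h3 : al * (p * e) <= 4 * p + p ^+ 2 * e' by clear -h h1 h2 hS; lra.
have h4 : al * (p * e) * A <= (4 * p + p ^+ 2 * e') * A by rewrite ler_wpM2r // ltW.
have h5 : al * (p * e) * A = p * (p * e ^+ 2).
  by rewrite mulrAC alA; ring.
have h6 : (4 * p + p ^+ 2 * e') * A = p * (4 * A + p * e ^+ 2 / 4).
  by rewrite -e'A; field.
move: h4; rewrite h5 h6 ler_pM2l // => h4.
by clear -h4 A0; lra.
Qed.

Section averaging.
Context d (T : measurableType d) (R : realType) (P : probability T R).
Variables (zeta : nat -> T -> R).
Hypothesis mzeta : forall n, measurable_fun setT (zeta n).
Hypothesis zeta2 : forall n w, `|zeta n w| <= 2.
Hypothesis decorrelated : forall eps : R, 0 < eps -> exists m0 : nat, forall m, (m0 <= m)%N ->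
  exists n0 : nat, forall n, (n0 <= n)%N -> `|\int[P]_w (zeta m w * zeta n w)| <= eps.

Let izz (f : T -> R) n (B : R) : measurable_fun setT f -> (forall w, `|f w| <= B) ->
  P.-integrable setT (EFin \o (fun w => f w * zeta n w)).
Proof.
move=> mf fB; apply: integrable_bddM fB _ => //.
exact: integrable_bdd (zeta2 n).
Qed.

Let Rint0 (f : T -> R) : (forall w, f w = 0) -> \int[P]_w f w = 0.
Proof.
move=> f0; rewrite -[RHS](Rintegral_cst_probability P 0).
by apply: eq_Rintegral => w _; rewrite f0.
Qed.

(* If [|E (Y zeta_n)| > e] along infinitely many [n], a sum [S] of [p] such
   terms, chosen with signs and nearly orthogonal, has [E (Y S) >= p e] although
   [E S^2] is of order [p]. *)
Lemma orthogonal_sums (Y : T -> R) (M e e' : R) (p : nat) :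
  measurable_fun setT Y -> (forall w, `|Y w| <= M) -> 0 < e' ->
  (forall N, exists2 n, (N <= n)%N & e < `|\int[P]_w (Y w * zeta n w)|) ->
  exists S : T -> R, exists B : R,
  [/\ measurable_fun setT S, (forall w, `|S w| <= B),
      p%:R * e <= \int[P]_w (Y w * S w),
      \int[P]_w (S w ^+ 2) <= 4 * p%:R + p%:R ^+ 2 * e' &
      exists n0 : nat, forall n, (n0 <= n)%N -> `|\int[P]_w (S w * zeta n w)| <= p%:R * e'].
Proof.
move=> mY YM e'0 often; elim: p => [|p [S [B [mS SB YS SS [n0 Hn0]]]]].
  exists (cst 0), 0; split => //.
  - by move=> w; rewrite normr0.
  - by rewrite mul0r Rint0 // => w; rewrite mulr0.
  - by rewrite Rint0 ?mulr0 ?expr0n ?mul0r ?addr0 // => w; rewrite expr0n.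
  - by exists 0%N => n _; rewrite Rint0 ?normr0 ?mul0r // => w; rewrite mul0r.
have [m0 Hm0] := decorrelated e'0.
(* Beyond [n0] the new variable is nearly orthogonal to the current sum; beyond [m0] it is so to
   every [zeta] of large enough index, which keeps the induction going. *)
have [n nN Yn] := often (maxn n0 m0).
have [nn0 nm0] : (n0 <= n)%N /\ (m0 <= n)%N by apply/andP; rewrite -geq_max.
have [n1 Hn1] := Hm0 n nm0.
(* The sign turns the contribution of the new term into |E (Y zeta_n)|, which exceeds e. *)
pose s : R := Num.sg (\int[P]_w (Y w * zeta n w)).
have s1 : `|s| <= 1.
  by rewrite /s normr_sg; case: (_ != 0); rewrite ?lexx ?ler01.
have iS m := izz m mS SB; have iY m := izz m mY YM; have iz m := izz m (mzeta n) (zeta2 n).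
have iYS : P.-integrable setT (EFin \o (fun w => Y w * S w)).
  exact: (integrable_bddM mY YM (integrable_bdd P mS SB)).
have iSS : P.-integrable setT (EFin \o (fun w => S w * S w)).
  exact: (integrable_bddM mS SB (integrable_bdd P mS SB)).
exists (fun w => S w + s * zeta n w), (B + 2); split.
- by apply: measurable_funD => //; exact: measurable_funM.
- move=> w; rewrite (le_trans (ler_normD _ _)) // lerD // normrM.
  by rewrite -[leRHS]mul1r ler_pM.
- rewrite (_ : \int[P]_w _ = \int[P]_w (Y w * S w + s * (Y w * zeta n w))); last first.
    by apply: eq_Rintegral => w _; ring.
  rewrite RintegralD //; last exact: integrable_RZ.
  rewrite RintegralZl // -natr1 mulrDl mul1r lerD //.
  by rewrite /s -normrEsg ltW.
- rewrite (_ : \int[P]_w _ = \int[P]_w ((S w * S w + 2 * s * (S w * zeta n w))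
     + s ^+ 2 * (zeta n w * zeta n w))); last first.
    by apply: eq_Rintegral => w _; ring.
  have iSz := integrable_RZ (2 * s) (iS n).
  rewrite RintegralD //; [|exact: integrable_RD|exact: integrable_RZ].
  rewrite RintegralD // !RintegralZl // -mulrA.
  apply: ler_growth; first exact: ltW.
  + by rewrite (_ : \int[P]_w _ = \int[P]_w (S w ^+ 2)).
  + apply: le_trans (ler_norm _) _; rewrite normrM -[leRHS]mul1r.
    by apply: ler_pM => //; exact: Hn0.
  + apply: le_trans (ler_norm _) _; rewrite normrM -[leRHS]mul1r.
    apply: ler_pM => //; first by rewrite normrX exprn_ile1.
    apply: Rintegral_bdd; first exact: measurable_funM.
    move=> w; rewrite normrM (_ : 4 = 2 * 2) ?ler_pM //; ring.
- exists (maxn n0 n1) => m; rewrite geq_max => /andP[m0' m1'].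
  rewrite (_ : \int[P]_w _ = \int[P]_w (S w * zeta m w + s * (zeta n w * zeta m w))); last first.
    by apply: eq_Rintegral => w _; ring.
  rewrite RintegralD //; last exact: integrable_RZ.
  rewrite RintegralZl // -natr1 mulrDl mul1r (le_trans (ler_normD _ _)) // lerD ?Hn0 //.
  rewrite normrM -[leRHS]mul1r; apply: ler_pM => //; exact: Hn1.
Qed.

Lemma decorrelated_cvg0 (Y : T -> R) (M : R) :
  measurable_fun setT Y -> (forall w, `|Y w| <= M) ->
  \int[P]_w (Y w * zeta n w) @[n --> \oo] --> (0 : R).
Proof.
move=> mY YM; apply/cvgrPdist_le => e e0.
apply: contrapT => notnear.
have often N : exists2 n, (N <= n)%N & e < `|\int[P]_w (Y w * zeta n w)|.
  apply: contrapT => H; apply: notnear; exists N => // n /= Nn.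
  rewrite sub0r normrN leNgt; apply/negP => en; apply: H; exists n => //.
have M0 : 0 <= M by exact: le_trans (YM point).
pose A := M ^+ 2 + 1; have A0 : 0 < A by rewrite ltr_wpDl ?sqr_ge0.
pose e' := e ^+ 2 / (4 * A); have e'0 : 0 < e' by rewrite divr_gt0 ?exprn_gt0 ?mulr_gt0.
(* Large enough for p e^2 > 8 A, which [quadratic_contradiction] rules out. *)
pose p := (Num.bound (8 * A / e ^+ 2)).+1.
have [S [B [mS SB YS SS _]]] := @orthogonal_sums Y M e e' p mY YM e'0 often.
have iY : P.-integrable setT (EFin \o (fun w => Y w * Y w)).
  exact: (integrable_bddM mY YM (integrable_bdd P mY YM)).
have iYS : P.-integrable setT (EFin \o (fun w => Y w * S w)).
  exact: (integrable_bddM mY YM (integrable_bdd P mS SB)).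
have iSS : P.-integrable setT (EFin \o (fun w => S w ^+ 2)).
  rewrite (_ : _ \o _ = EFin \o (fun w => S w * S w)); last by apply/funext => w /=; rewrite expr2.
  exact: (integrable_bddM mS SB (integrable_bdd P mS SB)).
pose al := p%:R * e / A.
have al0 : 0 < al by rewrite divr_gt0 ?mulr_gt0.
have sq0 : 0 <= \int[P]_w ((al * Y w - S w) ^+ 2) by apply: Rintegral_ge0 => w _; exact: sqr_ge0.
have YY : \int[P]_w (Y w * Y w) <= A.
  apply: le_trans (ler_norm _) _; apply: Rintegral_bdd; first exact: measurable_funM.
  move=> w; rewrite normrM (@le_trans _ _ (M * M)) ?ler_pM // -expr2 lerDl //.
have sqE : \int[P]_w ((al * Y w - S w) ^+ 2) =
    al ^+ 2 * \int[P]_w (Y w * Y w) - (2 * al) * \int[P]_w (Y w * S w) + \int[P]_w (S w ^+ 2).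
  rewrite (_ : \int[P]_w _ = \int[P]_w ((al ^+ 2 * (Y w * Y w) - (2 * al) * (Y w * S w)) + S w ^+ 2)); last first.
    by apply: eq_Rintegral => w _; ring.
  have i1 := integrable_RZ (al ^+ 2) iY; have i2 := integrable_RZ (2 * al) iYS.
  by rewrite RintegralD ?RintegralB ?RintegralZl //; exact: integrable_RB.
have pbig : 8 * A < p%:R * e ^+ 2.
  rewrite -ltr_pdivrMr ?exprn_gt0 //; apply: lt_le_trans (archi_boundP _) _.
    by rewrite divr_ge0 ?sqr_ge0 // mulr_ge0 ?ltW.
  by rewrite ler_nat leqnSn.
rewrite sqE in sq0.
have le8 : p%:R * e ^+ 2 <= 8 * A.
  apply: (quadratic_contradiction _ e0 A0 al0 _ _ YY YS SS sq0); first by rewrite ltr0n.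
  - by rewrite /al divfK // gt_eqF.
  - by rewrite /e' divfK // gt_eqF // mulr_gt0.
by move: (lt_le_trans pbig le8); rewrite ltxx.
Qed.

End averaging.

(** * The limit on the extension *)

Section extension.
Context d (T : measurableType d) (R : realType) (P : probability T R) (B : R -> T -> R).
Context d' (T' : measurableType d') (P' : probability T' R) (p : T' -> T) (Z : T' -> R).
Hypotheses (T_completed : completed_by P B) (ext : is_extension P P' p)
  (Z_measurable : measurable_fun setT Z) (Z_gaussian : gaussian P' Z 0 1)
  (Z_independent : independent P' (sigma_process (fun s w => B s (p w)))
     (preimage_set_system setT Z measurable)).

Lemma preimage_sigma_process A : sigma_process B A ->
  sigma_process (fun s w => B s (p w)) (p @^-1` A).
Proof.
move: A; rewrite /sigma_process /sigma_gen.
set G := \bigcup_(s in _) _; set G' := \bigcup_(s in _) _.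
suff sub : <<s G >> `<=` [set A | <<s G' >> (p @^-1` A)] by exact: sub.
apply: smallest_sub.
  split => /=.
  - by rewrite preimage_set0; exact: sigma_algebra0.
  - by move=> A GA; rewrite setTD preimage_setC -setTD; exact: sigma_algebraCD.
  - by move=> F GF; rewrite preimage_bigcup; exact: sigma_algebra_bigcup.
move=> A [s s0 [U mU <-]]; apply: sub_sigma_algebra; exists s => //.
by exists U => //; rewrite !setTI.
Qed.

(* The hypothesis only concerns [sigma_process]; a set of its completion is
   squeezed between two such sets of the same probability. *)
Lemma independent_extension A C : measurable A -> measurable C ->
  P' (p @^-1` A `&` Z @^-1` C) = (P' (p @^-1` A) * P' (Z @^-1` C))%E.
Proof.
have [mp pE] := ext.
move=> mA mC; have [L [U [sL sU LA AU UL0]]] := (T_completed A).1 mA.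
have mL : measurable L.
  apply/T_completed; exists L, L; split => //; by rewrite setDv measure0.
have mU : measurable U.
  apply/T_completed; exists U, U; split => //; by rewrite setDv measure0.
have PUL : P U = P L.
  apply/eqP; rewrite eq_le; apply/andP; split.
    rewrite -[in leLHS](setDUK (subset_trans LA AU)).
    apply: (le_trans (measureU2 P mL (measurableD mU mL))).
    by rewrite [X in (_ + X <= _)%E](_ : _ = 0%E) ?adde0.
  by apply: le_measure; rewrite ?inE //; exact: subset_trans LA AU.
have PAL : P A = P L.
  apply/eqP; rewrite eq_le; apply/andP; split.
    by rewrite -PUL; apply: le_measure; rewrite ?inE.
  by apply: le_measure; rewrite ?inE.
have mZC : measurable (Z @^-1` C) by rewrite -[X in measurable X]setTI; exact: Z_measurable.
have mpre D : measurable D -> measurable (p @^-1` D).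
  by move=> mD; rewrite -[X in measurable X]setTI; exact: mp.
have indL : P' (p @^-1` L `&` Z @^-1` C) = (P' (p @^-1` L) * P' (Z @^-1` C))%E.
  apply: Z_independent; first exact: preimage_sigma_process.
  by exists C => //; rewrite setTI.
have indU : P' (p @^-1` U `&` Z @^-1` C) = (P' (p @^-1` U) * P' (Z @^-1` C))%E.
  apply: Z_independent; first exact: preimage_sigma_process.
  by exists C => //; rewrite setTI.
apply/eqP; rewrite eq_le; apply/andP; split.
  apply: (@le_trans _ _ (P' (p @^-1` U `&` Z @^-1` C))).
    apply: le_measure; rewrite ?inE //; try by apply: measurableI => //; exact: mpre.
    by apply: setSI; exact: preimage_subset.
  by rewrite indU !pE // PUL PAL.
apply: (@le_trans _ _ (P' (p @^-1` L `&` Z @^-1` C))).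
  by rewrite indL !pE // PAL.
apply: le_measure; rewrite ?inE //; try by apply: measurableI => //; exact: mpre.
by apply: setSI; exact: preimage_subset.
Qed.

(** With [p w] frozen, [Z] is still standard normal, so the cosine integrates to cos kap times the
    characteristic function at v(p w). What is left depends on [p w] alone, whose law is [P]. *)
Lemma integral_extension_cos (Y v : T -> R) (M kap : R) :
  measurable_fun setT Y -> (forall w, `|Y w| <= M) -> measurable_fun setT v ->
  \int[P']_w (Y (p w) * cos (kap + v (p w) * Z w)) =
  \int[P]_w (Y w * (cos kap * gaussian_cf (v w))).
Proof.
have [mp pE] := ext.
move=> mY YM mv.
have mcos := @measurable_cos R.
have bnd x y : `|Y x * cos y| <= M.
  by rewrite normrM (le_trans _ (YM x)) // ler_piMr // cos_max.
pose F (z : T * R) := Y z.1 * cos (kap + v z.1 * z.2).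
have mF : measurable_fun setT F.
  apply: measurable_funM; first exact: (measurableT_comp mY).
  apply: (measurableT_comp mcos); apply: measurable_funD => //.
  by apply: measurable_funM => //; exact: (measurableT_comp mv).
have mYp : measurable_fun setT (fun w => Y (p w)) by exact: (measurableT_comp mY).
have mvp : measurable_fun setT (fun w => v (p w)) by exact: (measurableT_comp mv).
pose G x := Y x * (cos kap * gaussian_cf (v x)).
have mG : measurable_fun setT G.
  apply: measurable_funM => //; apply: measurable_funM => //.
  by apply: measurableT_comp mv; exact: (continuous_measurable_fun (@continuous_gaussian_cf R)).
have GM w : `|G w| <= M.
  rewrite normrM (le_trans _ (YM w)) // ler_piMr // normrM mulr_ile1 ?cos_max //.
  exact: gaussian_cf_norm.
have mZc x : measurable_fun setT (fun w => cos (kap + v x * Z w)).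
  by apply: (measurableT_comp mcos); apply: measurable_funD => //; exact: measurable_funM.
have mYZc x : measurable_fun setT (fun w => Y x * cos (kap + v x * Z w)).
  by apply: measurable_funM; [exact: measurable_cst|exact: mZc].
transitivity (\int[P']_w G (p w)).
  congr fine.
  rewrite (@integral_independent _ _ _ _ _ _ _ P' p Z F) //.
  - apply: eq_integral => w _; rewrite -EFin_Rintegral.
      congr EFin; rewrite /F /= RintegralZl //.
        by rewrite (integral_gaussian_cos Z_measurable (oner_neq0 _) Z_gaussian) mulr1.
      apply: (@integrable_bdd _ _ _ _ _ 1); last by move=> ?; exact: cos_max.
      exact: mZc.
    apply: (@integrable_bdd _ _ _ _ _ M); last by move=> ?; exact: bnd.
    exact: (mYZc (p w)).
  - exact: independent_extension.
  - apply: (@integrable_bdd _ _ _ _ _ M); last by move=> ?; exact: bnd.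
    by apply: (measurableT_comp mF); exact/measurable_fun_pairP.
  - move=> x; apply: (@integrable_bdd _ _ _ _ _ M); last by move=> ?; exact: bnd.
    exact: mYZc.
pose pm : {mfun T' >-> T} := HB.pack p (isMeasurableFun.Build _ _ _ _ _ mp).
have mEG : measurable_fun setT (EFin \o G) by exact/measurable_EFinP.
congr fine; rewrite -[LHS](@integral_distribution _ _ _ _ _ P' pm (EFin \o G)) //.
  by apply: eq_measure_integral => A mA _; exact: pE.
apply: (@integrable_bdd _ _ _ P' (G \o p) M); first exact: (measurableT_comp mG).
by move=> w; exact: GM.
Qed.

End extension.

(** * Stable convergence *)

Section L1_estimates.
Context d (T : measurableType d) (R : realType) (P : probability T R).
Implicit Types f x z : T -> R.

Lemma ler_rms (rho y : R) : 0 < rho -> `|y| <= rho + rho^-1 * y ^+ 2.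
Proof.
move=> rho0; rewrite -(ler_pM2l rho0) mulrDr mulrA mulfV ?gt_eqF // mul1r.
rewrite -(real_normK (num_real y)); have := normr_ge0 y.
by move: `|y| => z z0; nra.
Qed.

(** The bound |y| <= rho + y^2 / rho replaces Cauchy-Schwarz at the price of a factor 2, and gives
    integrability as well. *)
Lemma integral_norm_rms f (rho : R) : measurable_fun setT f -> 0 < rho ->
  (\int[P]_w (f w ^+ 2)%:E <= (rho ^+ 2)%:E)%E ->
  P.-integrable setT (EFin \o (fun w => `|f w|)) /\ \int[P]_w `|f w| <= 2 * rho.
Proof.
move=> mf rho0 frho.
have mf2 : measurable_fun setT (fun w => f w ^+ 2) by exact: measurable_funX.
have if2 : P.-integrable setT (EFin \o (fun w => f w ^+ 2)).
  apply/integrableP; split; first exact/measurable_EFinP.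
  apply: le_lt_trans (ltry (rho ^+ 2)); apply: le_trans frho.
  rewrite le_eqVlt; apply/orP; left; apply/eqP; apply: eq_integral => w _ /=.
  by rewrite ger0_norm ?sqr_ge0.
have ib : P.-integrable setT (EFin \o (fun w => cst rho w + rho^-1 * f w ^+ 2)).
  apply: integrable_RD; last exact: integrable_RZ.
  by apply: (@integrable_bdd _ _ _ _ _ `|rho|).
have ifn : P.-integrable setT (EFin \o (fun w => `|f w|)).
  apply: integrable_Rle ib _; first exact: measurableT_comp.
  by move=> w; rewrite normr_id; exact: ler_rms.
split=> //; apply: (@le_trans _ _ (\int[P]_w (cst rho w + rho^-1 * f w ^+ 2))).
  by apply: le_Rintegral => // w _; exact: ler_rms.
rewrite RintegralD //; last 2 first.
- by apply: (@integrable_bdd _ _ _ _ _ `|rho|).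
- exact: integrable_RZ.
rewrite Rintegral_cst_probability RintegralZl // mulrDl mul1r lerD2l.
rewrite ler_pdivrMl // -expr2 -lee_fin EFin_Rintegral //.
Qed.

(** The difference of the products is z2 (z1 - x1) + x1 (z2 - x2), and both outer factors are
    bounded by 2. *)
Lemma integralM_close z1 z2 x1 x2 (e e' : R) :
  measurable_fun setT z1 -> measurable_fun setT z2 ->
  measurable_fun setT x1 -> measurable_fun setT x2 ->
  (forall w, `|z1 w| <= 2) -> (forall w, `|z2 w| <= 2) ->
  (forall w, `|x1 w| <= 2) -> (forall w, `|x2 w| <= 2) ->
  \int[P]_w `|z1 w - x1 w| <= e -> \int[P]_w `|z2 w - x2 w| <= e ->
  `|\int[P]_w (x1 w * x2 w)| <= e' -> `|\int[P]_w (z1 w * z2 w)| <= 2 * e + 2 * e + e'.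
Proof.
move=> mz1 mz2 mx1 mx2 z1b z2b x1b x2b h1 h2 h12.
have iM (f g : T -> R) : measurable_fun setT f -> measurable_fun setT g ->
    (forall w, `|f w| <= 2) -> (forall w, `|g w| <= 2) ->
    P.-integrable setT (EFin \o (fun w => f w * g w)).
  move=> mf mg fb gb; apply: (integrable_bddM mf fb).
  exact: (@integrable_bdd _ _ _ _ _ 2).
have iB (f g : T -> R) : measurable_fun setT f -> measurable_fun setT g ->
    (forall w, `|f w| <= 2) -> (forall w, `|g w| <= 2) ->
    P.-integrable setT (EFin \o (fun w => 2 * `|f w - g w|)).
  move=> mf mg fb gb; apply: integrable_RZ.
  apply: (@integrable_bdd _ _ _ _ _ 4).
    by apply: measurableT_comp => //; exact: measurable_funB.
  move=> w; rewrite normr_id (le_trans (ler_normB _ _)) // (_ : 4 = 2 + 2) ?lerD //.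
  by rewrite -natrD.
rewrite (_ : \int[P]_w (z1 w * z2 w) =
    \int[P]_w (z1 w * z2 w - x1 w * x2 w) + \int[P]_w (x1 w * x2 w)); last first.
  by rewrite RintegralB ?subrK //; exact: iM.
apply: (le_trans (ler_normD _ _)); apply: lerD => //.
have iD : P.-integrable setT (EFin \o (fun w => z1 w * z2 w - x1 w * x2 w)).
  by apply: integrable_RB; exact: iM.
apply: (le_trans (le_normr_Rintegral measurableT iD)).
apply: (@le_trans _ _ (\int[P]_w (2 * `|z1 w - x1 w| + 2 * `|z2 w - x2 w|))).
  apply: le_Rintegral => //; first exact: integrable_norm.
    by apply: integrable_RD; exact: iB.
  move=> w _; rewrite (_ : _ - _ = z2 w * (z1 w - x1 w) + x1 w * (z2 w - x2 w)); last by ring.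
  by apply: (le_trans (ler_normD _ _)); rewrite !normrM lerD // ler_wpM2r.
have iN (f g : T -> R) : measurable_fun setT f -> measurable_fun setT g ->
    (forall w, `|f w| <= 2) -> (forall w, `|g w| <= 2) ->
    \int[P]_w (2 * `|f w - g w|) = 2 * \int[P]_w `|f w - g w|.
  move=> mf mg fb gb; rewrite RintegralZl //.
  apply: (@integrable_bdd _ _ _ _ _ 4).
    by apply: measurableT_comp => //; exact: measurable_funB.
  move=> w; rewrite normr_id (le_trans (ler_normB _ _)) // (_ : 4 = 2 + 2) ?lerD //.
  by rewrite -natrD.
rewrite RintegralD //; [|exact: iB|exact: iB].
by rewrite !iN // lerD // ler_wpM2l.
Qed.

End L1_estimates.

Lemma ler_lipschitz_sum (R : realType) (l x y z w k : R) : `|k| <= 1 -> `|x| <= `|l| * z -> `|y| <= `|l| * w ->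
  `|x - k * y| <= `|l| * (z + w).
Proof.
move=> k1 xz yw; apply: (le_trans (ler_normB _ _)); rewrite mulrDr lerD //.
by rewrite normrM (le_trans _ yw) // ler_piMl.
Qed.

Section close.
Context d (T : measurableType d) (R : realType) (P : probability T R) (B : R -> T -> R).
Hypothesis bm : brownian_motion P B.

(** [gauss_var] at (lam c)^2 S is the characteristic function at lam c sqrt S, so both differences
    are Lipschitz in the quantities controlled by the two L^2 bounds; each costs 2 |lam| rho in
    L^1. *)
Lemma centered_cos_close (a h lam kap rho : R) (g : nat -> R) k (c V X : T -> R) :
  0 <= a -> 0 < h -> 0 < rho ->
  measurable_fun setT c -> measurable_fun setT V -> measurable_fun setT X ->
  (\int[P]_w ((X w - c w * brownian_sum B a h g k w) ^+ 2)%:E <= (rho ^+ 2)%:E)%E ->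
  (\int[P]_w ((V w - c w * Num.sqrt (sum_prod h g g k)) ^+ 2)%:E <= (rho ^+ 2)%:E)%E ->
  \int[P]_w `|(cos (kap + lam * X w) - cos kap * gaussian_cf (lam * V w))
     - centered_cos B a h kap (fun w => lam * c w) g k w| <= `|lam| * (4 * rho).
Proof.
move=> a0 h0 rho0 mc mV mX h1 h2.
pose f1 w := X w - c w * brownian_sum B a h g k w.
pose f2 w := V w - c w * Num.sqrt (sum_prod h g g k).
have mf1 : measurable_fun setT f1.
  apply: measurable_funB => //; apply: measurable_funM => //.
  exact: (measurable_brownian_sum bm).
have mf2 : measurable_fun setT f2 by apply: measurable_funB => //; exact: measurable_funM.
have [i1 e1] := integral_norm_rms mf1 rho0 h1.
have [i2 e2] := integral_norm_rms mf2 rho0 h2.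
have mcos := @measurable_cos R.
have mgcf := continuous_measurable_fun (@continuous_gaussian_cf R).
have mlc : measurable_fun setT (fun w => lam * c w) by exact: measurable_funM.
have mz : measurable_fun setT (fun w => cos (kap + lam * X w) - cos kap * gaussian_cf (lam * V w)).
  apply: measurable_funB.
    apply: (measurableT_comp mcos); apply: measurable_funD => //.
    exact: measurable_funM.
  apply: measurable_funM => //; apply: (measurableT_comp mgcf).
  exact: measurable_funM.
have ib : P.-integrable setT (EFin \o (fun w => `|lam| * (`|f1 w| + `|f2 w|))).
  by apply: integrable_RZ; exact: integrable_RD.
have le w : `|(cos (kap + lam * X w) - cos kap * gaussian_cf (lam * V w))
     - centered_cos B a h kap (fun w => lam * c w) g k w| <= `|lam| * (`|f1 w| + `|f2 w|).
  rewrite /centered_cos.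
  have -> : (lam * c w) ^+ 2 * sum_prod h g g k =
      (lam * (c w * Num.sqrt (sum_prod h g g k))) ^+ 2.
    by rewrite mulrA [in RHS]exprMn sqr_sqrtr // sum_prod_ge0.
  have alg (x q y z v : R) : x - q * y - (z - q * v) = (x - z) - q * (y - v) by ring.
  rewrite gauss_var_sqr alg.
  apply: ler_lipschitz_sum; first exact: cos_max.
    apply: (le_trans (cos_lipschitz _ _)); rewrite -normrM le_eqVlt; apply/orP; left.
    by apply/eqP; congr `|_|; rewrite /f1; ring.
  by apply: (le_trans (gaussian_cf_lipschitz _ _)); rewrite -mulrBr normrM.
have mx := measurable_centered_cos bm a0 h0 kap g k mlc.
apply: (@le_trans _ _ (\int[P]_w (`|lam| * (`|f1 w| + `|f2 w|)))).
  apply: le_Rintegral => //.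
  apply: integrable_Rle ib _; last by move=> w; rewrite normr_id.
  by apply: measurableT_comp => //; exact: measurable_funB.
rewrite RintegralZl //; last exact: integrable_RD.
rewrite RintegralD // ler_wpM2l // (_ : 4 * rho = 2 * rho + 2 * rho) ?lerD //.
by rewrite -mulrDl -natrD.
Qed.

End close.

Lemma ler_rho (R : realFieldType) (eps l rho : R) : 0 <= l -> 0 < eps ->
  rho = eps / (32 * (l + 1)) -> 2 * (l * (4 * rho)) + 2 * (l * (4 * rho)) + eps / 2 <= eps.
Proof.
move=> l0 eps0 ->; have l1 : 0 < l + 1 by lra.
have -> : 2 * (l * (4 * (eps / (32 * (l + 1))))) = eps / 4 * (l / (l + 1)).
  by field; rewrite gt_eqF.
have h : l / (l + 1) <= 1 by rewrite ler_pdivrMr // mul1r lerDl.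
have : eps / 4 * (l / (l + 1)) <= eps / 4 by rewrite ler_piMr // divr_ge0 // ltW.
by clear; lra.
Qed.

Lemma ler_eta (R : realFieldType) (eps q eta s : R) : 0 <= q -> 0 < eps ->
  eta = eps / (4 * (q + 1)) -> s <= 2 * eta -> q * s <= eps / 2.
Proof.
move=> q0 eps0 -> hs; have q1 : 0 < q + 1 by lra.
apply: (le_trans (ler_wpM2l q0 hs)).
have -> : q * (2 * (eps / (4 * (q + 1)))) = eps / 2 * (q / (q + 1)).
  by field; rewrite gt_eqF.
by rewrite ler_piMr ?divr_ge0 ?(ltW eps0) // ler_pdivrMr // mul1r lerDl.
Qed.

Section stable_limit.
Context d (T : measurableType d) (R : realType) (P : probability T R) (B u : R -> T -> R).
Notation mu := (@lebesgue_measure R).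
Hypotheses (bm : brownian_motion P B) (u_measurable : measurable_process u)
  (u_adapted : adapted B u) (u_square_integrable : (square_norm P u < +oo)%E).
Variable t : R.
Hypotheses (t_ge0 : 0 <= t) (u_continuous : L2_continuous_at P u t).
Variable psi : R -> R.
Hypothesis psi_ge0 : forall x, 0 <= psi x.
Hypothesis psi_continuous : continuous psi.
Hypothesis psi_bounded : exists M : R, forall x, psi x <= M.
Hypothesis psi_norm : (\int[mu]_x ((psi x) ^+ 2)%:E = 1)%E.
Hypothesis psi_littleo : littleo_infinity (fun x => (psi x) ^+ 2) (fun x => `|x|^-1).
Hypothesis psi_boundary : t = 0 ->
  (\int[mu]_(x in `]-oo, 0%R]) ((psi x) ^+ 2)%:E = 1)%E.
Variable X : nat -> T -> R.
Hypothesis X_conv : forall n, is_stochastic_convolution P B u (dilation psi n) t (X n).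
Variables lam kap : R.

(** The index is shifted because the dilation by 0 vanishes identically. *)
Definition centered_convolution n w :=
  cos (kap + lam * X n.+1 w) - cos kap * gaussian_cf (lam * u t w).
Notation zeta := centered_convolution.

Let mX n : measurable_fun setT (X n). Proof. exact: (X_conv n).1. Qed.

Let mut : measurable_fun setT (u t).
Proof. exact: (measurable_wrt_measurable bm (u_adapted t_ge0)). Qed.

Let mgcf : measurable_fun setT (fun w => gaussian_cf (lam * u t w)).
Proof.
apply: (measurableT_comp (continuous_measurable_fun (@continuous_gaussian_cf R))).
exact: measurable_funM.
Qed.

Let mcosX n : measurable_fun setT (fun w => cos (kap + lam * X n w)).
Proof.
apply: (measurableT_comp (@measurable_cos R)); apply: measurable_funD => //.
exact: measurable_funM.
Qed.

Lemma measurable_centered_convolution n : measurable_fun setT (zeta n).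
Proof. by apply: measurable_funB => //; exact: measurable_funM. Qed.

Lemma centered_convolution_norm n w : `|zeta n w| <= 2.
Proof.
apply: le_trans (ler_normB _ _) _.
by apply: (@lerD _ _ 1 _ 1); rewrite ?normrM ?mulr_ile1 ?cos_max ?gaussian_cf_norm.
Qed.

(** One eta pays for the integral of the product of the kernels, the other for its Riemann sum. *)
Lemma kernel_tick_overlap a b m (eta : R) : a < b -> 0 < eta ->
  exists N : nat, forall n, (N <= n)%N -> exists K0 : nat, forall K, (K0 <= K)%N ->
    `|sum_prod (mesh a b K) (kernel_tick t psi a b m K) (kernel_tick t psi a b n K) K.+1|
      <= 2 * eta.
Proof.
move=> ab eta0.
have [N HN] := dilation_cross psi_ge0 psi_continuous psi_norm psi_littleo t m psi_bounded (ltW ab) eta0.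
exists N => n nN.
pose f s := dilation psi n (t - s) * dilation psi m (t - s).
have cf : continuous f.
  by move=> s; apply: cvgM; exact: continuous_dilationB.
have [K0 HK] := riemann_sum ab cf eta0.
exists K0 => K /HK rs; have /andP[I0 I1] := HN n nN.
rewrite /sum_prod (_ : \sum_(i < _) _ = \sum_(i < K.+1) f (tick a (mesh a b K) i) * mesh a b K); last first.
  by apply: eq_bigr => i _; congr (_ * _); exact: mulrC.
rewrite -[X in `|X|](subrK (\int[mu]_(s in `]a, b]) f s)).
apply: (le_trans (ler_normD _ _)); rewrite mulr2n mulrDl mul1r lerD //.
by rewrite ger0_norm.
Qed.

Lemma centered_convolution_decorrelated (eps : R) : 0 < eps ->
  exists m0 : nat, forall m, (m0 <= m)%N ->
  exists n0 : nat, forall n, (n0 <= n)%N -> `|\int[P]_w (zeta m w * zeta n w)| <= eps.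
Proof.
(* Replacing each of the two variables costs at most 2 |lam| 4 rho <= eps / 4; the other half of
   [eps] is left for the covariance. *)
move=> eps0; pose rho := eps / (32 * (`|lam| + 1)).
have rho0 : 0 < rho by rewrite divr_gt0 ?mulr_gt0 // ltr_wpDl.
have [a [b [c [M [a0 ab mc cM [N HN]]]]]] := stochastic_convolution_approx bm u_measurable
  u_adapted u_square_integrable t_ge0 u_continuous psi_continuous psi_norm
  psi_littleo psi_boundary X_conv (exprn_gt0 2 rho0).
have mcT := measurable_wrt_measurable bm mc.
exists N => m mN.
pose q := (`|lam| * M) ^+ 2; have q0 : 0 <= q by exact: sqr_ge0.
(* The covariance of the two sums will be at most 2 eta, and q times this is at most eps / 2. *)
pose eta := eps / (4 * (q + 1)).
have eta0 : 0 < eta by rewrite divr_gt0 ?mulr_gt0 // ltr_wpDl.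
have [N1 HN1] := kernel_tick_overlap m.+1 ab eta0.
exists (maxn N N1) => n; rewrite geq_max => /andP[nN nN1].
have [Km HKm] := HN m mN; have [Kn HKn] := HN n nN.
have [Ks HKs] := HN1 n.+1 (leqW nN1).
(* A single mesh for both indices: the covariance bound needs two sums over the same partition, with
   the same [c]. *)
pose K := maxn (maxn Km Kn) Ks.
have Km_le : (Km <= K)%N by rewrite !leq_max leqnn.
have Kn_le : (Kn <= K)%N by rewrite !leq_max leqnn orbT.
have Ks_le : (Ks <= K)%N by rewrite leq_max leqnn orbT.
have [m1 m2] := HKm K Km_le; have [n1 n2] := HKn K Kn_le; have S12 := HKs K Ks_le.
have h0 := mesh_gt0 K ab.
have em := centered_cos_close bm lam kap a0 h0 rho0 mcT mut (mX m.+1) m1 m2.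
have en := centered_cos_close bm lam kap a0 h0 rho0 mcT mut (mX n.+1) n1 n2.
have mlc : measurable_wrt (natural_filtration B a) (fun w => lam * c w).
  by apply: measurable_wrtM => //; exact: measurable_wrt_cst.
have lcM w : `|lam * c w| <= `|lam| * M by rewrite normrM ler_wpM2l.
have mlcT := measurable_wrt_measurable bm mlc.
have xx := integral_centered_cosM bm a0 h0 (kernel_tick t psi a b m.+1 K)
  (kernel_tick t psi a b n.+1 K) K.+1 kap mlc lcM.
apply: le_trans (ler_rho (normr_ge0 lam) eps0 (erefl rho)).
apply: (integralM_close _ _ _ _ _ _ _ _ em en).
- exact: measurable_centered_convolution.
- exact: measurable_centered_convolution.
- exact: (measurable_centered_cos bm a0 h0).
- exact: (measurable_centered_cos bm a0 h0).
- exact: centered_convolution_norm.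
- exact: centered_convolution_norm.
- by move=> w; exact: centered_cos_norm.
- by move=> w; exact: centered_cos_norm.
- by apply: (le_trans xx); exact: ler_eta q0 eps0 (erefl eta) S12.
Qed.

Lemma cvg_integral_cos_convolution (Y : T -> R) (M : R) :
  measurable_fun setT Y -> (forall w, `|Y w| <= M) ->
  \int[P]_w (Y w * cos (kap + lam * X n w)) @[n --> \oo] -->
  \int[P]_w (Y w * (cos kap * gaussian_cf (lam * u t w))).
Proof.
move=> mY YM; rewrite -cvg_shiftS.
have bdd (f : T -> R) : measurable_fun setT f -> (forall w, `|f w| <= 2) ->
    P.-integrable setT (EFin \o (fun w => Y w * f w)).
  move=> mf fb; apply: (integrable_bddM mY YM).
  exact: (@integrable_bdd _ _ _ _ _ 2).
have mL : measurable_fun setT (fun w => cos kap * gaussian_cf (lam * u t w)).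
  exact: measurable_funM.
have L2 w : `|cos kap * gaussian_cf (lam * u t w)| <= 2.
  apply: (@le_trans _ _ 1); last by rewrite ler1n.
  by rewrite normrM mulr_ile1 ?cos_max ?gaussian_cf_norm.
rewrite (_ : (fun n => _) = fun n => \int[P]_w (Y w * zeta n w) +
    \int[P]_w (Y w * (cos kap * gaussian_cf (lam * u t w)))); last first.
  apply/funext => n; rewrite -RintegralD //; last 2 first.
  - by apply: bdd; [exact: measurable_centered_convolution|exact: centered_convolution_norm].
  - exact: bdd.
  by apply: eq_Rintegral => w _; rewrite -mulrDr subrK.
set L := \int[P]_w (Y w * (cos kap * gaussian_cf (lam * u t w))).
have lim : \int[P]_w (Y w * zeta n w) + L @[n --> \oo] --> 0 + L.
  apply: cvgD; last exact: cvg_cst.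
  exact: (decorrelated_cvg0 measurable_centered_convolution centered_convolution_norm
    centered_convolution_decorrelated mY YM).
by rewrite add0r in lim.
Qed.

End stable_limit.

Theorem theorem3p5 (R : realType)
  (d : measure_display) (T : measurableType d) (P : probability T R)
  (B : R -> T -> R)
  (B_brownian : brownian_motion P B)
  (T_completed : completed_by P B)
  (u : R -> T -> R)
  (u_measurable : measurable_process u)
  (u_adapted : adapted B u)
  (u_square_integrable : (square_norm P u < +oo)%E)
  (t : R) (t_ge0 : 0 <= t)
  (u_continuous : L2_continuous_at P u t)
  (psi : R -> R)
  (psi_ge0 : forall x, 0 <= psi x)
  (psi_continuous : continuous psi)
  (psi_bounded : exists M : R, forall x, psi x <= M)
  (psi_norm : (\int[lebesgue_measure]_x ((psi x) ^+ 2)%:E = 1)%E)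
  (psi_littleo : littleo_infinity (fun x => (psi x) ^+ 2) (fun x => `|x|^-1))
  (* For t > 0 the variance of int psi_n(t - s) dB_s over s >= 0 tends to
     int psi^2 = 1, but at t = 0 it tends to the integral over ]-oo, 0]. *)
  (psi_boundary : t = 0 ->
     (\int[lebesgue_measure]_(x in `]-oo, 0%R]) ((psi x) ^+ 2)%:E = 1)%E)
  (X : nat -> T -> R)
  (X_conv : forall n, is_stochastic_convolution P B u (dilation psi n) t (X n))
  (d' : measure_display) (T' : measurableType d') (P' : probability T' R)
  (p : T' -> T)
  (T'_extension : is_extension P P' p)
  (Z : T' -> R)
  (Z_measurable : measurable_fun setT Z)
  (Z_gaussian : gaussian P' Z 0 1)
  (Z_independent : independent P' (sigma_process (fun s w => B s (p w)))
     (preimage_set_system setT Z measurable)) :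
  stable_cvg P P' p X (fun w => u t (p w) * Z w).
Proof.
have cvg_shifted_cos (lam kap M : R) (Y : T -> R) (f : R -> R) :
    f =1 (fun x => cos (kap + x)) -> measurable_fun setT Y -> (forall w, `|Y w| <= M) ->
    (\int[P]_w (Y w * f (lam * X n w))%:E)%E @[n --> \oo] -->
    (\int[P']_w (Y (p w) * f (lam * (u t (p w) * Z w)))%:E)%E.
  move=> /funext -> mY YM.
  have mX n : measurable_fun setT (X n) := (X_conv n).1.
  have mut := measurable_wrt_measurable B_brownian (u_adapted t t_ge0).
  have mp := T'_extension.1.
  have Ycos T0 (V g : T0 -> R) : (forall w, `|V w| <= M) -> forall w, `|V w * cos (g w)| <= M.
    by move=> VM w; rewrite normrM (le_trans _ (VM w)) // ler_piMr // cos_max.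
  have -> : (\int[P']_w (Y (p w) * cos (kap + lam * (u t (p w) * Z w)))%:E)%E =
      (\int[P]_w (Y w * (cos kap * gaussian_cf (lam * u t w))))%:E.
    rewrite -EFin_Rintegral; last first.
      apply: (@integrable_bdd _ _ _ _ _ M); last by apply: Ycos => w; exact: YM.
      apply: measurable_funM; first exact: (measurableT_comp mY).
      apply: (measurableT_comp (@measurable_cos R)); apply: measurable_funD => //.
      apply: measurable_funM => //; apply: measurable_funM => //.
      exact: (measurableT_comp mut).
    congr EFin; under eq_Rintegral do rewrite mulrA.
    apply: (@integral_extension_cos _ _ _ _ _ _ _ _ _ _ T_completed T'_extension Z_measurable
      Z_gaussian Z_independent _ (fun w => lam * u t w) M) => //.
    exact: measurable_funM.
  apply: cvg_EFin; last first.
    exact: (cvg_integral_cos_convolution B_brownian u_measurable u_adapted u_square_integrable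
      t_ge0 u_continuous psi_ge0 psi_continuous psi_bounded psi_norm psi_littleo psi_boundary
      X_conv mY YM).
  apply: nearW => n; apply: integrable_fin_num => //.
  apply: (@integrable_bdd _ _ _ _ _ M); last by apply: Ycos => w; exact: YM.
  apply: measurable_funM => //.
  apply: (measurableT_comp (@measurable_cos R)); apply: measurable_funD => //.
  exact: measurable_funM.
move=> lam Y mY [M YM].
split; [apply: (cvg_shifted_cos lam 0 M)|apply: (cvg_shifted_cos lam (- (pi / 2)) M)] => // x.
- by rewrite add0r.
- by rewrite addrC cosBpihalf.
Qed.
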